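(* Let $w$ be a function on $[-1,1]$ for which there exist $m>0$ and points $-1<s_1<s_2<\dots<s_L<1$ such that $w(x)\ge m$ for every $-1\le x\le 1$ and $w$ is absolutely continuous on each of the intervals $[-1,s_1),(s_1,s_2),\dots,(s_L,1]$. Then for every $\varepsilon>0$ there exists $C(w,\varepsilon)>0$ (independent of $n$) such that for every integer $n\ge1$, $$|\pi'(x)-w(x)|\le\varepsilon$$ for every point $x\in(-1,1)$ at which $\pi$ is differentiable and which satisfies $1-x^2\ge \frac{C(w,\varepsilon)}{n^2}$ and $|s_i-x|\ge \frac{C(w,\varepsilon)}{n}$ for all $1\le i\le L$.
   Context: Fix an integer $n\ge1$. Let $\mathcal{M}_n$ be the set of positive Borel measures $\mu$ on $[-1,1]$ such that $\int_{-1}^1 p(t)w(t)\,dt=\int p\,d\mu$ for every polynomial $p$ of degree at most $2n-1$. For $-1\le x\le 1$ define $\pi(x):=\sup_{\mu\in\mathcal{M}_n}\mu([-1,x])$ (it depends on $n$ and $w$). Absolute continuity on each of the listed intervals means that $w$ is the sum of an absolutely continuous function on $[-1,1]$ and a step function with discontinuities only at $s_1,\dots,s_L$. *)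

(* Defs.v *)
From HB Require Import structures.
From mathcomp Require Import all_boot all_order all_algebra.
From mathcomp Require Import all_classical all_reals all_analysis.
Set Implicit Arguments. Unset Strict Implicit. Unset Printing Implicit Defensive.
Import Order.TTheory GRing.Theory Num.Theory.
Import numFieldNormedType.Exports.
Local Open Scope classical_set_scope.
Local Open Scope ring_scope.

Definition abs_continuous_on {R : realType} (f : R -> R) (lo hi : R) : Prop :=
  forall e : R, 0 < e -> exists2 d : R, 0 < d &
    forall (k : nat) (a b : nat -> R),
      (forall i, (i < k)%N -> lo <= a i /\ a i <= b i /\ b i <= hi) ->
      (forall i, (i.+1 < k)%N -> b i <= a i.+1) ->
      \sum_(i < k) (b i - a i) < d ->
      \sum_(i < k) `|f (b i) - f (a i)| < e.

Definition knot {R : realType} (L : nat) (s : nat -> R) (j : nat) : R :=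
  if j == 0%N then -1 else if (j <= L)%N then s j.-1 else 1.

(* The j-th piece (0 <= j <= L): [-1,s_1), (s_1,s_2), ..., (s_L,1]
   (with the paper's 1-based s_i = our s (i-1)). *)
Definition piece {R : realType} (L : nat) (s : nat -> R) (j : nat) : set R :=
  [set x | (knot L s j < x \/ (j = 0%N /\ x = -1)) /\
           (x < knot L s j.+1 \/ (j = L /\ x = 1))].

Definition step_fun_on {R : realType} (L : nat) (s : nat -> R) (h : R -> R) : Prop :=
  forall j, (j <= L)%N -> exists c : R, forall x, piece L s j x -> h x = c.

Definition admissible_weight {R : realType} (w : R -> R) (m : R)
    (L : nat) (s : nat -> R) : Prop :=
  0 < m /\
  (forall i, (i < L)%N -> -1 < s i /\ s i < 1) /\
  (forall i, (i.+1 < L)%N -> s i < s i.+1) /\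
  (forall x, -1 <= x <= 1 -> m <= w x) /\
  exists g h : R -> R, abs_continuous_on g (-1) 1 /\ step_fun_on L s h /\
    forall x, -1 <= x <= 1 -> w x = g x + h x.

Definition quad_measures {R : realType} (w : R -> R) (n : nat)
    : set {measure set (measurableTypeR R) -> \bar R} :=
  [set mu : {measure set (measurableTypeR R) -> \bar R} | mu (~` `[(-1)%R, 1%R]) = 0%E /\
     forall p : {poly R}, (size p <= 2 * n)%N ->
       (\int[lebesgue_measure]_(x in `[(-1)%R, 1%R]) (p.[x] * w x)%:E =
        \int[mu]_(x in `[(-1)%R, 1%R]) (p.[x])%:E)%E].

(* pi(x) = sup_{mu in M_n} mu([-1,x]) (a finite real number). *)
Definition pi_fun {R : realType} (w : R -> R) (n : nat) (x : R) : R :=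
  fine (ereal_sup [set mu `[(-1)%R, x]%classic | mu in quad_measures w n]).

(* Main.v *)
(* By duality [pi(x)] is the minimum of [L p], where [L q] is the integral of
   [q w], over the polynomials [p] of degree at most [2n - 1] that majorize the
   indicator of [[-1, x]] on [[-1, 1]]. A minimizer [p] exists by compactness, and
   Farkas' lemma yields a quadrature formula with nonnegative weights [lam] whose
   nodes are contact points of [p] with the indicator. Perturbing [p] shows that,
   wherever [pi] is differentiable, [pi'(x)] is the node weight at [x] times [- p'(x)].

   Let [rho = sqrt(1 - x^2) / n] and let [z] be a node at distance between
   [K rho] and [2 K rho] from [x]. As [z] is a double zero of [p] (if [z > x]) or
   of [p - 1] (if [z < x]), the product of [p] (or [p - 1]) with
   [k (1 - u^2) / (u - z)] is a polynomial [F], with [k] of size about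
   [K rho / (1 - x^2)]. Applying the quadrature formula to [F'] bounds
   [lam(x) (- p'(x))], up to a small error, by [L F'] plus
   [|x - z|] times the sum of [lam(y) / (y - z)^2] over the nodes [y] on one side of [x].

   - [L F'] is small. The weight is a difference of two monotone functions, so
     integration by parts bounds [L F'] by the sup of [|F|] times a variation. By Nikolskii
     type inequalities [F] is [O(K)] within [T rho] of [x], where [w] oscillates
     little, and [O(K / T)] elsewhere.
   - The node sum is about [w(x)]. Comparing the quadrature with Jackson type
     majorants of step functions shows that the nodes carry mass [w(x) t + O(rho)]
     on an interval of length [t], and Abel summation converts this into
     [w(x) / |x - z| + O(rho / |x - z|^2)].

   Taking [K] large, then [T] large compared with [K], and finally [n sqrt(1 - x^2)] large
   makes all errors small. *)
Require Import Defs.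
From HB Require Import structures.
From mathcomp Require Import all_boot all_order all_algebra.
From mathcomp Require Import all_classical all_reals all_analysis.
From mathcomp Require Import measurable_realfun.
From mathcomp Require Import zify ring lra.
Set Implicit Arguments. Unset Strict Implicit. Unset Printing Implicit Defensive.
Import Order.TTheory GRing.Theory Num.Theory.
Import numFieldNormedType.Exports.
Local Open Scope classical_set_scope.
Local Open Scope ring_scope.

(** The factor [1 - u^2] in the test polynomials is forced by the endpoints: a node at [1] or [-1]
    need not be a zero of [p']. It costs degree, since [(1 - u^2) p'] exceeds by one the degree for
    which the quadrature is exact. For the formula for [pi'] the excess is removed by dividing out
    [u - y], where [y] is a maximum of [p] between two nodes beyond [x]. For the estimate of
    [lam(x) (- p'(x))] the division is by [u - z] at a node, and what it leaves over at the other
    nodes is the sum of [lam(y) / (y - z)^2]. The leftover at [z] itself is not computable but has a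
    sign, so [z > x] serves for the upper bound and [z < x] for the lower one. Two errors compete
    for the scale of [|x - z|]. Node masses are known up to [O(rho)], a relative error [O(1 / K)],
    whereas [F] near [x] grows like [K] and must be compensated by the small oscillation of [w]. All
    polynomial inequalities come from one fact: for [q >= 0] the function [q(cos t) sin t] is a sine
    polynomial whose coefficients are bounded by the integral of [q]. The same fact gives the
    compactness behind the minimizer. *)

Lemma le_of_is_derive (R : realType) (f f' : R -> R) (a b : R) :
  (forall x, a <= x <= b -> is_derive x 1 f (f' x)) ->
  (forall x, a <= x <= b -> 0 <= f' x) -> a <= b -> f a <= f b.
Proof.
move=> df f'0 ab.
have [||c cab E] := @MVT_segment R f f' a b ab.
- by move=> x; rewrite in_itv/= => /andP[/ltW ax /ltW xb]; apply: df; rewrite ax xb.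
- apply: continuous_in_subspaceT => x; rewrite inE/= in_itv/= => /df h.
  by apply: differentiable_continuous; exact/derivable1_diffP.
- by rewrite -subr_ge0 E mulr_ge0 ?subr_ge0// f'0.
Qed.

(** * Integration of polynomials *)

Definition hrn := (@hornerD, @hornerN, @hornerZ, @hornerXsubC, @hornerX, @hornerC, @hornerM, @horner_exp).

Section PolyInt.
Variable R : realType.
Implicit Types p q : {poly R}.

(** The antiderivative without constant term: the coefficient at [i = 0] is a division by [0], hence
    [0]. Integrals of polynomials are differences of its values, so they are compared without
    measure theory; [itv_int1] links them to the Lebesgue integral. *)
Definition prim q : {poly R} := \poly_(i < (size q).+1) (q`_i.-1 / i%:R).

Lemma deriv_prim q : (prim q)^`() = q.
Proof.
apply/polyP => i; rewrite coef_deriv coef_poly ltnS.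
case: ltnP => h /=; last by rewrite mul0rn nth_default.
by rewrite -[LHS]mulr_natr mulfVK// pnatr_eq0.
Qed.

Lemma is_derive_horner p (x : R) : is_derive x 1 (fun y => p.[y]) (p^`()).[x].
Proof. by move: (is_derive_poly p x); rewrite /=. Qed.

Lemma deriv_eq0_horner p (a b : R) : p^`() = 0 -> p.[a] = p.[b].
Proof.
move=> p0; suff -> : p = (p`_0)%:P by rewrite !hornerC.
apply/polyP => -[|i]; rewrite coefC//=.
have := congr1 (fun q : {poly R} => q`_i) p0; rewrite coef_deriv coef0 => /eqP.
by rewrite mulrn_eq0/= => /eqP.
Qed.

Definition pint q : R := (prim q).[1] - (prim q).[-1].

Lemma pintE q Q (a b : R) : Q^`() = q -> (prim q).[b] - (prim q).[a] = Q.[b] - Q.[a].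
Proof.
move=> Qq; have : (prim q - Q)^`() = 0 by rewrite derivB deriv_prim Qq subrr.
by move=> /(deriv_eq0_horner b a); rewrite !hrn; lra.
Qed.

Lemma pint_linear_subproof (a : R) p q : pint (a *: p + q) = a * pint p + pint q.
Proof.
rewrite /pint (@pintE _ (a *: prim p + prim q)).
  by rewrite !hrn; ring.
by rewrite derivD derivZ !deriv_prim.
Qed.
HB.instance Definition _ :=
  GRing.isLinear.Build R {poly R} R *%R pint pint_linear_subproof.

Lemma pint_le_fun q (G G' : R -> R) (a b : R) : a <= b ->
  (forall x, a <= x <= b -> is_derive x 1 G (G' x)) ->
  (forall x, a <= x <= b -> q.[x] <= G' x) ->
  (prim q).[b] - (prim q).[a] <= G b - G a.
Proof.
move=> ab dG qG.
suff : G a - (prim q).[a] <= G b - (prim q).[b] by lra.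
apply: (@le_of_is_derive _ (fun x => G x - (prim q).[x]) (fun x => G' x - q.[x])) => //.
- move=> x xab; apply: is_deriveB; first exact: dG.
  by rewrite -[X in X.[x]]deriv_prim; exact: is_derive_horner.
- by move=> x xab; rewrite subr_ge0 qG.
Qed.

Lemma prim_le p q (a b : R) : a <= b ->
  (forall x, a <= x <= b -> p.[x] <= q.[x]) ->
  (prim p).[b] - (prim p).[a] <= (prim q).[b] - (prim q).[a].
Proof.
move=> ab pq; apply: (@pint_le_fun _ _ (fun x => q.[x])) => // x _.
by rewrite -[X in X.[x]]deriv_prim; exact: is_derive_horner.
Qed.

Lemma pint_le p q : (forall x, -1 <= x <= 1 -> p.[x] <= q.[x]) -> pint p <= pint q.
Proof. by move=> h; apply: prim_le => //; lra. Qed.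

Lemma pintC (c : R) : pint c%:P = 2 * c.
Proof. by rewrite /pint (@pintE _ (c *: 'X)) ?derivZ ?derivX ?alg_polyC// !hrn; ring. Qed.

Lemma pint_ibp p (t : R) :
  pint p = (1 - t) * p.[1] + (1 + t) * p.[-1] - pint (('X - t%:P) * p^`()).
Proof.
rewrite /pint (@pintE p (('X - t%:P) * p - prim (('X - t%:P) * p^`()))).
  by rewrite !hrn; ring.
by rewrite derivB deriv_prim derivM derivXsubC mul1r; ring.
Qed.

(** On either side of [y] the bound has the antiderivative [c / (e + |x - y|)] up to sign, so each
    side contributes at most [c / e]. *)
Lemma pint_bump q (c e y : R) : 0 <= c -> 0 < e -> -1 <= y <= 1 ->
  (forall x, -1 <= x <= 1 -> q.[x] <= c / (e + `|x - y|) ^+ 2) ->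
  pint q <= 2 * c / e.
Proof.
move=> c0 e0 /andP[y1 y2] h.
have dinv s x : 0 < e + s * (x - y) ->
    is_derive x 1 (fun x : R => - s * c * (e + s * (x - y))^-1)
      (s ^+ 2 * c / (e + s * (x - y)) ^+ 2).
  move=> pos; have nz : e + s * (x - y) != 0 by rewrite gt_eqF.
  apply: is_derive_eq.
  by rewrite /GRing.scale/=; field.
have right : (prim q).[1] - (prim q).[y] <= c / e.
  have := @pint_le_fun q (fun x : R => - 1 * c * (e + 1 * (x - y))^-1)
     (fun x => 1 ^+ 2 * c / (e + 1 * (x - y)) ^+ 2) y 1 y2.
  have p1 : 0 < e + 1 * (1 - y) by lra.
  move=> H; apply: (le_trans (H _ _)).
  - by move=> x /andP[xy x1]; apply: dinv; lra.
  - move=> x /andP[xy x1]; apply: (le_trans (h x _)); first lra.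
    by rewrite ger0_norm ?subr_ge0// expr1n !mul1r.
  - rewrite subrr mulr0 addr0.
    have : 0 <= c * (e + 1 * (1 - y))^-1 by rewrite mulr_ge0// invr_ge0 ltW.
    by rewrite !mulN1r mulNr; lra.
have left : (prim q).[y] - (prim q).[-1] <= c / e.
  have := @pint_le_fun q (fun x : R => - (-1) * c * (e + -1 * (x - y))^-1)
     (fun x => (-1) ^+ 2 * c / (e + -1 * (x - y)) ^+ 2) (-1) y y1.
  have p1 : 0 < e + -1 * (-1 - y) by lra.
  move=> H; apply: (le_trans (H _ _)).
  - by move=> x /andP[xy x1]; apply: dinv; lra.
  - move=> x /andP[xy x1]; apply: (le_trans (h x _)); first lra.
    by rewrite ler0_norm ?subr_le0// sqrrN expr1n mul1r mulN1r.
  - rewrite subrr mulr0 addr0 opprK !mul1r.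
    have : 0 <= c * (e + -1 * (-1 - y))^-1 by rewrite mulr_ge0// invr_ge0 ltW.
    by lra.
rewrite /pint -[_ - _](subrKA (prim q).[y]) -mulrA.
lra.
Qed.
End PolyInt.

(** * Sine coefficients and Nikolskii inequalities *)

Section Chebyshev.
Variable R : realType.
Implicit Types q : {poly R}.

Fixpoint chebT (k : nat) : {poly R} :=
  match k with
  | 0 => 1
  | k1.+1 => match k1 with 0 => 'X | k2.+1 => 2%:P * 'X * chebT k1 - chebT k2 end
  end.

Fixpoint chebU (k : nat) : {poly R} :=
  match k with
  | 0 => 1
  | k1.+1 => match k1 with 0 => 2%:P * 'X | k2.+1 => 2%:P * 'X * chebU k1 - chebU k2 end
  end.

Lemma nat2_ind (P : nat -> Prop) :
  P 0%N -> P 1%N -> (forall k, P k -> P k.+1 -> P k.+2) -> forall k, P k.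
Proof.
move=> P0 P1 PS k; suff [] : P k /\ P k.+1 by [].
by elim: k => [|k [Pk Pk1]]; split=> //; exact: PS.
Qed.

Lemma horner_chebT k (t : R) : (chebT k).[cos t] = cos (k%:R * t).
Proof.
elim/nat2_ind: k => [||k IH0 IH1].
- by rewrite /= hornerC mul0r cos0.
- by rewrite /= hornerX mul1r.
- rewrite [chebT _]/= -/(chebT k.+1) !hrn IH0 IH1.
  have -> : k.+2%:R * t = k.+1%:R * t + t by rewrite -!natr1; ring.
  have -> : k%:R * t = k.+1%:R * t - t by rewrite -!natr1; ring.
  by rewrite cosB cosD; ring.
Qed.

Lemma horner_chebU k (t : R) : (chebU k).[cos t] * sin t = sin (k.+1%:R * t).
Proof.
elim/nat2_ind: k => [||k IH0 IH1].
- by rewrite /= hornerC !mul1r.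
- have -> : 2%:R * t = t + t by ring.
  by rewrite /= !hrn sinD; ring.
- rewrite [chebU _]/= -/(chebU k.+1) !hrn mulrBl IH0 -[_ * _ * sin t]mulrA IH1.
  have -> : k.+3%:R * t = k.+2%:R * t + t by rewrite -!natr1; ring.
  have -> : k.+1%:R * t = k.+2%:R * t - t by rewrite -!natr1; ring.
  by rewrite sinB sinD; ring.
Qed.

Lemma size_chebT k : (size (chebT k) <= k.+1)%N.
Proof.
elim/nat2_ind: k => [||k IH0 IH1]; rewrite ?size_poly1 ?size_polyX//.
rewrite [chebT _]/= -/(chebT k.+1) (leq_trans (size_polyD _ _))// geq_max size_polyN.
rewrite (leq_trans IH0 (leqW (leqnSn _))) andbT -mulrA mul_polyC.
by rewrite (leq_trans (size_scale_leq _ _))// (leq_trans (size_polyMleq _ _))// size_polyX.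
Qed.

Lemma size_chebU k : size (chebU k) = k.+1.
Proof.
elim/nat2_ind: k => [||k IH0 IH1]; first by rewrite size_poly1.
  by rewrite [chebU _]/= mul_polyC size_scale ?size_polyX// pnatr_eq0.
have sz : size (2%:P * 'X * chebU k.+1) = k.+3.
  rewrite -mulrA mul_polyC size_scale ?pnatr_eq0// mulrC size_mulX ?IH1//.
  by rewrite -size_poly_eq0 IH1.
by rewrite [chebU _]/= -/(chebU k.+1) size_polyDl sz// size_polyN IH0.
Qed.

Lemma chebU_span N q : (size q <= N)%N ->
  exists b : nat -> R, q = \sum_(k < N) b k *: chebU k.
Proof.
elim: N q => [|N IH] q sq.
  by exists (fun=> 0); rewrite big_ord0; apply/eqP; rewrite -size_poly_leq0.
pose c := q`_N / (chebU N)`_N.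
have UN0 : (chebU N)`_N != 0.
  have := lead_coef_eq0 (chebU N); rewrite lead_coefE size_chebU/= => ->.
  by rewrite -size_poly_eq0 size_chebU.
have [|b E] := IH (q - c *: chebU N); last first.
  exists (fun k => if k == N then c else b k).
  rewrite big_ord_recr/= eqxx.
  under eq_bigr => i _ do rewrite ltn_eqF//.
  by rewrite -E subrK.
apply/leq_sizeP => j; rewrite leq_eqVlt => /predU1P[<-|Nj].
  by rewrite coefB coefZ divfK// subrr.
rewrite coefB coefZ !nth_default ?mulr0 ?subr0 ?size_chebU//.
exact: leq_trans sq _.
Qed.

(** An antiderivative of [sin (i t) sin (j t)] that vanishes at [0]. For positive integers its value
    at [pi] is [pi / 2] if [i = j] and [0] otherwise, which is the orthogonality of the sines. *)
Definition sin2_prim (i j t : R) : R :=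
  if i == j then t / 2 - sin (2 * i * t) / (4 * i)
  else sin ((i - j) * t) / (2 * (i - j)) - sin ((i + j) * t) / (2 * (i + j)).

Lemma is_derive_sinZ (a x : R) : is_derive x 1 (fun t : R => sin (a * t)) (a * cos (a * x)).
Proof.
by apply: is_derive_eq; rewrite /GRing.scale/=; ring.
Qed.

Lemma is_derive_sin2_prim (i j t : R) : 0 < i -> 0 < j ->
  is_derive t 1 (sin2_prim i j) (sin (i * t) * sin (j * t)).
Proof.
move=> i0 j0; rewrite /sin2_prim; case: eqVneq => [<-|ij].
  have D := is_derive_sinZ (2 * i) t.
  apply: is_derive_eq.
  have -> : 2 * i * t = i * t + i * t by ring.
  rewrite cosD -[cos _ * cos _]expr2 cos2sin2 -expr2 /GRing.scale/=.
  by field; rewrite gt_eqF.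
have D1 := is_derive_sinZ (i - j) t.
have D2 := is_derive_sinZ (i + j) t.
apply: is_derive_eq.
have -> : (i - j) * t = i * t - j * t by ring.
have -> : (i + j) * t = i * t + j * t by ring.
rewrite cosB cosD /GRing.scale/=.
by field; rewrite subr_eq0 ij gt_eqF// addr_gt0.
Qed.

(** As [q(cos t) sin t] is the sine polynomial with coefficients [b], orthogonality makes
    [b k * (pi / 2)] its integral against [sin ((k + 1) t)] over [[0, pi]]. For [q >= 0] this is at
    most the integral of [q(cos t) sin t], which is [pint q]; and [pi / 2 >= 1]. *)
Lemma sine_coef_le q N (b : nat -> R) (k : 'I_N) :
  (forall u, -1 <= u <= 1 -> 0 <= q.[u]) -> q = \sum_(i < N) b i *: chebU i ->
  `|b k| <= pint q.
Proof.
move=> q0 E.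
have qs (t : R) : q.[cos t] * sin t = \sum_(i < N) b i * sin (i.+1%:R * t).
  rewrite {1}E horner_sum mulr_suml; apply: eq_bigr => i _.
  by rewrite hornerZ -mulrA horner_chebU.
pose A t := \sum_(i < N) b i * sin2_prim i.+1%:R k.+1%:R t.
have dA (t : R) : is_derive t 1 A (q.[cos t] * sin t * sin (k.+1%:R * t)).
  rewrite qs mulr_suml /A.
  have -> : (fun t => \sum_(i < N) b i * sin2_prim i.+1%:R k.+1%:R t) =
      \sum_(i < N) (fun t => b i * sin2_prim i.+1%:R k.+1%:R t).
    by apply/funext => x; rewrite fct_sumE.
  apply: is_derive_sum => i.
  have D := @is_derive_sin2_prim i.+1%:R k.+1%:R t (ltr0Sn _ _) (ltr0Sn _ _).
  by apply: is_derive_eq; rewrite /GRing.scale/=; ring.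
have A0 : A 0 = 0.
  rewrite /A big1// => i _; rewrite /sin2_prim.
  by case: ifP => _; rewrite !(mulr0, mul0r) sin0 !mul0r subr0 mulr0.
have sinpi_nat j : sin (j%:R * pi) = 0 :> R.
  elim: j => [|j IH]; first by rewrite mul0r sin0.
  by rewrite -natr1 mulrDl mul1r sinD IH sinpi; ring.
have sinpi_int (i j : nat) : sin ((i%:R - j%:R) * pi) = 0 :> R.
  by rewrite mulrBl sinB !sinpi_nat; ring.
have Api : A pi = b k * (pi / 2).
  rewrite /A (bigD1 k)//= big1 ?addr0; last first.
    move=> i ik; rewrite /sin2_prim eqr_nat eqSS.
    have /negbTE -> : (i : nat) != k by [].
    by rewrite -natrD sinpi_nat sinpi_int !mul0r subr0 mulr0.
  have E2 : 2 * k.+1%:R = (2 * k.+1)%:R :> R by rewrite natrM.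
  by rewrite /sin2_prim eqxx E2 sinpi_nat mul0r subr0.
(* The two integrals are compared through a monotone function of [t]; [s = 1] and [s = -1] give the
   two sides of the absolute value. *)
have key (s : R) : `|s| <= 1 -> s * (b k * (pi / 2)) <= pint q.
  move=> s1; rewrite /pint -Api.
  suff : - (prim q).[cos 0] - s * A 0 <= - (prim q).[cos pi] - s * A pi.
    by rewrite A0 cos0 cospi; lra.
  have pi0 := pi_ge0 R.
  apply: (@le_of_is_derive _ (fun t => - (prim q).[cos t] - s * A t)
    (fun t => q.[cos t] * sin t * (1 - s * sin (k.+1%:R * t)))) => // t t0pi.
    have D : is_derive t 1 (fun t => (prim q).[cos t]) (q.[cos t] * - sin t).
      apply: (@is_derive1_comp _ (fun u => (prim q).[u]) cos).
      by rewrite -[in X in X.[_]](deriv_prim q); exact: is_derive_horner.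
    by apply: is_derive_eq; rewrite /GRing.scale/=; ring.
  rewrite mulr_ge0 ?mulr_ge0 ?sin_ge0_pi//; first by rewrite q0// cos_geN1 cos_le1.
  rewrite subr_ge0 (le_trans (ler_norm _))// normrM mulr_ile1//.
  by rewrite ler_norml sin_geN1 sin_le1.
have pi2 := pi_ge2 R.
have := key 1; have := key (-1); rewrite normrN normr1 lexx => /(_ isT) h1 /(_ isT) h2.
have : `|b k| * (pi / 2) <= pint q.
  by case: (ger0P (b k)) => h; rewrite ?mulNr; lra.
apply: le_trans; rewrite ler_peMr//; lra.
Qed.

Lemma nikolskii q N (t : R) : (size q <= N)%N ->
  (forall u, -1 <= u <= 1 -> 0 <= q.[u]) -> 0 <= t <= pi ->
  q.[cos t] * sin t <= N%:R * pint q.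
Proof.
move=> sq q0 t0.
have [b E] := chebU_span sq.
rewrite {1}E horner_sum mulr_suml.
apply: (@le_trans _ _ (\sum_(i < N) pint q)); last first.
  by rewrite sumr_const card_ord mulr_natl.
apply: ler_sum => i _; rewrite hornerZ -mulrA horner_chebU.
apply: le_trans (sine_coef_le i q0 E).
rewrite (le_trans (ler_norm _))// normrM ler_piMr//.
by rewrite ler_norml sin_geN1 sin_le1.
Qed.

Lemma nikolskii_deriv q N (t : R) : (size q <= N)%N ->
  (forall u, -1 <= u <= 1 -> 0 <= q.[u]) ->
  `|(q^`()).[cos t]| * sin t ^+ 2 <= N%:R ^+ 2 * pint q + q.[cos t].
Proof.
move=> sq q0.
have [b E] := chebU_span sq.
pose B t := \sum_(i < N) b i * (i.+1%:R * cos (i.+1%:R * t)).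
(* [q(cos t) sin t] is differentiated in two ways: as a product, which brings in [q'], and in [dqs]
   as a sine polynomial, whose derivative [B] has coefficients at most [N * pint q]. *)
have dqs2 : is_derive t 1 (fun t => q.[cos t] * sin t)
    (q.[cos t] * cos t - (q^`()).[cos t] * sin t ^+ 2).
  have D : is_derive t 1 (fun t => q.[cos t]) ((q^`()).[cos t] * - sin t).
    by apply: (@is_derive1_comp _ (fun u => q.[u]) cos); exact: is_derive_horner.
  by apply: is_derive_eq; rewrite /GRing.scale/=; ring.
have dqs : is_derive t 1 (fun t => q.[cos t] * sin t) (B t).
  have -> : (fun t => q.[cos t] * sin t) = \sum_(i < N) (fun t => b i * sin (i.+1%:R * t)).
    apply/funext => x; rewrite fct_sumE.
    rewrite {1}E horner_sum mulr_suml; apply: eq_bigr => i _.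
    by rewrite hornerZ -mulrA horner_chebU.
  apply: is_derive_sum => i.
  have D := is_derive_sinZ i.+1%:R t.
  by apply: is_derive_eq; rewrite /GRing.scale/=; ring.
have EB : B t = q.[cos t] * cos t - (q^`()).[cos t] * sin t ^+ 2.
  by rewrite -(@derive_val _ _ _ _ _ _ _ dqs) -(@derive_val _ _ _ _ _ _ _ dqs2).
have Ble : `|B t| <= N%:R ^+ 2 * pint q.
  rewrite (le_trans (ler_norm_sum _ _ _))//.
  apply: (@le_trans _ _ (\sum_(i < N) (N%:R * pint q))); last first.
    by rewrite sumr_const card_ord -[_ *+ _]mulr_natl mulrA expr2.
  apply: ler_sum => i _; rewrite normrM mulrC ler_pM//; last exact: sine_coef_le E.
  rewrite normrM ger0_norm// -[leRHS]mulr1 ler_pM ?ler_nat//.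
  by rewrite ler_norml cos_geN1 cos_le1.
have qc0 : 0 <= q.[cos t] by rewrite q0// cos_geN1 cos_le1.
have qc : `|q.[cos t] * cos t| <= q.[cos t].
  by rewrite normrM ger0_norm// ler_piMr// ler_norml cos_geN1 cos_le1.
have -> : `|(q^`()).[cos t]| * sin t ^+ 2 = `|q.[cos t] * cos t - B t|.
  by rewrite EB subKr normrM (ger0_norm (sqr_ge0 _)).
by rewrite (le_trans (ler_normB _ _))// addrC lerD.
Qed.
End Chebyshev.

(** * Localized kernels *)

Section Kernel.
Variable R : realType.
Implicit Types t x y u : R.

Definition sn u : R := Num.sqrt (1 - u ^+ 2).

(* the resolution of polynomials of degree [n] at [u] *)
Definition res (n : nat) u : R := sn u / n%:R + n%:R ^- 2.

Lemma sn_ge0 u : 0 <= sn u. Proof. exact: sqrtr_ge0. Qed.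

Lemma sqr_sn u : -1 <= u <= 1 -> sn u ^+ 2 = 1 - u ^+ 2.
Proof. by move=> h; rewrite sqr_sqrtr//; nra. Qed.

Lemma sinx_le x : 0 <= x -> sin x <= x.
Proof.
move=> x0; rewrite -subr_ge0.
have := @le_of_is_derive _ (fun x => x - sin x) (fun x => 1 - cos x) 0 x.
rewrite sin0 subrr; apply=> //.
Qed.

Lemma abs_sin_le x : `|sin x| <= `|x|.
Proof.
wlog x0 : x / 0 <= x => [H|].
  case: (lerP 0 x) => x0; first exact: H.
  by rewrite -normrN -sinN -[leRHS]normrN H// oppr_ge0 ltW.
rewrite [leRHS]ger0_norm// ler_norml sinx_le// andbT.
have [x1|/ltW x1] := lerP x 1.
  suff : 0 <= sin x by lra.
  by apply: sin_ge0_pi; have := pi_ge2 R; lra.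
by have := sin_geN1 x; lra.
Qed.

(** By [y cos y <= sin y] at [y = x / 2], [sin x = 2 sin (x/2) cos (x/2) >= x cos^2 (x/2) = x (1 +
    cos x) / 2], and here [cos x >= 0]. *)
Lemma sin_ge_half x : 0 <= x <= pi / 2 -> x / 2 <= sin x.
Proof.
move=> /andP[x0 xpi].
have key y : 0 <= y <= pi / 2 -> y * cos y <= sin y.
  move=> /andP[y0 ypi]; rewrite -subr_ge0.
  have := @le_of_is_derive _ (fun x => sin x - x * cos x) (fun x => x * sin x) 0 y.
  rewrite sin0 mul0r subrr; apply=> //.
    by move=> z _; apply: is_derive_eq; rewrite /GRing.scale/=; ring.
  move=> z /andP[z0 zy]; rewrite mulr_ge0// sin_ge0_pi//; have := pi_ge0 R; lra.
have -> : sin x = 2 * (sin (x / 2) * cos (x / 2)).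
  by rewrite [in LHS](splitr x) sinD; ring.
have c0 : 0 <= cos (x / 2) by apply: cos_ge0_pihalf; have := pi_ge0 R; lra.
have k1 : x / 2 * cos (x / 2) * cos (x / 2) <= sin (x / 2) * cos (x / 2).
  by rewrite ler_wpM2r// key//; have := pi_ge0 R; lra.
have k2 : cos x = 2 * (cos (x / 2) * cos (x / 2)) - 1.
  rewrite [in LHS](splitr x) cosD.
  by have := cos2Dsin2 (x / 2); rewrite !expr2; lra.
have k3 : 0 <= cos x by apply: cos_ge0_pihalf; have := pi_ge0 R; lra.
have : 0 <= x * cos x by rewrite mulr_ge0.
rewrite k2; lra.
Qed.

Lemma abs_sinM (k : nat) x : `|sin (k%:R * x)| <= k%:R * `|sin x|.
Proof.
elim: k => [|k IH]; first by rewrite !mul0r sin0 normr0.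
rewrite -natr1 !mulrDl !mul1r sinD (le_trans (ler_normD _ _))// !normrM.
have c1 z : `|cos z| <= 1 :> R by rewrite ler_norml cos_geN1 cos_le1.
rewrite lerD//; first by rewrite (le_trans _ IH)// ler_piMr.
by rewrite ler_piMl.
Qed.

Lemma cosB_cos x y : cos x - cos y = - 2 * (sin ((x + y) / 2) * sin ((x - y) / 2)).
Proof.
have -> : cos x = cos ((x + y) / 2 + (x - y) / 2) by congr cos; lra.
have -> : cos y = cos ((x + y) / 2 - (x - y) / 2) by congr cos; lra.
by rewrite cosB cosD; ring.
Qed.

Section Node.
Variables (m : nat) (theta : R).
Hypotheses (m0 : (0 < m)%N) (th0 : 0 < theta < pi) (cosm : cos (m%:R * theta) = 0).
Let s := sin theta.
Let y := cos theta.

Let th1 : 0 < theta. Proof. by case/andP: th0. Qed.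

Let th2 : theta < pi. Proof. by case/andP: th0. Qed.

Let mR0 : 0 < m%:R :> R. Proof. by rewrite ltr0n. Qed.

Let s0 : 0 < s. Proof. by rewrite /s sin_gt0_pi. Qed.

Let abs_sinm : `|sin (m%:R * theta)| = 1.
Proof.
apply/eqP; rewrite -[_ == _](@eqrXn2 _ 2)// expr1n real_normK ?num_real//.
by rewrite sin2cos2 cosm expr0n subr0.
Qed.

Lemma node_sin_ge : 1 <= m%:R * s.
Proof. by rewrite -[X in X <= _]abs_sinm (le_trans (abs_sinM _ _))// ger0_norm// ltW. Qed.

Let D := chebT R m %/ ('X - y%:P).

Let DE : chebT R m = D * ('X - y%:P).
Proof. by rewrite divpK// dvdp_XsubCl /root horner_chebT cosm. Qed.

Let DcosE t : D.[cos t] * (cos t - y) = cos (m%:R * t).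
Proof. by rewrite -horner_chebT DE !hrn. Qed.

Let abs_cosm t : `|cos (m%:R * t)| = `|sin (2 * m%:R * ((t - theta) / 2))|.
Proof.
have -> : m%:R * t = m%:R * theta + 2 * m%:R * ((t - theta) / 2) by field.
by rewrite cosD cosm mul0r sub0r normrN normrM abs_sinm mul1r.
Qed.

Let abs_cosB t : 0 <= t <= pi ->
  `|cos t - y| = 2 * sin ((t + theta) / 2) * `|sin ((t - theta) / 2)|.
Proof.
move=> t0; rewrite cosB_cos mulNr normrN !normrM (ger0_norm (ler0n _ 2)) mulrA.
by have T1 := th1; have T2 := th2; case/andP: t0 => t1 t2; rewrite (@ger0_norm _ (sin ((t + theta) / 2)))// sin_ge0_pi//; lra.
Qed.

Let sin_mid t : 0 <= t <= pi -> s <= 2 * sin ((t + theta) / 2).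
Proof.
move=> t0; have /andP[t1 t2] := t0; have T1 := th1; have T2 := th2.
have A0 : 0 <= sin ((t + theta) / 2) by rewrite sin_ge0_pi//; lra.
have E : 2 * (sin ((t + theta) / 2) * cos ((t - theta) / 2)) = sin t + s.
  have -> : s = sin ((t + theta) / 2 - (t - theta) / 2) by congr sin; field.
  have -> : sin t = sin ((t + theta) / 2 + (t - theta) / 2) by congr sin; field.
  by rewrite sinB sinD; ring.
have st0 : 0 <= sin t by rewrite sin_ge0_pi.
have : sin ((t + theta) / 2) * cos ((t - theta) / 2) <= sin ((t + theta) / 2).
  by rewrite ler_piMr// cos_le1.
lra.
Qed.

Let D_node : `|D.[y]| * s = m%:R.
Proof.
have dT : (chebT R m)^`().[y] = D.[y].
  by rewrite DE derivM derivXsubC !hrn subrr; ring.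
have d1 : is_derive theta 1 (fun t => (chebT R m).[cos t]) (D.[y] * - s).
  rewrite -dT; apply: (@is_derive1_comp _ (fun u => (chebT R m).[u]) cos).
  exact: is_derive_horner.
have d2 : is_derive theta 1 (fun t => (chebT R m).[cos t]) (- (m%:R * sin (m%:R * theta))).
  have -> : (fun t => (chebT R m).[cos t]) = (fun t => cos (m%:R * t)).
    by apply/funext => t; rewrite horner_chebT.
  by apply: is_derive_eq; rewrite /GRing.scale/=; ring.
have : D.[y] * - s = - (m%:R * sin (m%:R * theta)).
  by rewrite -(@derive_val _ _ _ _ _ _ _ d1) -(@derive_val _ _ _ _ _ _ _ d2).
move=> /(congr1 (fun z => `|z|)); rewrite !(normrM,normrN) abs_sinm mulr1.
by rewrite (ger0_norm (ltW s0)) normr_nat.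
Qed.

Let sinB_neq0 t : 0 <= t <= pi -> t != theta -> 0 < `|sin ((t - theta) / 2)|.
Proof.
move=> t0 tth; rewrite normr_gt0; apply/negP => /eqP E.
have : `|cos t - y| = 0 by rewrite abs_cosB// E normr0 mulr0.
move=> /eqP; rewrite normr_eq0 subr_eq0 => /eqP /(congr1 (@acos R)).
by rewrite /y !cosK ?in_itv//=; [exact/eqP | case/andP: th0 => *; rewrite !ltW].
Qed.

(** Both [|cos (m t)|] and [|cos t - y|] contain [|sin ((t - theta) / 2)|]: the former is at most
    [2 m] times it by [abs_sinM], the latter at least [s] times it by [sin_mid]. At [theta] the
    quotient is the derivative of [chebT m]. *)
Lemma node_quot_le t : 0 <= t <= pi -> `|D.[cos t]| * s <= 2 * m%:R.
Proof.
move=> t0; have T0 := s0; have T1 := mR0; case: (eqVneq t theta) => [->|tth].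
  by rewrite D_node; lra.
have B0 := sinB_neq0 t0 tth.
have := congr1 (fun z => `|z|) (DcosE t).
rewrite /= normrM abs_cosm abs_cosB// => E.
have H := abs_sinM (2 * m) ((t - theta) / 2); rewrite natrM -E mulrA in H.
rewrite ler_pM2r// in H.
have := ler_wpM2l (normr_ge0 D.[cos t]) (sin_mid t0); lra.
Qed.

(** The cancellation of [node_quot_le] in the other direction: within half a node spacing of
    [theta], [m (t - theta)] stays below [pi / 2], where the sine is at least half its argument,
    while the sine of the mean angle is at most [2 s]. *)
Lemma node_quot_ge t : 0 <= t <= pi -> `|t - theta| <= pi / (2 * m%:R) ->
  m%:R <= `|D.[cos t]| * (4 * s).
Proof.
move=> t0 tth; have T1 := th1; have T2 := th2; have T3 := s0; have T4 := mR0; case: (eqVneq t theta) => [->|tth'].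
  by rewrite mulrCA D_node; lra.
have B0 := sinB_neq0 t0 tth'.
have B1 : 0 < `|(t - theta) / 2| by rewrite (lt_le_trans B0)// abs_sin_le.
have Bpi : `|(t - theta) / 2| <= pi / (4 * m%:R).
  rewrite normrM [X in _ * X]ger0_norm//.
  have -> : pi / (4 * m%:R) = pi / (2 * m%:R) / 2 :> R by field; rewrite gt_eqF.
  by rewrite ler_wpM2r.
have pi4 : pi <= 4 :> R by have := pihalf_02 R; lra.
have B2 : `|(t - theta) / 2| <= s.
  apply: (le_trans Bpi); rewrite ler_pdivrMr ?mulr_gt0//.
  by have := node_sin_ge; lra.
have := congr1 (fun z => `|z|) (DcosE t).
rewrite /= normrM abs_cosm abs_cosB// => E.
have low : m%:R * `|(t - theta) / 2| <= `|sin (2 * m%:R * ((t - theta) / 2))|.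
  have -> : `|sin (2 * m%:R * ((t - theta) / 2))| = `|sin (2 * m%:R * `|(t - theta) / 2|)|.
    by case: (ger0P ((t - theta) / 2)) => h //; rewrite mulrN sinN normrN.
  set b := `|(t - theta) / 2| in B1 Bpi *.
  have : 2 * m%:R * b / 2 <= sin (2 * m%:R * b).
    apply: sin_ge_half; rewrite !mulr_ge0 ?(ltW B1) ?(ltW mR0)//=.
    have := ler_wpM2l (ltW mR0) Bpi.
    have -> : m%:R * (pi / (4 * m%:R)) = pi / 4 :> R by field; rewrite gt_eqF.
    lra.
  by move=> h; rewrite (le_trans _ (ler_norm _))//; lra.
rewrite -E in low.
have sA : sin ((t + theta) / 2) <= 2 * s.
  have -> : (t + theta) / 2 = theta + (t - theta) / 2 by field.
  rewrite sinD.
  have h1 : sin theta * cos ((t - theta) / 2) <= s by rewrite ler_piMr ?cos_le1// ltW.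
  have h2 : cos theta * sin ((t - theta) / 2) <= `|(t - theta) / 2|.
    rewrite (le_trans (ler_norm _))// normrM (le_trans _ (abs_sin_le _))// ler_piMl//.
    by rewrite ler_norml cos_geN1 cos_le1.
  lra.
have /andP[t1 t2] := t0.
have h3 := abs_sin_le ((t - theta) / 2).
have A0 : 0 <= sin ((t + theta) / 2) by rewrite sin_ge0_pi//; lra.
have h4 : `|D.[cos t]| * (2 * sin ((t + theta) / 2) * `|sin ((t - theta) / 2)|) <=
   `|D.[cos t]| * (4 * s) * `|(t - theta) / 2|.
  by rewrite -[leRHS]mulrA ler_wpM2l// ler_pM//; lra.
by have := le_trans low h4; rewrite ler_pM2r.
Qed.

Lemma node_quot_le_inv t : `|D.[cos t]| * `|cos t - y| <= 1.
Proof. by rewrite -normrM DcosE ler_norml cos_geN1 cos_le1. Qed.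

Lemma size_node_quot : (size D <= m)%N.
Proof.
rewrite /D size_divp ?polyXsubC_eq0// size_XsubC/=.
by rewrite leq_subLR add1n size_chebT.
Qed.
End Node.

Lemma cheb_node_near (m : nat) t : (0 < m)%N -> 0 <= t <= pi ->
  exists theta, [/\ 0 < theta < pi, cos (m%:R * theta) = 0 &
    `|t - theta| <= pi / (2 * m%:R)].
Proof.
move=> m0 /andP[t0 tpi].
have mR0 : 0 < m%:R :> R by rewrite ltr0n.
have pi0 := pi_gt0 R.
have Em : m%:R * (pi / m%:R) = pi :> R by field; rewrite gt_eqF.
have main (k : nat) : (k < m)%N -> k%:R * (pi / m%:R) <= t <= k.+1%:R * (pi / m%:R) ->
    exists theta, [/\ 0 < theta < pi, cos (m%:R * theta) = 0 &
      `|t - theta| <= pi / (2 * m%:R)].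
  move=> km /andP[k1 k2]; exists (k%:R * (pi / m%:R) + pi / (2 * m%:R)).
  have E : pi / m%:R = pi / (2 * m%:R) + pi / (2 * m%:R) :> R by field; rewrite gt_eqF.
  have h0 : 0 < pi / (2 * m%:R) :> R by rewrite divr_gt0// mulr_gt0.
  have k0 : 0 <= k%:R * (pi / m%:R) :> R by rewrite mulr_ge0// E addr_ge0 ?ltW.
  split.
  - have : k.+1%:R * (pi / m%:R) <= m%:R * (pi / m%:R) :> R.
      by rewrite ler_pM2r ?ler_nat// divr_gt0.
    by rewrite Em -natr1; lra.
  - have -> : m%:R * (k%:R * (pi / m%:R) + pi / (2 * m%:R)) = k%:R * pi + pi / 2 :> R.
      by field; rewrite gt_eqF.
    rewrite cosDpihalf; elim: (k) => [|j IH]; first by rewrite mul0r sin0 oppr0.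
    have {}IH : sin (j%:R * pi) = 0 :> R by apply/eqP; rewrite -oppr_eq0 IH.
    by rewrite -natr1 mulrDl mul1r sinD IH sinpi; ring.
  - by rewrite ler_norml; move: k2; rewrite -natr1; lra.
(* At [t = pi] the truncation below would give the cell [k = m], one too many; the last cell is
   taken by hand. *)
have [tlt|tge] := ltP t pi; last first.
  apply: (main m.-1); first by rewrite prednK.
  have -> : t = pi by lra.
  rewrite prednK// Em lexx andbT -[leRHS]Em ler_wpM2r ?ler_nat ?leq_pred//.
  by rewrite divr_ge0// ltW.
have q0 : 0 <= t / (pi / m%:R) by rewrite !divr_ge0// ltW.
have pm0 : 0 < pi / m%:R :> R by rewrite divr_gt0.
have /andP[l1 l2] := truncn_itv q0.
apply: (main (Num.truncn (t / (pi / m%:R)))).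
  by rewrite -(ltr_nat R) (le_lt_trans l1)// ltr_pdivrMr// Em.
by rewrite -ler_pdivlMr// l1/= ltW// -ltr_pdivrMr.
Qed.

(* [J] is the fourth power of the Chebyshev polynomial [T_(n/2)] with its zero [y] nearest to [u0] divided out. *)
Lemma kernel_exists (n : nat) u0 : (2 <= n)%N -> -1 <= u0 <= 1 ->
  exists (J : {poly R}) (y e S : R),
  [/\ [/\ (size J + 2 <= 2 * n)%N, -1 <= y <= 1, 0 < e, e <= 18 * res n u0 &
          `|y - u0| <= 4 * e],
      [/\ 0 < S, forall u, 0 <= J.[u], forall u, -1 <= u <= 1 -> J.[u] <= S &
          S <= 8 ^+ 4 * J.[u0]] &
      [/\ pint J <= 11 * e * S, 0 < pint J &
          pint (('X - y%:P) ^+ 2 * J) <= 55 ^+ 3 * e ^+ 2 * pint J]].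
Proof.
move=> n2 u01.
pose m := n./2.
have m0 : (0 < m)%N by rewrite half_gt0.
have t0pi : 0 <= acos u0 <= pi by rewrite acos_ge0// acos_lepi.
have [theta [th0 cosm near]] := cheb_node_near m0 t0pi.
have mR0 : 0 < m%:R :> R by rewrite ltr0n.
have nR0 : 0 < n%:R :> R by rewrite ltr0n (leq_trans _ n2).
have mn : n%:R <= 3 * m%:R :> R.
  rewrite -natrM ler_nat -[in leqLHS](odd_double_half n) -/m -addnn.
  by clear -m0; case: (odd n); lia.
set s := sin theta; set y := cos theta.
have s0 : 0 < s by rewrite sin_gt0_pi.
pose D : {poly R} := chebT R m %/ ('X - y%:P).
have Dle t : 0 <= t <= pi -> `|D.[cos t]| * s <= 2 * m%:R by exact: node_quot_le.
have Dge : m%:R <= `|D.[u0]| * (4 * s).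
  by have := node_quot_ge m0 th0 cosm t0pi near; rewrite acosK ?in_itv.
have Dinv t : `|D.[cos t]| * `|cos t - y| <= 1 by exact: node_quot_le_inv.
have cosE u : -1 <= u <= 1 -> exists2 t, 0 <= t <= pi & u = cos t.
  by move=> h; exists (acos u); rewrite ?acos_ge0 ?acos_lepi// acosK ?in_itv.
have pi4 : pi <= 4 :> R by have := pihalf_02 R; lra.
have pi0 := pi_gt0 R.
have ms1 : 1 <= m%:R * s by exact: node_sin_ge.
have thu : `|acos u0 - theta| <= 2 / m%:R.
  apply: (le_trans near); rewrite ler_pdivlMr// mulrC.
  have -> : m%:R * (pi / (2 * m%:R)) = pi / 2 :> R by field; rewrite gt_eqF.
  by clear -pi4; lra.
(* [e] is the width of the bump: [|D|] is at most [2 / e] and at most [1 / |u - y|], hence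
   [(e + |u - y|) |D| <= 3]. *)
pose e := s / m%:R.
have e0 : 0 < e by rewrite divr_gt0.
have y1 : -1 <= y <= 1 by rewrite cos_geN1 cos_le1.
have D_le u : -1 <= u <= 1 -> `|D.[u]| <= 2 / e.
  move=> /cosE[t t0 ->]; rewrite /e ler_pdivlMr// mulrA ler_pdivrMr//.
  exact: Dle.
have D_inv u : -1 <= u <= 1 -> (e + `|u - y|) * `|D.[u]| <= 3.
  move=> u1; have h1 := D_le u u1.
  have : e * `|D.[u]| <= 2 by rewrite mulrC -ler_pdivlMr.
  by move: u1 => /cosE[t t0 ->]; have := Dinv t; clear; lra.
(* The fourth power is nonnegative and makes even [(X - y)^2 J] decay like an inverse square, so
   that [pint_bump] also bounds the second moment. *)
pose J := D ^+ 4; pose S := (2 / e) ^+ 4.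
have JE u : J.[u] = `|D.[u]| ^+ 4.
  by rewrite /J horner_exp -normrX ger0_norm// exprn_even_ge0.
have J0 u : 0 <= J.[u] by rewrite JE exprn_ge0.
have S0 : 0 < S by rewrite exprn_gt0// divr_gt0.
have De : e^-1 <= 4 * `|D.[u0]|.
  by rewrite invf_div ler_pdivrMr// -mulrA mulrCA.
have bump u : -1 <= u <= 1 -> (e + `|u - y|) ^+ 4 * J.[u] <= 81.
  move=> u1; rewrite JE -exprMn.
  have -> : 81 = 3 ^+ 4 :> R by ring.
  by rewrite lerXn2r ?nnegrE ?D_inv ?mulr_ge0 ?addr_ge0 ?(ltW e0).
have pd u : 0 < e + `|u - y| by rewrite (lt_le_trans e0)// lerDl.
have sJ : (size J <= 4 * (m - 1) + 1)%N.
  rewrite /J (leq_trans (size_poly_exp_leq _ _))// addn1 ltnS mulnC leq_mul2l/=.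
  by have := size_node_quot m theta; rewrite -/y -/D; move: (size D) => k; clear; lia.
have JA u : -1 <= u <= 1 -> J.[u] * (e + `|u - y|) ^+ 2 <= 81 / e ^+ 2.
  move=> u1; rewrite ler_pdivlMr ?exprn_gt0//.
  apply: le_trans (bump u u1); rewrite -mulrA mulrC ler_wpM2r//.
  rewrite [leRHS](exprM _ 2 2) [leRHS]expr2 ler_wpM2l ?exprn_ge0 ?(ltW (pd u))//.
  by rewrite lerXn2r ?nnegrE ?(ltW (pd u)) ?(ltW e0)// lerDl.
have IJ : pint J <= 162 / e ^+ 3.
  have -> : 162 / e ^+ 3 = 2 * (81 / e ^+ 2) / e :> R by field; rewrite gt_eqF.
  apply: (@pint_bump _ _ _ _ y) => //; first by rewrite divr_ge0// exprn_ge0// ltW.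
  by move=> u u1; rewrite ler_pdivlMr ?JA// exprn_gt0.
have I2J : pint (('X - y%:P) ^+ 2 * J) <= 162 / e.
  have -> : 162 / e = 2 * 81 / e :> R by ring.
  apply: (@pint_bump _ _ _ _ y) => // u u1.
  rewrite ler_pdivlMr ?exprn_gt0// hornerM horner_exp hornerXsubC.
  apply: le_trans (bump u u1); rewrite mulrAC ler_wpM2r//.
  rewrite [leRHS](exprM _ 2 2) [leRHS]expr2 ler_wpM2r ?exprn_ge0 ?(ltW (pd u))//.
  rewrite -[leLHS]real_normK ?num_real// lerXn2r ?nnegrE ?(ltW (pd u))//.
  by rewrite lerDr ltW.
(* The mass is bounded from below by Nikolskii's inequality at [y] itself, where [J] is at least of
   order [e^-4]. *)
have IJge : (4 ^+ 5 * e ^+ 3)^-1 <= pint J.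
  have thpi : 0 <= theta <= pi by case/andP: th0 => *; rewrite !ltW.
  have := @nikolskii _ J (4 * m) theta _ _ thpi; rewrite -/s -/y => H.
  have {}H : J.[y] * s <= (4 * m)%:R * pint J.
    apply: H => [|u _]; last exact: J0.
    by apply: leq_trans sJ _; clear -m0; lia.
  have Dy : e^-1 <= 4 * `|D.[y]|.
    have := node_quot_ge m0 th0 cosm thpi; rewrite subrr normr0 => H1.
    have {}H1 := H1 (divr_ge0 (ltW pi0) (mulr_ge0 (ler0n _ 2) (ltW mR0))).
    by move: H1; rewrite -/s -/y -/D invf_div ler_pdivrMr// -mulrA mulrCA.
  have Jy : (4 ^+ 4 * e ^+ 4)^-1 <= J.[y].
    have -> : (4 ^+ 4 * e ^+ 4)^-1 = (e^-1 / 4) ^+ 4 by field; rewrite gt_eqF.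
    rewrite JE lerXn2r ?nnegrE ?divr_ge0 ?invr_ge0 ?(ltW e0)//; clear -Dy; lra.
  have : (4 ^+ 4 * e ^+ 4)^-1 * s <= (4 * m)%:R * pint J.
    by apply: le_trans H; rewrite ler_wpM2r// ltW.
  rewrite natrM -mulrA -ler_pdivrMl// -ler_pdivrMl//; apply: le_trans.
  rewrite le_eqVlt; apply/orP; left; apply/eqP.
  by rewrite /e; field; rewrite !gt_eqF.
have se : s <= sn u0 + 2 / m%:R.
  rewrite /sn -sin_acos//; have -> : s = sin (acos u0 + (theta - acos u0)) by rewrite addrCA subrr addr0.
  rewrite sinD lerD//.
    by rewrite ler_piMr ?cos_le1// sin_ge0_pi.
  rewrite distrC in thu; apply: le_trans thu.
  rewrite (le_trans (ler_norm _))// normrM (le_trans _ (abs_sin_le _))// ler_piMl//.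
  by rewrite ler_norml cos_geN1 cos_le1.
exists J, y, e, S; split; split=> //.
- by move: sJ m0; rewrite /m; move: (size J) => k; clear; lia.
- rewrite /res.
  have -> : 18 * (sn u0 / n%:R + n%:R ^- 2) = 18 * (sn u0 + n%:R^-1) / n%:R.
    by field; rewrite gt_eqF.
  rewrite ler_pdivlMr// /e mulrAC ler_pdivrMr//.
  have h1 : s * n%:R <= s * (3 * m%:R) by rewrite ler_wpM2l// ltW.
  apply: (le_trans h1); rewrite mulrCA mulrA ler_wpM2r ?(ltW mR0)//.
  have h2 : m%:R^-1 <= 3 * n%:R^-1 :> R.
    by rewrite ler_pdivlMr// mulrC ler_pdivrMr.
  by have := sn_ge0 u0; clear -se h2; lra.
- have := cosB_cos (acos u0) theta; rewrite acosK ?in_itv//= -/y => E.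
  rewrite distrC E mulNr normrN !normrM (ger0_norm (ler0n _ 2)).
  have B1 : `|(acos u0 - theta) / 2| <= m%:R^-1.
    rewrite normrM [X in _ * X]ger0_norm// ler_pdivrMr// mulrC.
    exact: thu.
  have B2 : m%:R^-1 <= s by rewrite -div1r ler_pdivrMr// mulrC.
  have sA : `|sin ((acos u0 + theta) / 2)| <= 2 * s.
    have -> : (acos u0 + theta) / 2 = theta + (acos u0 - theta) / 2 by field.
    rewrite sinD (le_trans (ler_normD _ _))// !normrM.
    have h1 : `|sin theta| * `|cos ((acos u0 - theta) / 2)| <= s.
      by rewrite (ger0_norm (ltW s0)) ler_piMr ?(ltW s0)// ler_norml cos_geN1 cos_le1.
    have h2 : `|cos theta| * `|sin ((acos u0 - theta) / 2)| <= `|(acos u0 - theta) / 2|.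
      rewrite (le_trans _ (abs_sin_le _))// ler_piMl//.
      by rewrite ler_norml cos_geN1 cos_le1.
    by clear -h1 h2 B1 B2; lra.
  have sB := le_trans (abs_sin_le _) B1.
  have -> : 4 * e = 2 * ((2 * s) * m%:R^-1) by rewrite /e; ring.
  by rewrite ler_wpM2l// ler_pM.
- by move=> u u1; rewrite JE /S lerXn2r ?nnegrE ?D_le// divr_ge0// (ltW e0).
- rewrite JE /S; rewrite -exprMn lerXn2r ?nnegrE ?divr_ge0 ?mulr_ge0 ?(ltW s0)//; clear -De; lra.
- apply: (le_trans IJ); rewrite /S.
  have -> : 11 * e * (2 / e) ^+ 4 = 176 / e ^+ 3 by field; rewrite gt_eqF.
  by rewrite ler_wpM2r ?ler_nat// invr_ge0 exprn_ge0// ltW.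
- by rewrite (lt_le_trans _ IJge)// invr_gt0 mulr_gt0// exprn_gt0.
- apply: (le_trans I2J).
  have : 55 ^+ 3 * e ^+ 2 * (4 ^+ 5 * e ^+ 3)^-1 <= 55 ^+ 3 * e ^+ 2 * pint J.
    by rewrite ler_wpM2l// mulr_ge0 ?exprn_ge0// ltW.
  apply: le_trans; have -> : 55 ^+ 3 * e ^+ 2 * (4 ^+ 5 * e ^+ 3)^-1 = 55 ^+ 3 / 4 ^+ 5 / e by field; rewrite gt_eqF.
  by rewrite ler_wpM2r ?invr_ge0 ?(ltW e0)//; clear; lra.
Qed.
End Kernel.

(** * Polynomial majorants of the step function *)

Section Majorants.
Variable R : realType.
Implicit Types (p q J : {poly R}) (t u x : R).

Lemma nikolskii_sn q N u : (size q <= N)%N ->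
  (forall u, -1 <= u <= 1 -> 0 <= q.[u]) -> -1 <= u <= 1 ->
  q.[u] * sn u <= N%:R * pint q.
Proof.
move=> sq q0 u1; have := @nikolskii _ q N (acos u) sq q0.
rewrite acosK ?in_itv//= sin_acos// => -> //.
by rewrite acos_ge0// acos_lepi.
Qed.

Lemma nikolskii_deriv_sn q N u : (size q <= N)%N ->
  (forall u, -1 <= u <= 1 -> 0 <= q.[u]) -> -1 <= u <= 1 ->
  `|(q^`()).[u]| * sn u ^+ 2 <= N%:R ^+ 2 * pint q + q.[u].
Proof.
move=> sq q0 u1; have := @nikolskii_deriv _ q N (acos u) sq q0.
by rewrite acosK ?in_itv//= sin_acos.
Qed.

Lemma res_gt0 n u : (0 < n)%N -> 0 < res n u.
Proof.
move=> n0; rewrite /res ltr_wpDl ?invr_gt0 ?exprn_gt0 ?ltr0n//.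
by rewrite divr_ge0// sn_ge0.
Qed.

Lemma resE n u : (0 < n)%N -> n%:R ^+ 2 * res n u = n%:R * sn u + 1.
Proof. by move=> n0; rewrite /res; field; rewrite pnatr_eq0 -lt0n. Qed.

(** In the unit [v = n^2 res n t = n sn t + 1], a move by [k^2 res n t] raises [(n sn)^2] by at most
    [2 k^2 v], so [n sn] reaches at most [2 k v]: a displacement quadratic in [k] costs a factor
    linear in [k]. *)
Lemma res_shift n t u (k : R) : (0 < n)%N -> 1 <= k -> -1 <= t <= 1 -> -1 <= u <= 1 ->
  `|u - t| <= k ^+ 2 * res n t -> res n u <= 3 * k * res n t.
Proof.
move=> n0 k1 t1 u1 ut.
have nR0 : 0 < n%:R :> R by rewrite ltr0n.
have n20 : 0 < n%:R ^+ 2 :> R by rewrite exprn_gt0.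
rewrite -(ler_pM2l n20) mulrCA !resE//.
set v := n%:R * sn t + 1.
have v1 : 1 <= v by rewrite lerDr mulr_ge0// sn_ge0.
suff : n%:R * sn u <= 2 * k * v by nra.
rewrite -(@ler_pXn2r _ 2)// ?nnegrE; [|by rewrite mulr_ge0// sn_ge0|by nra].
rewrite exprMn sqr_sn//.
have h1 : 1 - u ^+ 2 <= sn t ^+ 2 + 2 * `|u - t|.
  rewrite sqr_sn//; case/andP: t1 => *; case/andP: u1 => *.
  by case: (ger0P (u - t)) => ?; nra.
have h2 : n%:R ^+ 2 * (1 - u ^+ 2) <= (n%:R * sn t) ^+ 2 + 2 * k ^+ 2 * v.
  rewrite /v -resE//.
  have := ler_wpM2l (ltW n20) (le_trans h1 (lerD (lexx _) (ler_wpM2l (ler0n _ 2) ut))).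
  by rewrite exprMn; lra.
apply: (le_trans h2).
have ns0 : 0 <= n%:R * sn t by rewrite mulr_ge0// sn_ge0.
have -> : n%:R * sn t = v - 1 by rewrite /v addrK.
have kk : 1 <= k ^+ 2 by rewrite exprn_ege1.
have -> : (2 * k * v) ^+ 2 = 4 * k ^+ 2 * v ^+ 2 by ring.
have : k ^+ 2 * v <= k ^+ 2 * v ^+ 2 by rewrite ler_wpM2l ?ler_eXnr//; lra.
have : 1 * v ^+ 2 <= k ^+ 2 * v ^+ 2 by rewrite ler_wpM2r ?sqr_ge0.
by rewrite sqrrB; nra.
Qed.

Definition major p x :=
  forall u, -1 <= u <= 1 -> 0 <= p.[u] /\ (u <= x -> 1 <= p.[u]).

(* The polynomial with derivative proportional to [(t - X) J] has a single bump
   above its values 1 at -1 and 0 at 1, hence majorizes the step at [t]. *)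
Lemma major_of_bump J t : -1 <= t <= 1 -> (forall u, 0 <= J.[u]) ->
  0 < pint (('X - t%:P) * J) ->
  exists P : {poly R}, [/\ (size P <= size J + 2)%N, major P t &
    pint P - (1 + t) = pint (('X - t%:P) ^+ 2 * J) / pint (('X - t%:P) * J)].
Proof.
move=> t1 J0; set m1 := pint _ => m10.
pose Q := prim (m1^-1 *: ((t%:P - 'X) * J)).
pose P := Q - (Q.[1])%:P.
have dP : P^`() = m1^-1 *: ((t%:P - 'X) * J) by rewrite /P derivB derivC subr0 deriv_prim.
have dPu u : (P^`()).[u] = m1^-1 * ((t - u) * J.[u]).
  by rewrite dP hornerZ hornerM !hrn.
have P1 : P.[1] = 0 by rewrite /P !hrn subrr.
have PN1 : P.[-1] = 1.
  have : pint (m1^-1 *: ((t%:P - 'X) * J)) = P.[1] - P.[-1].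
    by rewrite /pint (@pintE _ _ P).
  have -> : (t%:P - 'X) * J = - (('X - t%:P) * J) by ring.
  rewrite scalerN linearN linearZ/= -/m1 mulVf ?gt_eqF// P1 sub0r.
  by move=> /oppr_inj.
have m1V : 0 <= m1^-1 by rewrite invr_ge0 ltW.
have Pd u v : u <= v -> (forall z, u <= z <= v -> 0 <= (P^`()).[z]) -> P.[u] <= P.[v].
  by move=> uv h; apply: (@le_of_is_derive _ (horner P) (horner P^`())).
have Pd' u v : u <= v -> (forall z, u <= z <= v -> (P^`()).[z] <= 0) -> P.[v] <= P.[u].
  move=> uv h; rewrite -lerN2.
  apply: (@le_of_is_derive _ (fun z => - P.[z]) (fun z => - (P^`()).[z])) => //.
  by move=> z /h; rewrite oppr_ge0.
exists P; split.
- have sQ : (size Q <= size J + 2)%N.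
    rewrite (leq_trans (size_poly _ _))// addnS ltnS.
    rewrite (leq_trans (size_scale_leq _ _))// (leq_trans (size_polyMleq _ _))//.
    have -> : t%:P - 'X = - ('X - t%:P) by rewrite opprB.
    by rewrite size_polyN size_XsubC/= addn1.
  rewrite (leq_trans (size_polyD _ _))// geq_max sQ size_polyN.
  by rewrite (leq_trans (size_polyC_leq1 _))// addnS ltnS.
- move=> u /andP[u1 u2].
  have lower : u <= t -> 1 <= P.[u].
    move=> ut; rewrite -PN1; apply: Pd => // z /andP[_ zu].
    by rewrite dPu mulr_ge0// mulr_ge0// subr_ge0 (le_trans zu).
  split=> //; case: (lerP u t) => ut; first by have := lower ut; lra.
  rewrite -P1; apply: Pd' => // z /andP[uz _].
  rewrite dPu mulr_ge0_le0// mulr_le0_ge0// subr_le0 (le_trans _ uz)//.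
  exact: ltW.
- rewrite (pint_ibp P t) P1 PN1 mulr0 mulr1 add0r addrAC subrr add0r dP.
  have -> : ('X - t%:P) * (m1^-1 *: ((t%:P - 'X) * J)) = - (m1^-1 *: (('X - t%:P) ^+ 2 * J)).
    by rewrite -!mul_polyC; ring.
  by rewrite linearN opprK linearZ/= mulrC.
Qed.

(** The kernel is centred a large multiple of [res n t] to the right of [t]. Its first moment about
    [t] is then positive and comparable to the distance [d] times its mass, and the error in
    [major_of_bump], the ratio of second to first moment, is of order [d]. If there is no room
    before [1], the constant [1] is good enough. *)
Lemma crude_majorant : exists2 C : R, 0 < C & forall n t, (2 <= n)%N -> -1 <= t <= 1 ->
  exists P : {poly R}, [/\ (size P <= 2 * n)%N, major P t & pint P - (1 + t) <= C * res n t].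
Proof.
(* [B] is the second moment constant of [kernel_exists]. By [res_shift] the width [e] at the shifted
   centre is at most [18 * 3 k * res n t], so this [k] makes the shift [k^2 res n t] at least
   [(2 B + 6) e]; the offset [4 e] of the kernel's own centre leaves [(2 B + 2) e]. *)
pose B : R := 55 ^+ 3; pose k : R := 54 * (2 * B + 6).
have B0 : 0 < B by rewrite exprn_gt0.
have k1 : 1 <= k by rewrite /k; lra.
have k0 : 0 < k by exact: lt_le_trans k1.
have [BE kE] : 55 ^+ 3 = B /\ k = 54 * (2 * B + 6) by [].
clearbody k B.
have D0 : 0 < k ^+ 2 + 216 * k by apply: addr_gt0; [exact: exprn_gt0|apply: mulr_gt0].
exists (4 * (B + 1) * (k ^+ 2 + 216 * k)).
  by apply: mulr_gt0 => //; apply: mulr_gt0 => //; apply: addr_gt0.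
move=> n t n2 t1; have n0 : (0 < n)%N by exact: leq_trans n2.
have r0 := res_gt0 t n0; set r := res n t in r0 *.
have kr0 : 0 < k ^+ 2 * r by rewrite mulr_gt0// exprn_gt0.
have [big|small] := ltP 1 (t + k ^+ 2 * r).
  exists 1; split; first by rewrite size_poly1; lia.
  - by move=> u _; rewrite hornerC.
  - rewrite -polyC1 pintC mulr1 mulrDl.
    have h1 : 2 - (1 + t) <= 1 * (k ^+ 2 * r) by rewrite mul1r; clear -big; lra.
    apply: (le_trans h1); rewrite mulrA mul1r ler_wpM2r ?(ltW r0)//.
    have h2 : 1 * (k ^+ 2 + 216 * k) <= 4 * (B + 1) * (k ^+ 2 + 216 * k).
      by rewrite ler_wpM2r ?(ltW D0)//; clear -B0; lra.
    by clear -h2 k0; have := mulr_gt0 k0 k0; lra.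
pose t0 := t + k ^+ 2 * r.
have t01 : -1 <= t0 <= 1 by case/andP: t1 => tl tr; rewrite /t0; clear -small kr0 tl tr; lra.
have [J [y [e [S [[sJ y1 e0 ele yt0] [S0 J0 JS _] [_ I0 I2]]]]]] := kernel_exists n2 t01.
have rt0 : res n t0 <= 3 * k * r.
  apply: res_shift => //; rewrite /t0 addrAC subrr add0r ger0_norm//; exact: ltW.
have ele' : e <= 54 * k * r by clear -ele rt0; lra.
pose d := y - t.
have dge : (2 * B + 2) * e <= d.
  have h : k * e <= 54 * (k ^+ 2 * r).
    by have := ler_wpM2l (ltW k0) ele'; rewrite expr2; clear; lra.
  have : (2 * B + 6) * e <= k ^+ 2 * r by move: h; rewrite {1}kE; clear -e0; lra.
  by move: yt0; rewrite ler_norml /d /t0 => /andP[]; clear; lra.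
have d0 : 0 < d by rewrite (lt_le_trans _ dge)// mulr_gt0// addr_gt0// mulr_gt0.
have E1 : ('X - t%:P) * J = ('X - y%:P) * J + d *: J.
  by rewrite -mul_polyC /d polyCB; ring.
have m1 : d / 2 * pint J <= pint (('X - t%:P) * J).
  (* As [e + s + s^2 / e >= 0] for every [s], the first moment about [y] is controlled by the mass
     and the second moment, hence by [(1 + B) e] times the mass. *)
  have h : - (e * pint J + e^-1 * pint (('X - y%:P) ^+ 2 * J)) <= pint (('X - y%:P) * J).
    rewrite -!linearZ -linearD -linearN; apply: pint_le => u _ /=.
    rewrite !(horner_exp, hornerXsubC, hornerD, hornerN, hornerZ, hornerM).
    rewrite mulrA -mulrDl -mulNr ler_wpM2r// lerNl.
    have h : 0 <= e^-1 * ((u - y + e / 2) ^+ 2 + 3 / 4 * e ^+ 2).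
      rewrite mulr_ge0 ?invr_ge0 ?(ltW e0)//.
      by have := sqr_ge0 (u - y + e / 2); have := sqr_ge0 e; clear; lra.
    have -> : e + e^-1 * (u - y) ^+ 2 =
        e^-1 * ((u - y + e / 2) ^+ 2 + 3 / 4 * e ^+ 2) - (u - y).
      by field; rewrite gt_eqF.
    by rewrite lerDr.
  rewrite E1 linearD linearZ/=.
  have h2 : e^-1 * pint (('X - y%:P) ^+ 2 * J) <= B * e * pint J.
    by rewrite ler_pdivrMl// (le_trans I2)// BE le_eqVlt; apply/orP; left; apply/eqP; ring.
  have h3 : (2 * B + 2) * e * pint J <= d * pint J by rewrite ler_wpM2r ?(ltW I0).
  have h4 : 0 < e * pint J by rewrite mulr_gt0.
  by clear -h h2 h3 h4; lra.
have m10 : 0 < pint (('X - t%:P) * J) by rewrite (lt_le_trans _ m1)// !mulr_gt0.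
have m2 : pint (('X - t%:P) ^+ 2 * J) <= (2 * B + 2) * d ^+ 2 * pint J.
  have h : pint (('X - t%:P) ^+ 2 * J) <=
      2 * pint (('X - y%:P) ^+ 2 * J) + 2 * d ^+ 2 * pint J.
    rewrite -!linearZ -linearD; apply: pint_le => u _ /=.
    rewrite !(horner_exp, hornerXsubC, hornerD, hornerN, hornerZ, hornerM).
    rewrite [2 * (_ * _)]mulrA -mulrDl ler_wpM2r//.
    by have := sqr_ge0 ((u - y) - (y - t)); rewrite /d; clear; lra.
  have h2 : e ^+ 2 <= d ^+ 2.
    rewrite lerXn2r ?nnegrE ?(ltW e0) ?(ltW d0)//.
    by have := mulr_gt0 B0 e0; clear -e0 dge; lra.
  have h3 : B * e ^+ 2 * pint J <= B * d ^+ 2 * pint J.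
    by rewrite ler_wpM2r ?(ltW I0)// ler_wpM2l ?(ltW B0).
  by move: I2; rewrite BE; clear -h h3; lra.
have [P [sP mP EP]] := major_of_bump t1 J0 m10.
exists P; split=> //; first exact: leq_trans sP sJ.
rewrite EP ler_pdivrMr//.
have dle : d <= (k ^+ 2 + 216 * k) * r.
  by move: yt0; rewrite ler_norml /d /t0 => /andP[]; clear -ele'; lra.
apply: (le_trans m2).
have h4 : 4 * (B + 1) * d * (d / 2 * pint J) <= 4 * (B + 1) * d * pint (('X - t%:P) * J).
  by rewrite ler_wpM2l// !mulr_ge0// ?(ltW d0)// addr_ge0// ltW.
have h5 : 4 * (B + 1) * d * pint (('X - t%:P) * J) <=
   4 * (B + 1) * ((k ^+ 2 + 216 * k) * r) * pint (('X - t%:P) * J).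
  by rewrite ler_wpM2r ?(ltW m10)// ler_wpM2l// mulr_ge0// addr_ge0// ltW.
rewrite -[4 * _ * _ * r]mulrA; apply: le_trans h5; apply: le_trans h4.
by rewrite le_eqVlt; apply/orP; left; apply/eqP; field.
Qed.

(** Pointwise, [p J <= J + S (p - 1)] up to [x], because [p >= 1] there, and [p J <= S p] beyond
    [x]. *)
Lemma pint_major_mul p J x (S : R) : -1 <= x <= 1 -> major p x ->
  (forall u, 0 <= J.[u]) -> (forall u, -1 <= u <= 1 -> J.[u] <= S) ->
  pint (p * J) <= S * (pint p - (1 + x)) + pint J.
Proof.
move=> x1 mp J0 JS; have /andP[x0 x2] := x1.
have JE u : -1 <= u <= 1 -> p.[u] * J.[u] <= S * p.[u].
  by move=> u1; rewrite mulrC ler_wpM2r ?JS//; have [] := mp u u1.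
have left : (prim (p * J)).[x] - (prim (p * J)).[-1] <=
    (prim J + S *: (prim p - 'X)).[x] - (prim J + S *: (prim p - 'X)).[-1].
  rewrite -(@pintE _ (J + S *: (p - 1)) (prim J + S *: (prim p - 'X))); last first.
    by rewrite derivD derivZ derivB !deriv_prim derivX.
  apply: prim_le => // u /andP[u1 ux]; have u11 : -1 <= u <= 1 by rewrite u1 (le_trans ux).
  rewrite !(hornerD, hornerN, hornerZ, hornerM) -polyC1 hornerC.
  have [p0 /(_ ux) p1] := mp u u11; have := JS u u11; have := J0 u; nra.
have right : (prim (p * J)).[1] - (prim (p * J)).[x] <=
    (prim J + S *: prim p).[1] - (prim J + S *: prim p).[x].
  rewrite -(@pintE _ (J + S *: p) (prim J + S *: prim p)); last by rewrite derivD derivZ !deriv_prim.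
  apply: prim_le => // u /andP[xu u2]; have u11 : -1 <= u <= 1 by rewrite u2 (le_trans x0).
  by rewrite !(hornerD, hornerN, hornerZ, hornerM) (le_trans (JE _ u11))// lerDr.
move: left right; rewrite /pint !(hornerD, hornerN, hornerZ, hornerX).
lra.
Qed.

(** Nikolskii's inequalities for [p] alone would see its whole integral. They are applied to [p J]
    with a kernel [J] concentrated at [u], whose integral involves only the error of [p] and the
    mass of [J]; then [J(u)], comparable to the maximum of [J], is divided out. For the derivative,
    [p J'] is subtracted from [(p J)'] and bounded by the same inequality for [J]. *)
Lemma major_bound : exists2 C : R, 0 < C & forall n p x u, (2 <= n)%N ->
  (size p <= 2 * n)%N -> -1 <= x <= 1 -> major p x -> -1 <= u <= 1 ->
  p.[u] * sn u <= C * (n%:R * (pint p - (1 + x) + res n u)) /\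
  `|(p^`()).[u]| * sn u ^+ 2 <=
    C * (n%:R ^+ 2 * (pint p - (1 + x) + res n u) + p.[u] * (1 + n%:R ^+ 2 * res n u)).
Proof.
pose K : R := 8 ^+ 4.
have K1 : 1 <= K by rewrite /K exprn_ege1//; lra.
have K0 : 0 < K by exact: lt_le_trans K1.
have KE : 8 ^+ 4 = K by [].
clearbody K; exists (16 * 198 * K); first by apply: mulr_gt0 => //; apply: mulr_gt0.
move=> n p x u n2 sp x1 mp u1.
have n0 : (0 < n)%N by exact: leq_trans n2.
have nR0 : 0 < n%:R :> R by rewrite ltr0n.
have [J [y [e [S [[sJ y1 e0 ele _] [S0 J0 JS SJ] [IJ I0 _]]]]]] := kernel_exists n2 u1.
rewrite KE in SJ.
have r0 := res_gt0 u n0.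
set E := pint p - (1 + x); set r := res n u in r0 ele *.
have [p0 _] := mp u u1.
have Ju0 : 0 < J.[u] by rewrite -(@pmulr_rgt0 _ K)// (lt_le_trans S0).
have E0 : 0 <= E.
  have := pint_major_mul x1 mp (J := 0) (S := 1).
  rewrite mulr0 linear0 addr0 mul1r; apply=> v; rewrite horner0//; lra.
have q0 v : -1 <= v <= 1 -> 0 <= (p * J).[v].
  by move=> v1; rewrite hornerM mulr_ge0//; have [] := mp v v1.
have IpJ : pint (p * J) <= S * (E + 198 * r).
  apply: (le_trans (pint_major_mul x1 mp J0 JS)); rewrite -/E [leRHS]mulrDr lerD2l.
  apply: (le_trans IJ); rewrite [leRHS]mulrC ler_wpM2r ?(ltW S0)//.
  by clear -ele; lra.
have SK : S <= K * J.[u] by [].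
have spJ : (size (p * J)%R <= 4 * n)%N.
  by rewrite (leq_trans (size_polyMleq _ _))//; move: sp sJ; clear; move: (size p) (size J); lia.
have sJ' : (size J <= 2 * n)%N by move: sJ; clear; move: (size J); lia.
have IpJ' : pint (p * J) <= K * J.[u] * (198 * (E + r)).
  apply: (le_trans IpJ); apply: ler_pM (ltW S0) _ SK _; by clear -E0 r0; lra.
have {}K0 : 0 <= K by exact: ltW.
clearbody E r.
have Er0 : 0 <= E + r by rewrite addr_ge0// ltW.
have Ju0' := ltW Ju0; have nR0' := ltW nR0; have r0' := ltW r0.
split.
  have := nikolskii_sn spJ q0 u1; rewrite hornerM natrM => H.
  rewrite -(ler_pM2r Ju0) mulrAC (le_trans H)//.
  have H0 : 0 <= n%:R * (K * J.[u] * (E + r)).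
    by rewrite !mulr_ge0.
  by have := ler_wpM2l (ltW nR0) IpJ'; clear -H0; lra.
have H1 := nikolskii_deriv_sn spJ q0 u1.
have H2 := nikolskii_deriv_sn sJ' (fun v _ => J0 v) u1.
rewrite derivM hornerD !hornerM !natrM in H1; rewrite natrM in H2.
rewrite -(ler_pM2r Ju0).
have n20 : 0 <= n%:R ^+ 2 :> R by rewrite sqr_ge0.
pose X := `|(p^`()).[u] * J.[u] + p.[u] * (J^`()).[u]|.
have {}H1 : X * sn u ^+ 2 <= (4 * n%:R) ^+ 2 * pint (p * J) + p.[u] * J.[u] by exact: H1.
have T : `|(p^`()).[u]| * J.[u] <= X + p.[u] * `|(J^`()).[u]|.
  have := ler_normB ((p^`()).[u] * J.[u] + p.[u] * (J^`()).[u]) (p.[u] * (J^`()).[u]).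
  by rewrite addrK -/X !normrM (ger0_norm p0) (ger0_norm (J0 u)).
clearbody X.
have s0 : 0 <= sn u ^+ 2 by rewrite sqr_ge0.
have T2 := ler_wpM2r s0 T.
have H3 := ler_wpM2l p0 H2.
have H4 : pint J <= K * J.[u] * (198 * r).
  apply: (le_trans IJ); rewrite mulrC; apply: ler_pM => //; rewrite ?mulr_ge0 ?(ltW S0) ?(ltW e0)//.
  by clear -ele; lra.
have H5 : n%:R ^+ 2 * pint (p * J) <= n%:R ^+ 2 * (K * J.[u] * (198 * (E + r))).
  by rewrite ler_wpM2l.
have H6 : p.[u] * (n%:R ^+ 2 * pint J) <= p.[u] * (n%:R ^+ 2 * (K * J.[u] * (198 * r))).
  by rewrite ler_wpM2l// ler_wpM2l.
have H7 : 1 * (p.[u] * J.[u]) <= K * (p.[u] * J.[u]) by rewrite ler_wpM2r// mulr_ge0.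
have H8 : 0 <= K * (J.[u] * p.[u] * (n%:R ^+ 2 * r)).
  by rewrite !mulr_ge0.
have H9 : 0 <= K * (J.[u] * (n%:R ^+ 2 * (E + r))).
  by rewrite !mulr_ge0.
rewrite mulrAC; apply: (le_trans T2).
have H10 : 0 <= p.[u] * J.[u] by rewrite mulr_ge0.
move: H1 H3 H5 H6 H7 H8 H9 H10; clear.
move: X (`|(J^`()).[u]|) (sn u ^+ 2) (pint J) (pint (p * J)) J.[u] p.[u] (n%:R : R).
move=> X Y s2 I1 I2 j P N H1 H3 H5 H6 H7 H8 H9 H10.
lra.
Qed.
End Majorants.

(** * Duality and perturbation of the extremal majorant *)

Section Farkas.
Variables (R : realType) (V : lmodType R).

Definition lin_form (f : V -> R) := forall a u v, f (a *: u + v) = a * f u + f v.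

Lemma lin_form0 f : lin_form f -> f 0 = 0.
Proof. by move=> h; have := h 1 0 0; rewrite scale1r addr0 mul1r; lra. Qed.

Lemma lin_formZ f a v : lin_form f -> f (a *: v) = a * f v.
Proof. by move=> h; have := h a v 0; rewrite addr0 (lin_form0 h) addr0. Qed.

(* Bartl's inductive proof: project along a direction on which [f] is negative. *)
Lemma farkas k (e : nat -> V -> R) (f : V -> R) :
  (forall i, lin_form (e i)) -> lin_form f ->
  (forall v, (forall i, (i < k)%N -> 0 <= e i v) -> 0 <= f v) ->
  exists2 c : nat -> R, (forall i, 0 <= c i) & forall v, f v = \sum_(i < k) c i * e i v.
Proof.
elim: k e f => [|k IH] e f le lf H.
  exists (fun=> 0) => // v; rewrite big_ord0; apply/eqP; rewrite eq_le H// andbT.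
  have : 0 <= f ((-1) *: v) by exact: H.
  by rewrite lin_formZ// mulN1r oppr_ge0.
have [H'|] := pselect (forall v, (forall i, (i < k)%N -> 0 <= e i v) -> 0 <= f v).
  have [c c0 fE] := IH e f le lf H'.
  exists (fun i => if (i < k)%N then c i else 0) => [i|v]; first by case: ifP.
  rewrite big_ord_recr/= ltnn mul0r addr0 fE; apply: eq_bigr => i _.
  by rewrite ltn_ord.
move=> /existsNP[v0 /not_implyP[ev0 /negP]]; rewrite -ltNge => fv0.
have ek0 : e k v0 < 0.
  rewrite ltNge; apply/negP => ek; move: fv0; rewrite ltNge H// => i.
  by rewrite ltnS leq_eqVlt => /predU1P[->//|]; exact: ev0.
pose proj v := v + (- (e k v / e k v0)) *: v0.
have eproj g v : lin_form g -> g (proj v) = g v - e k v / e k v0 * g v0.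
  by move=> lg; rewrite /proj addrC lg; ring.
have lproj g : lin_form g -> lin_form (g \o proj).
  by move=> lg a u v /=; rewrite !eproj// lg (le k a u v); field; rewrite lt_eqF.
have [||v evp|c c0 fE] := IH (fun i => e i \o proj) (f \o proj).
- by move=> i; exact: lproj.
- exact: lproj.
- apply: H => i; rewrite ltnS leq_eqVlt => /predU1P[->|/evp//].
  by rewrite eproj// divfK ?subrr// lt_eqF.
(* The induction hypothesis settles the projections, on which [e k] vanishes. The last coefficient
   is fixed by equality at [v0]; it is nonnegative because [f v0] and [e k v0] are negative. *)
pose ck := (f v0 - \sum_(i < k) c i * e i v0) / e k v0.
have ck0 : 0 <= ck.
  rewrite mulr_le0// ?invr_le0 ?(ltW ek0)// subr_le0 (le_trans (ltW fv0))//.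
  by apply: sumr_ge0 => i _; rewrite mulr_ge0// ev0.
exists (fun i => if (i < k)%N then c i else ck) => [i|v]; first by case: ifP.
rewrite big_ord_recr/= ltnn.
have -> : \sum_(i < k) (if (i < k)%N then c i else ck) * e i v = \sum_(i < k) c i * e i v.
  by apply: eq_bigr => i _; rewrite ltn_ord.
have := fE v; rewrite /= eproj//.
have -> : \sum_(i < k) c i * e i (proj v) =
    \sum_(i < k) c i * e i v - e k v / e k v0 * \sum_(i < k) c i * e i v0.
  rewrite mulr_sumr -sumrB; apply: eq_bigr => i _; rewrite eproj//; ring.
move=> /(canRL (subrK _)) ->; rewrite /ck; field.
by rewrite lt_eqF.
Qed.
End Farkas.

(** * Stability of the majorant property under perturbation *)

Section Perturbation.
Variable R : realType.
Implicit Types (p q : {poly R}) (u v x h : R).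

Lemma horner_near q u (e : R) : 0 < e ->
  exists2 r, 0 < r & forall v, `|v - u| < r -> `|q.[v] - q.[u]| < e.
Proof.
move=> e0; have /cvgrPdist_lt/(_ _ e0) := @continuous_horner _ q u.
move=> [r /= r0 H]; exists r => // v vu.
by rewrite distrC; apply: H; rewrite /= distrC.
Qed.

(** Compactness: each point has its own range of [h], and finitely many neighbourhoods cover
    [[a, b]]. *)
Lemma itv_near_uniform (P : R -> R -> Prop) (a b : R) :
  (forall u, a <= u <= b -> exists2 r, 0 < r &
    forall v h, `|v - u| < r -> 0 < h -> h < r -> P h v) ->
  exists2 h0, 0 < h0 & forall h, 0 < h -> h < h0 -> forall v, a <= v <= b -> P h v.
Proof.
move=> H.
have /compact_near_coveringP/(_ _ (0:R)^'+ P _) := @segment_compact R a b.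
move=> /(_ _)[].
- move=> u; rewrite /= in_itv/= => /H[r r0 Hr].
  exists (ball u r, [set h | 0 < h < r]) => /=.
    split; first exact: nbhsx_ballx.
    exists r => //= h; rewrite /= sub0r normrN => hr h0; rewrite h0/=.
    by rewrite (le_lt_trans (ler_norm _)).
  by move=> [v h] /= [uv /andP[h0 hr]]; apply: Hr => //; rewrite distrC.
- move=> r /= r0 Hr; exists r => // h h0 hr v vab.
  by apply: (Hr h) => //=; rewrite ?in_itv// sub0r normrN gtr0_norm.
Qed.

(* the points where the majorant [p] of the step at [x] meets the step *)
Definition touch p x u := (-1 <= u <= 1) && (if u <= x then p.[u] == 1 else p.[u] == 0).

Lemma taylor2 p x : exists r, p = p.[x]%:P + (p^`()).[x] *: ('X - x%:P) + ('X - x%:P) ^+ 2 * r.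
Proof.
have /factor_theorem[g gE] : root (p - p.[x]%:P) x by rewrite /root !hrn subrr.
have /factor_theorem[r rE] : root (g - g.[x]%:P) x by rewrite /root !hrn subrr.
exists r.
have gx : (p^`()).[x] = g.[x].
  have -> : p^`() = (g * ('X - x%:P))^`() by rewrite -gE derivB derivC subr0.
  by rewrite derivM derivXsubC !hrn; ring.
rewrite gx -mul_polyC.
have -> : p = g * ('X - x%:P) + p.[x]%:P by rewrite -gE subrK.
have -> : g * ('X - x%:P) = (r * ('X - x%:P) + (g.[x])%:P) * ('X - x%:P) by rewrite -rE subrK.
by rewrite !hrn subrr; ring.
Qed.

(** Where [p] exceeds [c], the slack absorbs [h q]. Where it only meets [c], [q > 0] persists near
    [u] and pushes upwards from [p >= c]. *)
Lemma horner_perturb_ge p q u (c : R) (D : R -> Prop) :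
  c < p.[u] \/ (0 < q.[u] /\ forall v, D v -> c <= p.[v]) ->
  exists2 r, 0 < r & forall v h, `|v - u| < r -> D v -> 0 < h -> h < r -> c <= p.[v] + h * q.[v].
Proof.
case=> [pu|[qu pD]].
  have pu0 : 0 < (p.[u] - c) / 2 by rewrite divr_gt0// subr_gt0.
  have [r1 r10 H1] := horner_near p u pu0.
  have [r2 r20 H2] := horner_near q u ltr01.
  set M := `|q.[u]| + 1; have M0 : 0 < M by rewrite ltr_wpDl.
  exists (Num.min (Num.min r1 r2) ((p.[u] - c) / 2 / M)).
    by rewrite !lt_min r10 r20 divr_gt0.
  move=> v h; rewrite !lt_min => /andP[/andP[vr1 vr2] _] _ h0 /andP[_].
  rewrite ltr_pdivlMr// => hM.
  have := H1 _ vr1; have := H2 _ vr2; rewrite !ltr_norml => /andP[q1 q2] /andP[p1 p2].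
  have : h * - M <= h * q.[v].
    rewrite ler_pM2l// /M; have := ler_norm (- q.[u]); rewrite normrN; lra.
  by rewrite mulrN; lra.
have [r r0 H] := horner_near q u qu.
exists r => // v h vr Dv h0 hr.
have := H _ vr; rewrite ltr_norml => /andP[q1 _].
have : 0 < h * q.[v] by rewrite mulr_gt0//; lra.
have := pD _ Dv; lra.
Qed.

Lemma major_deriv_le0 p x : -1 < x -> x <= 1 -> major p x -> p.[x] = 1 -> (p^`()).[x] <= 0.
Proof.
move=> xN1 x1 mp px; rewrite leNgt; apply/negP => d0.
have [r pE] := taylor2 p x.
have [r1 r10 H1] := horner_near r x ltr01.
set C := `|r.[x]| + 1; have C0 : 0 < C by rewrite ltr_wpDl.
set d := (p^`()).[x] in d0 pE.
pose t := Num.min (Num.min (r1 / 2) (x + 1)) (d / (2 * C)).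
have t0 : 0 < t by rewrite !lt_min divr_gt0//= divr_gt0// ?mulr_gt0// andbT; lra.
have : t <= t by []; rewrite {2}/t !le_min => /andP[/andP[t1 t2]].
rewrite ler_pdivlMr ?mulr_gt0// => t3.
have [|_ pt1] := mp (x - t); first by lra.
have {pt1} : 1 <= p.[x - t] by apply: pt1; lra.
apply/negP; rewrite -ltNge pE !(horner_exp, hornerXsubC, hornerD, hornerN, hornerZ, hornerM, hornerC) px.
have : r.[x - t] < C.
  have := H1 (x - t); rewrite [_ - x]addrAC subrr add0r normrN gtr0_norm// ltr_norml.
  have := ler_norm r.[x]; rewrite /C => ? /(_ _)/andP[]; lra.
move=> rC; have : t ^+ 2 * r.[x - t] < t ^+ 2 * C by rewrite ltr_pM2l// exprn_gt0.
have : t * (t * (2 * C)) <= t * d by rewrite ler_pM2l.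
have : 0 < t * d by rewrite mulr_gt0.
have -> : x - t - x = - t by ring.
rewrite sqrrN; nra.
Qed.

(* [e] is the velocity at which the endpoint [x] of the step moves *)
Lemma major_perturb p q x (e : R) : -1 < x -> x <= 1 -> major p x ->
  (forall u, u != x -> touch p x u -> 0 < q.[u]) ->
  (p.[x] = 1 -> - e * (p^`()).[x] < q.[x]) ->
  exists2 h0, 0 < h0 & forall h, 0 < h -> h < h0 -> major (p + h *: q) (x + e * h).
Proof.
move=> xN1 x1 mp qpos qx.
pose P h u := -1 <= u <= 1 -> 0 <= p.[u] + h * q.[u] /\ (u <= x + e * h -> 1 <= p.[u] + h * q.[u]).
suff [h0 h00 H] : exists2 h0, 0 < h0 &
    forall h, 0 < h -> h < h0 -> forall u, -1 <= u <= 1 -> P h u.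
  by exists h0 => // h hp hh u u1; rewrite hornerD hornerZ; exact: H.
apply: itv_near_uniform => u u1.
have [ux|ux|->] := ltgtP u x.
- have [|r r0 H] := @horner_perturb_ge p q u 1 (fun v => -1 <= v <= 1 /\ v <= x).
    have [_ /(_ (ltW ux))] := mp _ u1; rewrite le_eqVlt => /predU1P[pu|]; last by left.
    right; split; last by move=> v [v1 vx]; have [_ ->] := mp _ v1.
    by apply: qpos; rewrite ?lt_eqF// /touch u1 (ltW ux) -pu eqxx.
  exists (Num.min r (x - u)); first by rewrite lt_min r0 subr_gt0.
  move=> v h; rewrite !lt_min => /andP[vr vx] h0 /andP[hr _] v1.
  have Hv : 1 <= p.[v] + h * q.[v].
    by apply: H => //; split => //; move: vx; rewrite ltr_norml; lra.
  by split => //; apply: le_trans ler01 _.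
- have [|r r0 H] := @horner_perturb_ge p q u 0 (fun v => -1 <= v <= 1).
    have [] := mp _ u1; rewrite le_eqVlt => /predU1P[pu|]; last by left.
    right; split; last by move=> v v1; have [] := mp _ v1.
    by apply: qpos; rewrite ?gt_eqF// /touch u1 leNgt ux -pu /= eqxx.
  have e0 : 0 < 2 * (1 + `|e|) by rewrite mulr_gt0// ltr_pwDl.
  exists (Num.min r ((u - x) / (2 * (1 + `|e|)))).
    by rewrite lt_min r0 divr_gt0// subr_gt0.
  move=> v h; rewrite !lt_min !ltr_pdivlMr// => /andP[vr vx] h0 /andP[hr hx] v1.
  split; first exact: H.
  move=> vxe; exfalso.
  have : e * h <= `|e| * h by rewrite ler_pM2r// ler_norm.
  have : 0 <= `|v - u| * `|e| by rewrite mulr_ge0.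
  have := ler_norm (- (v - u)); rewrite normrN.
  by nra.
- have [_ /(_ (lexx _)) px] := mp x ltac:(lra).
  have [|r1 r10 H1] := @horner_perturb_ge p q x 0 (fun=> True).
    by left; rewrite (lt_le_trans ltr01).
  suff [r2 r20 H2] : exists2 r, 0 < r & forall v h, `|v - x| < r -> 0 < h -> h < r ->
      -1 <= v <= 1 -> v <= x + e * h -> 1 <= p.[v] + h * q.[v].
    exists (Num.min r1 r2); first by rewrite lt_min r10.
    move=> v h; rewrite !lt_min => /andP[v1 v2] h0 /andP[h1 h2] v11.
    by split; [exact: H1|exact: H2].
  move: px; rewrite le_eqVlt => /predU1P[/esym px|px]; last first.
    have [|r r0 H] := @horner_perturb_ge p q x 1 (fun=> True); first by left.
    by exists r => // v h vr h0 hr _ _; exact: H.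
  have d0 := major_deriv_le0 xN1 x1 mp px; have := qx px.
  have [r2 pE] := taylor2 p x.
  have [ra ra0 Ha] := horner_near r2 x ltr01.
  set C := `|r2.[x]| + 1; have C0 : 0 < C by rewrite ltr_wpDl.
  move: d0 pE; set d' := (p^`()).[x]; pose d := - d'.
  have -> : d' = - d by rewrite opprK.
  clearbody d; clear d'; rewrite oppr_le0 mulrNN => d0 pE qd.
  pose eta := (q.[x] - e * d) / 2.
  have eta0 : 0 < eta by rewrite divr_gt0// subr_gt0.
  have [rb rb0 Hb] := horner_near q x eta0.
  pose r := Num.min (Num.min ra rb) (Num.min (eta / (4 * C * (e ^+ 2 + 1)))
     (if 0 < d then d / (2 * C) else 1)).
  have e20 : 0 < e ^+ 2 + 1 by rewrite ltr_wpDl// sqr_ge0.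
  exists r.
    rewrite !lt_min ra0 rb0 (divr_gt0 eta0) ?mulr_gt0//=.
    by case: ifP => // d1; rewrite divr_gt0// mulr_gt0.
  move=> v h; rewrite !lt_min => /andP[/andP[va vb] /andP[_ vd]] h0 /andP[_ /andP[+ _]] v1 vx.
  rewrite ltr_pdivlMr ?mulr_gt0// => he.
  have qv : e * d + eta <= q.[v].
    by have := Hb _ vb; rewrite ltr_norml /eta => /andP[+ _]; clear; lra.
  have hq : h * (e * d + eta) <= h * q.[v] by rewrite ler_pM2l.
  have rv : - C <= r2.[v].
    have := Ha _ va; rewrite ltr_norml /C => /andP[]; have := ler_norm (- r2.[x]).
    by rewrite normrN; clear; lra.
  pose t := v - x; have vE : v = x + t by rewrite /t; ring.
  have pv : 1 - d * t - C * t ^+ 2 <= p.[v].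
    rewrite pE !(horner_exp, hornerXsubC, hornerD, hornerN, hornerZ, hornerM, hornerC) px -/t.
    have : t ^+ 2 * - C <= t ^+ 2 * r2.[v] by rewrite ler_wpM2l// sqr_ge0.
    by clear; lra.
  have te : t <= e * h by rewrite /t; clear -vx; lra.
  (* Here [t = v - x] and [d = - p'(x)]. Within [2 |e| h] of [x] the quadratic remainder is [O(h^2)]
     and is beaten by the gain [h * eta]. Farther left the slope [d] outweighs the remainder if
     [d > 0], and [p >= 1] suffices if [d = 0]. *)
  have [tl|tl] := leP (- (2 * `|e| * h)) t.
    have t2 : t ^+ 2 <= 4 * e ^+ 2 * h ^+ 2.
      rewrite -[e ^+ 2]real_normK ?num_real//.
      have : e * h <= `|e| * h by rewrite ler_pM2r// ler_norm.
      have := normr_ge0 e; set E := `|e| in tl *; clearbody E => E0 ee.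
      have : 0 <= E * h by rewrite mulr_ge0// ltW.
      by move=> Eh; clear -te tl ee Eh; nra.
    have : C * t ^+ 2 <= C * (4 * e ^+ 2 * h ^+ 2) by rewrite ler_pM2l.
    have : h * (h * (4 * C * (e ^+ 2 + 1))) < h * eta by rewrite ltr_pM2l.
    have : 0 < C * h ^+ 2 by rewrite mulr_gt0// exprn_gt0.
    have : d * t <= d * (e * h) by rewrite ler_wpM2l.
    by clear -hq pv t2; lra.
  have t0 : t < 0 by rewrite (lt_le_trans tl)// oppr_le0 !mulr_ge0// ltW.
  move: vd; case: ifPn => [dp|]; last first.
    rewrite -leNgt => dle _; have dE : d = 0 by apply/eqP; rewrite eq_le dle d0.
    have {mp} [_ pv1] := mp _ v1; have {pv1} : 1 <= p.[v] by apply: pv1; rewrite vE; clear -t0; lra.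
    have : 0 < h * eta by rewrite mulr_gt0.
    by move: hq; rewrite dE; clear; lra.
  rewrite ltr_pdivlMr ?mulr_gt0// -/t ltr0_norm// => td.
  have : - t * (- t * (2 * C)) <= - t * d by rewrite ler_wpM2l ?(ltW td)// oppr_ge0 ltW.
  have : - e * h <= `|e| * h by rewrite ler_pM2r// -normrN ler_norm.
  move=> ee tt.
  have : d * - t <= d * (2 * (e * h - t)) by rewrite ler_pM2l//; clear -tl ee; lra.
  have : 0 < h * eta by rewrite mulr_gt0.
  by clear -tt hq pv; lra.
Qed.
End Perturbation.

(** * The minimizer, its quadrature formula and the derivative of the minimum *)

Section Extremal.
Variables (R : realType) (L : {poly R} -> R) (m : R).
Hypotheses (lL : lin_form L) (m0 : 0 < m).
Hypothesis Lm : forall q, (forall u, -1 <= u <= 1 -> 0 <= q.[u]) -> m * pint q <= L q.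
Implicit Types (p q : {poly R}) (u v x h : R).

Lemma lin_form_horner u : lin_form (fun q => q.[u]).
Proof. by move=> a p q; rewrite hornerD hornerZ. Qed.

Let span N (c : 'rV[R]_N) := \sum_(k < N) c ord0 k *: chebU R k.

Lemma lin_form_sum f N (b : nat -> R) (g : nat -> {poly R}) : lin_form f ->
  f (\sum_(k < N) b k *: g k) = \sum_(k < N) b k * f (g k).
Proof.
move=> lf; elim: N => [|N IH]; first by rewrite !big_ord0 lin_form0.
by rewrite !big_ord_recr/= addrC lf IH addrC.
Qed.

Lemma continuous_span N f : lin_form f -> continuous (fun c => f (@span N c)).
Proof.
move=> lf.
have -> : (fun c => f (@span N c)) = (fun c => \sum_(k < N) c ord0 k * f (chebU R k)).
  apply/funext => c; rewrite /span.
  have := lin_form_sum N (fun k => if insub k is Some i then c ord0 i else 0) (chebU R) lf.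
  under eq_bigr do rewrite valK.
  by under [RHS]eq_bigr do rewrite valK.
apply: continuous_big => [c|k _ c]; first exact: add_continuous.
apply: (@continuousM R _ (fun x : 'rV[R]_N => x ord0 k) (fun=> f (chebU R k))).
  exact: coord_continuous.
exact: cst_continuous.
Qed.

(** In the basis [chebU], a candidate no worse than the constant [1] has all coefficients bounded by
    [L 1 / m], by [sine_coef_le] and the lower bound on [L]. So the competition takes place in a
    compact set. *)
Lemma minimizer N x : (0 < N)%N -> exists p, [/\ (size p <= N)%N, major p x &
  forall q, (size q <= N)%N -> major q x -> L p <= L q].
Proof.
move=> N0.
have M1 : major 1 x by move=> u _; rewrite hornerC.
have sp q : (size q <= N)%N -> exists c, q = @span N c.
  move=> /chebU_span[b ->]; exists (\row_k b k); apply: eq_bigr => k _.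
  by rewrite mxE.
have sz c : (size (@span N c) <= N)%N.
  apply: (leq_trans (size_sum _ _ _)); apply/bigmax_leqP => k _.
  by rewrite (leq_trans (size_scale_leq _ _))// size_chebU.
pose S := [set c | major (@span N c) x /\ L (span c) <= L 1].
have SE : S = (\bigcap_(u in [set u | -1 <= u <= 1]) [set c | 0 <= (@span N c).[u]]) `&`
    (\bigcap_(u in [set u | -1 <= u <= 1 /\ u <= x]) [set c | 1 <= (@span N c).[u]]) `&`
    [set c | L (@span N c) <= L 1].
  apply/seteqP; split => c /=.
    move=> [mc Lc]; split => //; split=> u /=; first by move=> /mc[].
    by move=> [/mc[_ +]]; apply.
  by move=> [[c1 c2] c3]; split => // u u1; split => [|ux]; [exact: c1|exact: c2].
have clS : closed S.
  rewrite SE; apply: closedI; first apply: closedI.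
  - apply: closed_bigI => u _; apply: (@closed_comp _ _ (fun c => (@span N c).[u]) [set y | 0 <= y]).
      by move=> c _; apply: (continuous_span (lin_form_horner u)).
    exact: closed_ge.
  - apply: closed_bigI => u _; apply: (@closed_comp _ _ (fun c => (@span N c).[u]) [set y | 1 <= y]).
      by move=> c _; apply: (continuous_span (lin_form_horner u)).
    exact: closed_ge.
  - apply: (@closed_comp _ _ (fun c => L (@span N c)) [set y | y <= L 1]).
      by move=> c _; exact: continuous_span.
    exact: closed_le.
have cS : compact S.
  apply: (@subclosed_compact _ S [set c : 'rV[R]_N | forall i, `[- (L 1 / m), L 1 / m]%classic (c ord0 i)]) => //.
    by apply: (@rV_compact R N (fun=> `[- (L 1 / m), L 1 / m]%classic)) => i; exact: segment_compact.
  move=> c [mc Lc] i /=; rewrite in_itv/= -ler_norml.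
  have c0 u : -1 <= u <= 1 -> 0 <= (span c).[u] by move=> /mc[].
  rewrite ler_pdivlMr// mulrC (le_trans _ Lc)// (le_trans _ (Lm c0))// ler_pM2l//.
  have := @sine_coef_le _ (span c) N (fun k => if insub k is Some i then c ord0 i else 0) i c0.
  by rewrite valK; apply; apply: eq_bigr => k _; rewrite valK.
have S0 : S !=set0.
  have [|c cE] := sp 1; first by rewrite size_poly1.
  by exists c; rewrite /S/= -cE.
have [|c] := @EVT_min_rV _ _ (fun c => L (@span N c)) S S0 cS.
  by apply: continuous_subspaceT; exact: continuous_span.
rewrite inE => -[mc Lc] H.
exists (span c); split => // q /sp[d ->] md.
have [Ld|/ltW Ld] := leP (L (span d)) (L 1); last exact: le_trans Ld.
by apply: H; rewrite inE.
Qed.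

Lemma poly_root_seq p : p != 0 -> exists s : seq R, uniq s /\ forall u, (u \in s) = root p u.
Proof.
elim: {p}(size p) {-2}p (leqnn (size p)) => [p|n IH p sp p0].
  by rewrite leqn0 size_poly_eq0 => ->.
have [[a pa]|] := pselect (exists a, root p a); last first.
  move=> H; exists [::]; split => // u; rewrite in_nil; apply/esym/negbTE/negP => pu.
  by apply: H; exists u.
have /factor_theorem[q qE] := pa.
have q0 : q != 0 by apply: contraNneq p0 => q0; rewrite qE q0 mul0r.
have [|//|s [us sE]] := IH q.
  by move: sp; rewrite qE size_Mmonic ?monicXsubC// size_XsubC addn2.
exists (undup (a :: s)); split; first exact: undup_uniq.
by move=> u; rewrite mem_undup inE sE qE rootM root_XsubC orbC.
Qed.

(** Contact points are roots of [p (p - 1)], which is nonzero unless [p] is one of the two excluded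
    constants. *)
Lemma touch_seq p x : p != 0 -> p != 1 ->
  exists Z : seq R, uniq Z /\ forall u, (u \in Z) = touch p x u.
Proof.
move=> p0 p1; have [|s [us sE]] := @poly_root_seq (p * (p - 1)).
  by rewrite mulf_neq0// subr_eq0.
exists [seq u <- s | touch p x u]; split; first exact: filter_uniq.
move=> u; rewrite mem_filter sE rootM /root hornerD hornerN hornerC subr_eq0.
by rewrite /touch; case: ifP => _; case: eqP => [->|]; rewrite ?orbT ?andbT ?andbF//= ?eqxx ?orbT.
Qed.

Definition quadrature N p x (Z : seq R) (lam : R -> R) :=
  [/\ uniq Z, forall u, (u \in Z) = touch p x u, forall u, 0 <= lam u &
    forall q, (size q <= N)%N -> L q = \sum_(z <- Z) lam z * q.[z]].

Lemma le0_of_small (a b : R) : (forall e, 0 < e -> 0 <= a + e * b) -> 0 <= a.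
Proof.
move=> H; rewrite leNgt; apply/negP => a0.
have b0 : 0 < `|b| + 1 by rewrite ltr_wpDl.
have /H : 0 < - a / 2 / (`|b| + 1) by rewrite !divr_gt0// oppr_gt0.
apply/negP; rewrite -ltNge.
have : - a / 2 / (`|b| + 1) * b <= - a / 2; last by lra.
rewrite -mulrA ler_piMr//; first by lra.
rewrite mulrC ler_pdivrMr// mul1r; have := ler_norm b; lra.
Qed.

(** If [q >= 0] at the contact points, then [p + h (q + e)] is still a majorant for small [h], and
    minimality gives [L q + e L 1 >= 0]. Letting [e] tend to [0] yields the hypothesis of [farkas]
    for the evaluations at the contact points. *)
Lemma minimizer_quadrature N p x : (0 < N)%N -> -1 < x -> x <= 1 ->
  (size p <= N)%N -> major p x -> (forall q, (size q <= N)%N -> major q x -> L p <= L q) ->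
  p != 0 -> p != 1 -> exists Z lam, quadrature N p x Z lam.
Proof.
move=> N0 xN1 x1 sp mp pmin p0 p1.
have [Z [uZ ZE]] := touch_seq x p0 p1.
have key q : (size q <= N)%N -> (forall z, z \in Z -> 0 <= q.[z]) -> 0 <= L q.
  move=> sq qZ; apply: (@le0_of_small _ (L 1)) => e e0.
  have [||h0 h00 H] := @major_perturb _ p (q + e%:P) x 0 xN1 x1 mp.
  - move=> u _; rewrite -ZE => /qZ qu; rewrite hornerD hornerC ltr_wpDl//.
  - move=> px; rewrite oppr0 mul0r hornerD hornerC ltr_wpDl// qZ// ZE /touch lexx px eqxx andbT.
    lra.
  have h2 : 0 < h0 / 2 by rewrite divr_gt0.
  have /pmin : (size (p + (h0 / 2) *: (q + e%:P))%R <= N)%N.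
    rewrite (leq_trans (size_polyD _ _))// geq_max sp (leq_trans (size_scale_leq _ _))//.
    by rewrite (leq_trans (size_polyD _ _))// geq_max sq (leq_trans (size_polyC_leq1 _)).
  have mq : major (p + (h0 / 2) *: (q + e%:P)) x.
    by have := H (h0 / 2); rewrite mul0r addr0; apply => //; lra.
  move=> /(_ mq).
  have -> : p + (h0 / 2) *: (q + e%:P) = (h0 / 2) *: (q + e%:P) + p by rewrite addrC.
  rewrite lL lerDr pmulr_rge0// addrC.
  by rewrite -[e%:P]mulr1 mul_polyC lL addrC.
(* [farkas] speaks of a whole space, so all functionals are made to see only the first [N]
   coefficients. *)
have tl : forall f : {poly R} -> R, lin_form f -> lin_form (f \o take_poly N).
  move=> f lf a u v /=; rewrite -lf; congr (f _).
  by apply/polyP => i; rewrite !(coefD, coef_poly, coefZ); case: ifP => _; rewrite ?mulr0 ?addr0.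
have [|||c c0 cE] := @farkas R {poly R} (size Z) (fun i => (fun q => q.[nth 0 Z i]) \o take_poly N)
    (L \o take_poly N).
- by move=> i; apply: tl; exact: lin_form_horner.
- exact: tl.
- move=> q /= qZ; apply: key; first exact: size_take_poly.
  by move=> z zZ; rewrite -(nth_index 0 zZ); apply: qZ; rewrite index_mem.
exists Z, (fun z => c (index z Z)); split => // q sq.
have := cE q; rewrite /= take_poly_id// => ->.
rewrite (big_nth 0) big_mkord; apply: eq_bigr => i _.
by rewrite index_uniq.
Qed.

Lemma quadrature_val N p x Z lam : quadrature N p x Z lam -> (size p <= N)%N ->
  L p = \sum_(z <- Z | z <= x) lam z.
Proof.
move=> [_ ZE _ LE] sp; rewrite LE// [RHS]big_mkcond/=; apply: eq_big_seq => z.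
rewrite ZE /touch => /andP[_]; case: ifP => _ /eqP ->; by rewrite ?mulr1 ?mulr0.
Qed.

Lemma derive1_le_rate (f : R -> R) x (e c : R) : derivable f x 1 ->
  (exists2 h0, 0 < h0 & forall h, 0 < h -> h < h0 -> f (x + e * h) <= f x + h * c) ->
  e * derive1 f x <= c.
Proof.
move=> df [h0 h00 H].
have [e0|e0] := eqVneq e 0.
  have h2 : 0 < h0 / 2 by rewrite divr_gt0.
  have := H (h0 / 2) h2; rewrite e0 !mul0r addr0 lerDl pmulr_rge0//.
  by apply; lra.
rewrite leNgt; apply/negP => lt.
have dl : 0 < (e * derive1 f x - c) / `|e| by rewrite divr_gt0 ?normr_gt0// subr_gt0.
have /cvg_ex[l fl] : cvg (h^-1 *: (f (h + x) - f x) @[h --> 0^']).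
  by move: df; rewrite /derivable; under eq_fun do rewrite scaler1.
have lE : derive1 f x = l by rewrite /derive1; exact/cvg_lim.
move: fl => /cvgrPdist_lt/(_ _ dl)[r /= r0 Hr].
pose h := Num.min (h0 / 2) (r / (2 * `|e|)).
have ea : 0 < `|e| by rewrite normr_gt0.
have hp : 0 < h by rewrite lt_min !divr_gt0// mulr_gt0.
have : h <= h by []; rewrite {2}/h le_min => /andP[hh].
rewrite ler_pdivlMr ?mulr_gt0// => hr.
have := Hr (e * h); rewrite /= sub0r normrN normrM (gtr0_norm hp).
have eh1 : `|e| * h < r by nra.
have eh0 : e * h != 0 by rewrite mulf_neq0// gt_eqF.
move=> /(_ eh1 eh0).
rewrite lE in dl lt *.
have -> : l - (e * h)^-1 *: (f (e * h + x) - f x) = (e * h * l - (f (e * h + x) - f x)) / (e * h).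
  by rewrite /GRing.scale/=; field; rewrite e0 gt_eqF.
rewrite normrM normfV normrM (gtr0_norm hp) ltr_pdivrMr ?mulr_gt0// mulrA divfK ?gt_eqF//.
have hh0 : h < h0 by lra.
have := H h hp hh0; rewrite (addrC x).
have := ler_norm (e * h * l - (f (e * h + x) - f x)).
by nra.
Qed.

(** For small [h] the polynomial [p + h (q + eta)] majorizes the step whose endpoint has moved by
    [e h], so [f] grows in that direction at a rate of at most [L q + eta L 1]. The positive [eta]
    turns the weak sign conditions into the strict ones of [major_perturb]. *)
Lemma derive_le_of_major N p x (f : R -> R) q (e : R) : (0 < N)%N -> -1 < x -> x < 1 ->
  (size p <= N)%N -> (size q <= N)%N -> major p x -> f x = L p ->
  (forall t (P : {poly R}), (size P <= N)%N -> major P t -> f t <= L P) ->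
  derivable f x 1 ->
  (forall u, u != x -> touch p x u -> 0 <= q.[u]) ->
  (p.[x] = 1 -> - e * (p^`()).[x] <= q.[x]) ->
  e * derive1 f x <= L q.
Proof.
move=> N0 xN1 x1 sp sq mp fx fle df qZ qx.
rewrite -subr_ge0; apply: (@le0_of_small _ (L 1)) => eta eta0.
rewrite addrAC subr_ge0.
have -> : L q + eta * L 1 = L (q + eta%:P).
  by rewrite -[eta%:P]mulr1 mul_polyC [q + _]addrC lL addrC.
apply: derive1_le_rate => //.
have [||h0 h00 H] := @major_perturb _ p (q + eta%:P) x e xN1 (ltW x1) mp.
- by move=> u ux tu; rewrite hornerD hornerC ltr_wpDl// qZ.
- by move=> px; rewrite hornerD hornerC; have := qx px; lra.
exists h0 => // h hp hh; have /fle := H h hp hh.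
have -> : f x + h * L (q + eta%:P) = L (p + h *: (q + eta%:P)) by rewrite [p + _]addrC lL fx addrC.
apply.
rewrite (leq_trans (size_polyD _ _))// geq_max sp/= (leq_trans (size_scale_leq _ _))//.
by rewrite (leq_trans (size_polyD _ _))// geq_max sq (leq_trans (size_polyC_leq1 _)).
Qed.

Lemma touch_deriv_eq0 p x u : major p x -> touch p x u -> u != x -> -1 < u -> u < 1 ->
  (p^`()).[u] = 0.
Proof.
move=> mp tu ux uN1 u1.
pose a := if u < x then -1 else x; pose b := if u < x then x else 1.
have ab : a < b /\ (a < u < b).
  rewrite /a /b; case: (ltgtP u x) ux => // ux _; rewrite ?uN1 ?u1 ?ux //=.
    by split => //; lra.
  by split => //; lra.
pose a' := Num.max a (-1); pose b' := Num.min b 1.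
have [ab' uab] : a' < b' /\ a' < u < b'.
  have [_ /andP[au ub]] := ab.
  by split; rewrite ?gt_max ?lt_min ?au ?ub ?uN1 ?u1 //; lra.
have H := @derive1_at_min R (fun v => p.[v]) a' b' u (ltW ab').
have := is_derive_horner p u; move=> /@derive_val <-.
have /@derive_val -> // : is_derive u 1 (fun v => p.[v]) 0.
apply: H.
- by move=> t _; have := is_derive_horner p t; move=> [].
- by rewrite in_itv.
move=> t; rewrite in_itv/= /a' /b' gt_max lt_min => /andP[/andP[ta tN] /andP[tb t1]].
have [] := mp t; first by lra.
move: tu; rewrite /touch => /andP[_]; move: ta tb; rewrite /a /b.
have [ux'|ux'|/eqP] := ltgtP u x; last by rewrite (negbTE ux).
- by move=> _ tx /eqP -> _; apply; exact: ltW.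
- by move=> _ _ /eqP ->.
Qed.

(* The test polynomial [q] vanishes on all nodes but [x] and has [q(x) = - p'(x)], so it bounds both one-sided rates. *)
Lemma derive_eq_node n p x (f : R -> R) Z lam y : (0 < n)%N -> -1 < x -> x < 1 ->
  (size p <= 2 * n)%N -> major p x -> f x = L p ->
  (forall t (P : {poly R}), (size P <= 2 * n)%N -> major P t -> f t <= L P) ->
  derivable f x 1 -> quadrature (2 * n) p x Z lam ->
  (p^`()).[y] = 0 -> y \notin Z -> y != x ->
  derive1 f x = \sum_(z <- Z | z == x) lam z * - (p^`()).[x].
Proof.
move=> n0 xN1 x1 sp mp fx fle df [uZ ZE lam0 LE] py yZ yx.
have /factor_theorem[r rE] : root p^`() y by apply/rootP.
have x20 : 1 - x ^+ 2 != 0.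
  by rewrite -[1](expr1n _ 2) subr_sqr mulf_neq0 ?gt_eqF//; lra.
(* [p'] vanishes at the nodes inside [(-1, 1)] other than [x], and [1 - X^2] at the endpoints.
   Dividing by [X - y] saves the degree that is missing, and the scalar makes the value at [x] equal
   to [- p'(x)]. If [x] is not a node, the sum in the conclusion is empty. *)
pose q := (- (x - y) / (1 - x ^+ 2)) *: ((1 - 'X ^+ 2) * r).
have rv u : r.[u] * (u - y) = (p^`()).[u] by rewrite rE hornerM hornerXsubC.
have qx : q.[x] = - (p^`()).[x].
  rewrite -rv /q !(horner_exp, hornerX, hornerC, hornerD, hornerN, hornerZ, hornerM); field.
  exact: x20.
have qZ u : u != x -> u \in Z -> q.[u] = 0.
  move=> ux uZ'.
  rewrite /q !(horner_exp, hornerX, hornerC, hornerD, hornerN, hornerZ, hornerM).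
  have [->|u1] := eqVneq u 1; first by rewrite expr1n subrr; ring.
  have [->|uN1] := eqVneq u (-1); first by rewrite sqrrN expr1n subrr; ring.
  have tu : touch p x u by rewrite -ZE.
  have u11 : -1 <= u <= 1 by move: tu => /andP[].
  have : r.[u] * (u - y) = 0.
    have /andP[uN1' u1'] := u11.
    by rewrite rv (touch_deriv_eq0 mp tu)// lt_neqAle ?(eq_sym (-1)) ?uN1 ?u1.
  move=> /eqP; rewrite mulf_eq0 subr_eq0 => /orP[/eqP -> |/eqP uy].
    by rewrite !mulr0.
  by move: yZ; rewrite -uy uZ'.
have sq : (size q <= 2 * n)%N.
  rewrite (leq_trans (size_scale_leq _ _))//.
  have [->|r0] := eqVneq r 0; first by rewrite mulr0 size_poly0.
  have p0 : p != 0.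
    by apply: contraNneq r0 => p0; move: rE; rewrite p0 deriv0 => /esym/eqP; rewrite mulf_eq0 polyXsubC_eq0 orbF.
  have := leq_trans (lt_size_deriv p0) sp; rewrite rE size_Mmonic ?monicXsubC// size_XsubC addn2/=.
  have : (size (1 - 'X ^+ 2 : {poly R})%R <= 3)%N.
    rewrite (leq_trans (size_polyD _ _))// geq_max size_poly1/= size_polyN.
    by rewrite size_polyXn.
  move=> s3 sr; apply: leq_trans (size_polyMleq _ _) _; move: s3 sr.
  by move: (size (1 - 'X ^+ 2)%R) (size r) => a b; clear; lia.
have LqE c : L (c *: q) = \sum_(z <- Z | z == x) lam z * (c * - (p^`()).[x]).
  rewrite LE; last by rewrite (leq_trans (size_scale_leq _ _)).
  rewrite [RHS]big_mkcond/=; apply: eq_big_seq => z zZ; rewrite hornerZ; case: eqVneq => [->|zx]; first by rewrite qx.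
  by rewrite qZ// !mulr0.
have N0 : (0 < 2 * n)%N by rewrite muln_gt0.
apply/eqP; rewrite eq_le; apply/andP; split.
  have := @derive_le_of_major (2 * n) p x f q 1 N0 xN1 x1 sp sq mp fx fle df.
  rewrite mul1r => H; have := LqE 1; rewrite scale1r.
  under eq_bigr do rewrite mul1r.
  move=> <-; apply: H => [u ux tu|_]; first by rewrite qZ ?ZE.
  by rewrite qx mulN1r.
have sqN : (size (-1 *: q) <= 2 * n)%N by rewrite (leq_trans (size_scale_leq _ _)).
have := @derive_le_of_major (2 * n) p x f _ (-1) N0 xN1 x1 sp sqN mp fx fle df.
rewrite mulN1r LqE.
have -> : \sum_(z <- Z | z == x) lam z * (-1 * - p^`().[x]) = - \sum_(z <- Z | z == x) lam z * - p^`().[x].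
  by rewrite -sumrN; apply: eq_bigr => z _; ring.
rewrite lerN2; apply => [u ux tu|_]; first by rewrite hornerZ qZ ?ZE// mulr0.
by rewrite hornerZ qx; lra.
Qed.

End Extremal.

(** * Integration against the weight *)

Section WeightIntegral.
Variable R : realType.
Implicit Types (q F : {poly R}) (f : R -> R) (a b c u x : R).
Local Notation mu := (@lebesgue_measure R).

Lemma horner_bounded q a b : exists2 C : R, 0 < C & forall u, a <= u <= b -> `|q.[u]| <= C.
Proof.
elim/poly_ind: q => [|q c [C C0 H]].
  by exists 1 => // u _; rewrite horner0 normr0.
exists (C * (`|a| + `|b|) + (`|c| + 1)).
  by rewrite ltr_wpDl// ?mulr_ge0 ?addr_ge0// ?(ltW C0)// ltr_wpDl.
move=> u uab; rewrite hornerMXaddC (le_trans (ler_normD _ _))// lerD ?lerDl// normrM ler_pM// ?H//.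
have /andP[au ub] := uab.
have := ler_norm b; have := ler_norm (- a); rewrite normrN => ? ?.
by rewrite ler_norml; have := normr_ge0 a; have := normr_ge0 b => ? ?; apply/andP; split; lra.
Qed.

Lemma continuous_horner_within q (A : set R) : {within A, continuous (fun x => q.[x])}.
Proof. by apply: continuous_subspaceT => x; exact: continuous_horner. Qed.

Lemma measurable_horner q (D : set R) : measurable_fun D (fun x => q.[x]).
Proof.
by apply: measurable_funTS; apply: continuous_measurable_fun; exact: continuous_horner.
Qed.

Definition itv_int q f a b : R := \int[mu]_(x in `[a, b]) (q.[x] * f x).

Section Monotone.
Variable f : R -> R.
Hypothesis ndf : nondecreasing_fun f.

Lemma mono_integrable q a b : mu.-integrable `[a, b] (EFin \o (fun x => q.[x] * f x)).
Proof.
apply: measurable_bounded_integrable => //.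
- by rewrite /= lebesgue_measure_itv/=; case: ifP => // _; rewrite -EFinB ltry.
- by apply: measurable_funM; [exact: measurable_horner|exact: nondecreasing_measurable].
have [C C0 H] := horner_bounded q a b.
exists (C * (`|f a| + `|f b|)); split; first by rewrite num_real.
move=> M /ltW CM x /=; rewrite in_itv/= => xab; apply: le_trans CM.
rewrite normrM ler_pM// ?H//.
have /andP[/ndf fa /ndf fb] := xab.
have := ler_norm (f b); have := ler_norm (- f a); rewrite normrN => ? ?.
rewrite ler_norml; have := normr_ge0 (f a); have := normr_ge0 (f b) => ? ?; apply/andP; split; lra.
Qed.
End Monotone.

Lemma horner_integrable q a b : mu.-integrable `[a, b] (EFin \o (fun x => q.[x])).
Proof.
have nd1 : nondecreasing_fun (fun _ : R => 1 : R) by move=> ? ? ?; exact: lexx.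
have := @mono_integrable _ nd1 q a b; congr (integrable _ _ _).
by apply/funext => x /=; rewrite mulr1.
Qed.

Lemma itv_int1 q a b : a <= b -> \int[mu]_(x in `[a, b]) q.[x] = (prim q).[b] - (prim q).[a].
Proof.
rewrite le_eqVlt => /predU1P[->|ab]; first by rewrite set_itv1 Rintegral_set1 subrr.
rewrite /Rintegral (@continuous_FTC2 _ _ (fun x => (prim q).[x]))//.
- exact: continuous_horner_within.
- split.
  + by move=> x _; have := is_derive_horner (prim q) x; move=> [].
  + by apply: cvg_at_right_filter; exact: continuous_horner.
  + by apply: cvg_at_left_filter; exact: continuous_horner.
- move=> x _; rewrite derive1E; have := is_derive_horner (prim q) x => /@derive_val ->.
  by rewrite deriv_prim.
Qed.

Section Weight.
Variables w w1 w2 : R -> R.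
Hypotheses (nd1 : nondecreasing_fun w1) (nd2 : nondecreasing_fun w2).
Hypothesis wE : forall x, -1 <= x <= 1 -> w x = w1 x - w2 x.

Lemma weight_integrable q a b : -1 <= a -> b <= 1 ->
  mu.-integrable `[a, b] (EFin \o (fun x => q.[x] * w x)).
Proof.
move=> a1 b1.
have H : mu.-integrable `[a, b] ((EFin \o (fun x => q.[x] * w1 x)%R) \- (EFin \o (fun x => q.[x] * w2 x)%R))%E.
  by apply: integrableB => //; exact: mono_integrable.
apply: eq_integrable H => // x; rewrite inE/= in_itv/= => xab.
by rewrite wE ?mulrBr//; lra.
Qed.

Lemma itv_intE q a b : -1 <= a -> b <= 1 -> itv_int q w a b = itv_int q w1 a b - itv_int q w2 a b.
Proof.
move=> a1 b1; rewrite /itv_int -RintegralB//; try exact: mono_integrable.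
apply: eq_Rintegral => x; rewrite inE/= in_itv/= => xab; rewrite wE ?mulrBr//; lra.
Qed.

Lemma itv_int_lin a b : -1 <= a -> b <= 1 -> lin_form (fun q => itv_int q w a b).
Proof.
move=> a1 b1 k p q; rewrite /itv_int -RintegralZl//; last exact: weight_integrable.
rewrite -RintegralD//; last exact: weight_integrable.
  by apply: eq_Rintegral => x _; rewrite hornerD hornerZ; ring.
have := weight_integrable (k *: p) a1 b1; congr (integrable _ _ _).
by apply/funext => x /=; rewrite hornerZ mulrA.
Qed.

Lemma itv_int_split q a b c : -1 <= a -> a <= b -> b <= c -> c <= 1 ->
  itv_int q w a c = itv_int q w a b + itv_int q w b c.
Proof.
move=> a1 ab bc c1; rewrite /itv_int.
have := @Rintegral_itvB _ (fun x => q.[x] * w x) (BLeft a) (BRight c) b.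
rewrite Rintegral_itv_obnd_cbnd.
  move=> H; rewrite -H ?bnd_simp//; first by ring.
  exact: weight_integrable.
apply: integrableS (weight_integrable q a1 c1) => //.
by apply: subset_itv; rewrite bnd_simp.
Qed.

Lemma itv_int_ge q (l : R) a b : -1 <= a -> a <= b -> b <= 1 ->
  (forall x, a <= x <= b -> 0 <= q.[x] /\ l <= w x) ->
  l * ((prim q).[b] - (prim q).[a]) <= itv_int q w a b.
Proof.
move=> a1 ab b1 H; rewrite -itv_int1//.
rewrite -RintegralZl//; last exact: horner_integrable.
apply: le_Rintegral => //.
- have := horner_integrable (l *: q) a b; congr (integrable _ _ _).
  by apply/funext => x /=; rewrite hornerZ.
- exact: weight_integrable.
- by move=> x /=; rewrite in_itv/= => /H[q0 lw]; rewrite mulrC ler_wpM2l.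
Qed.

Lemma itv_int_le q (l : R) a b : -1 <= a -> a <= b -> b <= 1 ->
  (forall x, a <= x <= b -> 0 <= q.[x] /\ w x <= l) ->
  itv_int q w a b <= l * ((prim q).[b] - (prim q).[a]).
Proof.
move=> a1 ab b1 H; rewrite -itv_int1//.
rewrite -RintegralZl//; last exact: horner_integrable.
apply: le_Rintegral => //.
- exact: weight_integrable.
- have := horner_integrable (l *: q) a b; congr (integrable _ _ _).
  by apply/funext => x /=; rewrite hornerZ.
- by move=> x /=; rewrite in_itv/= => /H[q0 lw]; rewrite mulrC ler_wpM2r.
Qed.
End Weight.

Lemma mono_split f q a b c : nondecreasing_fun f -> -1 <= a -> a <= b -> b <= c -> c <= 1 ->
  itv_int q f a c = itv_int q f a b + itv_int q f b c.
Proof.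
move=> ndf; apply: (@itv_int_split f f (fun=> 0)) => //.
by move=> x _; rewrite subr0.
Qed.

(** Subtracting the constant [f a] leaves under the integral a factor between [0] and [f b - f a];
    the boundary term then costs [B] and the integral [C (b - a)]. This replaces a Stieltjes
    integral. *)
Lemma mono_ibp_crude f F (B C : R) a b : nondecreasing_fun f -> a <= b ->
  (forall u, a <= u <= b -> `|F.[u]| <= B) ->
  (forall u, a <= u <= b -> `|(F^`()).[u]| <= C) ->
  `|itv_int F^`() f a b - (F.[b] * f b - F.[a] * f a)| <= (B + C * (b - a)) * (f b - f a).
Proof.
move=> ndf ab FB FC.
have fab : 0 <= f b - f a by rewrite subr_ge0 ndf.
have i1f := @mono_integrable _ ndf F^`() a b.
have ndg : nondecreasing_fun (fun x => f x - f a) by move=> x y xy; rewrite lerB// ndf.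
have ig := @mono_integrable _ ndg F^`() a b.
have intg : itv_int F^`() f a b = itv_int F^`() (fun x => f x - f a) a b + f a * (F.[b] - F.[a]).
  rewrite -(@pintE _ F^`() F)// -itv_int1// -RintegralZl//; last exact: horner_integrable.
  rewrite -RintegralD//; last first.
    have := horner_integrable (f a *: F^`()) a b; congr (integrable _ _ _).
    by apply/funext => x /=; rewrite hornerZ.
  by apply: eq_Rintegral => x _; ring.
rewrite intg.
have -> : itv_int F^`() (fun x => f x - f a) a b + f a * (F.[b] - F.[a]) - (F.[b] * f b - F.[a] * f a) =
  itv_int F^`() (fun x => f x - f a) a b - F.[b] * (f b - f a) by ring.
rewrite (le_trans (ler_normB _ _))// addrC mulrDl lerD//.
  by rewrite normrM (ger0_norm fab) ler_wpM2r// FB// lexx ab.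
rewrite (le_trans (le_normr_Rintegral _ ig))//.
have C0 : 0 <= C by apply: le_trans (FC a _) => //; rewrite lexx ab.
have -> : C * (b - a) * (f b - f a) = \int[mu]_(x in `[a, b]) (C * (f b - f a)).
  by rewrite Rintegral_cst//= lebesgue_measure_itv/= lte_fin; case: ltP ab => //= [_ _|ba ab]; [ring|rewrite (_ : b = a); [ring|lra]].
apply: le_Rintegral => //.
- exact: integrable_norm ig.
- have := horner_integrable (C * (f b - f a))%:P a b; congr (integrable _ _ _).
  by apply/funext => x /=; rewrite hornerC.
- move=> x; rewrite /= in_itv/= => xab.
  rewrite normrM ler_pM// ?FC//.
  have /andP[/ndf ? /ndf ?] := xab.
  by rewrite ger0_norm ?subr_ge0// lerB.
Qed.

Lemma le_of_halves (y z k : R) : 0 <= k -> (forall i, y <= z + k / 2 ^+ i) -> y <= z.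
Proof.
move=> k0 H; rewrite leNgt; apply/negP => zy.
have yz : 0 < y - z by rewrite subr_gt0.
have := archi_boundP (divr_ge0 k0 (ltW yz)); set i := Num.bound _ => ki.
have := H i; apply/negP; rewrite -ltNge -ltrBrDl ltr_pdivrMr ?exprn_gt0//.
rewrite mulrC -ltr_pdivrMr// (lt_trans ki)//.
by rewrite -natrX ltr_nat ltn_expl.
Qed.

(* Bisecting [a, b] halves the second error term of [mono_ibp_crude]. *)
Lemma mono_ibp f F (B : R) a b : nondecreasing_fun f -> -1 <= a -> a <= b -> b <= 1 ->
  (forall u, a <= u <= b -> `|F.[u]| <= B) ->
  `|itv_int F^`() f a b - (F.[b] * f b - F.[a] * f a)| <= B * (f b - f a).
Proof.
move=> ndf a1 ab b1 FB.
have [C C0 FC] := horner_bounded F^`() (-1) 1.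
have H i : forall a b, -1 <= a -> a <= b -> b <= 1 -> (forall u, a <= u <= b -> `|F.[u]| <= B) ->
    `|itv_int F^`() f a b - (F.[b] * f b - F.[a] * f a)| <= (B + C * (b - a) / 2 ^+ i) * (f b - f a).
  elim: i => [|i IH] {a1 ab b1 FB}a {}b a1 ab b1 FB.
    rewrite expr0 divr1; apply: mono_ibp_crude => // u uab; apply: FC; lra.
  pose c := (a + b) / 2; have ac : a <= c by rewrite /c; lra.
  have cb : c <= b by rewrite /c; lra.
  rewrite (@mono_split _ _ a c b)//.
  have -> : itv_int F^`() f a c + itv_int F^`() f c b - (F.[b] * f b - F.[a] * f a) =
    (itv_int F^`() f a c - (F.[c] * f c - F.[a] * f a)) + (itv_int F^`() f c b - (F.[b] * f b - F.[c] * f c)) by ring.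
  have -> : (B + C * (b - a) / 2 ^+ i.+1) * (f b - f a) =
     (B + C * (c - a) / 2 ^+ i) * (f c - f a) + (B + C * (b - c) / 2 ^+ i) * (f b - f c).
    by rewrite exprS /c; field; rewrite expf_neq0.
  rewrite (le_trans (ler_normD _ _))// lerD// IH//; try lra.
    by move=> u uac; apply: FB; lra.
  by move=> u uac; apply: FB; lra.
have fab : 0 <= f b - f a by rewrite subr_ge0 ndf.
apply: (@le_of_halves _ _ (C * (b - a) * (f b - f a))) => [|i].
  by rewrite !mulr_ge0 ?(ltW C0)// subr_ge0.
apply: le_trans (H i a b a1 ab b1 FB) _; lra.
Qed.

Lemma weight_ibp w w1 w2 F (B : R) a b : nondecreasing_fun w1 -> nondecreasing_fun w2 ->
  (forall x, -1 <= x <= 1 -> w x = w1 x - w2 x) -> -1 <= a -> a <= b -> b <= 1 ->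
  (forall u, a <= u <= b -> `|F.[u]| <= B) ->
  `|itv_int F^`() w a b - (F.[b] * w b - F.[a] * w a)| <= B * ((w1 b + w2 b) - (w1 a + w2 a)).
Proof.
move=> nd1 nd2 wE a1 ab b1 FB.
rewrite (itv_intE nd1 nd2 wE)// !wE; try lra.
have := mono_ibp nd1 a1 ab b1 FB; have := mono_ibp nd2 a1 ab b1 FB.
by rewrite !ler_norml; lra.
Qed.
End WeightIntegral.

(** * Chebyshev-Markov duality for [pi_fun] *)

Section PiFun.
Variable R : realType.
Implicit Types (p q : {poly R}) (x t u : R).
Local Notation mu := (@lebesgue_measure R).
Variables w w1 w2 : R -> R.
Hypotheses (nd1 : nondecreasing_fun w1) (nd2 : nondecreasing_fun w2).
Hypothesis wE : forall x, -1 <= x <= 1 -> w x = w1 x - w2 x.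
Hypothesis w0 : forall x, -1 <= x <= 1 -> 0 <= w x.
Local Notation L q := (itv_int q w (-1) 1).

Lemma itv_int_fine q : (L q)%:E = (\int[mu]_(x in `[(-1)%R, 1%R]) (q.[x] * w x)%:E)%E.
Proof.
rewrite /itv_int /Rintegral fineK//.
by apply: integrable_fin_num => //; exact: (weight_integrable nd1 nd2 wE).
Qed.

Lemma quad_measure_le n p t (nu : {measure set (measurableTypeR R) -> \bar R}) :
  quad_measures w n nu -> (size p <= 2 * n)%N -> major p t ->
  (nu `[(-1)%R, t]%classic <= (L p)%:E)%E.
Proof.
move=> [nu0 H] sp mp.
set D : set (measurableTypeR R) := `[(-1)%R, 1%R]%classic in nu0 H *.
set A : set (measurableTypeR R) := `[(-1)%R, t]%classic.
have mD : measurable D by exact: measurable_itv.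
have mA : measurable A by exact: measurable_itv.
(* [t] is arbitrary, so [[-1, t]] may stick out of [[-1, 1]], but only where [nu] has no mass. *)
have AD : (nu A <= nu (A `&` D))%E.
  rewrite (measureDI nu mA mD) -[leRHS]add0e leeD2r// -nu0 le_measure ?inE//.
    exact: measurableD.
  exact: measurableC.
apply: (le_trans AD).
rewrite itv_int_fine (H p sp) -integral_indic//.
apply: ge0_le_integral => //=.
- by apply/measurable_EFinP; exact: measurable_indic.
- by apply/measurable_EFinP; exact: measurable_horner.
- move=> x; rewrite /D/= in_itv/= => x1; have [p0 p1] := mp x x1.
  rewrite lee_fin indicE; case: (boolP (x \in A)) => //=.
  by rewrite inE /A/= in_itv/= => /andP[_ xt]; exact: p1.
Qed.

(** [fine] sends [-oo], the supremum of an empty family, to [0]; the assumption [0 <= r] covers that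
    case. *)
Lemma fine_ereal_sup_le (S : set (\bar R)) (r : R) : 0 <= r ->
  (forall y, S y -> (y <= r%:E)%E) -> fine (ereal_sup S) <= r.
Proof.
move=> r0 H; have : (ereal_sup S <= r%:E)%E by apply: ge_ereal_sup => y; exact: H.
by case: (ereal_sup S) => [z| |] //=; rewrite lee_fin.
Qed.

Lemma pi_fun_le n p t : (size p <= 2 * n)%N -> major p t -> pi_fun w n t <= L p.
Proof.
move=> sp mp; apply: fine_ereal_sup_le.
  have := itv_int_ge nd1 nd2 wE (l := 0) (q := p) (lexx _) (a := -1) (b := 1).
  rewrite mul0r; apply; rewrite ?lexx// ?lerN10//; last by move=> x x1; have [] := mp x x1; split => //; exact: w0.
by move=> _ [nu qnu <-]; exact: (quad_measure_le qnu).
Qed.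

Lemma atomic_measure (Z : seq R) (lam : R -> R) : (forall z, 0 <= lam z) ->
  exists nu : {measure set (measurableTypeR R) -> \bar R},
   (forall A : set R, nu A = (\sum_(z <- Z) lam z * \1_A z)%:E) /\
   forall (D : set (measurableTypeR R)) (f : R -> R), measurable D -> measurable_fun D f ->
     (forall z, z \in Z -> D z) -> (forall x, D x -> 0 <= f x) ->
     (\int[nu]_(x in D) (f x)%:E = (\sum_(z <- Z) lam z * f z)%:E)%E.
Proof.
move=> lam0; elim: Z => [|z Z [nu [nuE nuI]]].
  exists (mzero : {measure set _ -> \bar R}); split=> [A|D f mD mf _ f0]; rewrite big_nil//.
  by rewrite integral_measure_zero.
pose d : {measure set (measurableTypeR R) -> \bar R} := dirac (z : measurableTypeR R).
pose a : {measure set (measurableTypeR R) -> \bar R} := mscale (NngNum (lam0 z)) d.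
exists (measure_add a nu); split=> [A|D f mD mf ZD f0].
  transitivity (a A + nu A)%E; first exact: measure_addE.
  rewrite nuE big_cons EFinD; congr (_ + _)%E.
have f0' x : D x -> (0 <= (f x)%:E)%E by move=> Dx; rewrite lee_fin f0.
have mf' : measurable_fun D (EFin \o f) by exact/measurable_EFinP.
rewrite ge0_integral_measure_add// nuI//; last by move=> y yZ; apply: ZD; rewrite inE yZ orbT.
rewrite ge0_integral_mscale// integral_dirac// diracE mem_set ?mul1e//=; last first.
  by apply: ZD; rewrite inE eqxx.
by rewrite big_cons EFinD EFinM.
Qed.

Lemma atomic_quad_measure n (Z : seq R) (lam : R -> R) : (forall z, 0 <= lam z) ->
  (forall z, z \in Z -> -1 <= z <= 1) ->
  (forall q, (size q <= 2 * n)%N -> L q = \sum_(z <- Z) lam z * q.[z]) ->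
  exists2 nu, quad_measures w n nu & forall A : set R, nu A = (\sum_(z <- Z) lam z * \1_A z)%:E.
Proof.
move=> lam0 Z1 LE; have [nu [nuE nuI]] := atomic_measure Z lam0.
exists nu => //; split.
  rewrite nuE big_seq big1// => z /Z1 z1; rewrite indicE memNset ?mulr0//=.
move=> q sq; rewrite -itv_int_fine LE//.
set D : set (measurableTypeR R) := `[(-1)%R, 1%R]%classic.
have mD : measurable D by exact: measurable_itv.
have ZD z : z \in Z -> D z by move=> /Z1; rewrite /D/= in_itv.
have [C C0 qC] := horner_bounded q (-1) 1.
(* [nuI] applies to nonnegative integrands only, so [q] is shifted by its bound [C]. *)
have sE : \sum_(z <- Z) lam z * q.[z] =
    \sum_(z <- Z) lam z * (q.[z] + C) - \sum_(z <- Z) lam z * C.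
  by rewrite -sumrB; apply: eq_bigr => z _; ring.
have nuD : (nu D < +oo)%E by rewrite nuE ltry.
have Dq x : D x -> `|q.[x]| <= C by rewrite /D/= in_itv/= => /qC.
rewrite sE EFinB -(nuI D (fun x => q.[x] + C))//; last 2 first.
- by apply: measurable_funD => //; exact: measurable_horner.
- by move=> x /Dq; rewrite ler_norml => /andP[]; lra.
rewrite -(nuI D (fun=> C))//; last by move=> x _; exact: ltW.
have iq (p : {poly R}) : nu.-integrable D (EFin \o (fun x => p.[x])).
  apply: measurable_bounded_integrable => //; first exact: measurable_horner.
  have [c c0 pc] := horner_bounded p (-1) 1.
  exists c; split; first by rewrite num_real.
  by move=> M /ltW cM x /=; rewrite /D/= in_itv/= => /pc /le_trans; apply.
have eC (c : R) : (fun=> c%:E) = EFin \o (fun x => (c%:P).[x]) :> (R -> \bar R).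
  by apply/funext => x /=; rewrite hornerC.
rewrite -integralB//.
- by apply: eq_integral => x _; rewrite -EFinB addrK.
- have := iq (q + C%:P); congr (integrable _ _ _).
  by apply/funext => x /=; rewrite hornerD hornerC.
- by rewrite eC; exact: iq.
Qed.

(** The quadrature formula is itself a measure in the family and gives [[-1, x]] the mass [L p], so
    the bound of [pi_fun_le] is attained. The two bounds also make the supremum finite, which the
    use of [fine] requires. *)
Lemma pi_fun_eq n p x (Z : seq R) (lam : R -> R) : (size p <= 2 * n)%N -> major p x ->
  quadrature (fun q => L q) (2 * n) p x Z lam -> pi_fun w n x = L p.
Proof.
move=> sp mp Q; apply/eqP; rewrite eq_le pi_fun_le//=.
have [_ ZE lam0 LE] := Q.
rewrite (quadrature_val Q sp).
have Z1 z : z \in Z -> -1 <= z <= 1 by rewrite ZE => /andP[].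
have [nu qnu nuE] := atomic_quad_measure lam0 Z1 LE.
have -> : \sum_(z <- Z | z <= x) lam z = fine (nu `[-1, x]%classic).
  rewrite nuE/= big_mkcond/=; apply: eq_big_seq => z /Z1/andP[z1 _].
  rewrite indicE; case: ifP => zx; [rewrite mem_set ?mulr1//= in_itv/= z1 zx//|].
  by rewrite memNset ?mulr0//= in_itv/= zx andbF.
rewrite /pi_fun; set S := [set _ | _ in _].
have Sn : S (nu `[-1, x]%classic) by exists nu.
have h1 : (nu `[(-1)%R, x]%classic <= ereal_sup S)%E by exact: ereal_sup_ubound.
have h2 : (ereal_sup S <= (L p)%:E)%E.
  by apply: ge_ereal_sup => _ [nu' qnu' <-]; exact: (quad_measure_le qnu').
apply: fine_le => //; rewrite ?nuE//.
rewrite fin_numE; apply/andP; split.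
  by rewrite gt_eqF// (lt_le_trans _ h1)// nuE ltNyr.
by rewrite lt_eqF// (le_lt_trans h2)// ltry.
Qed.

End PiFun.

(** * The weight as a difference of monotone functions *)

Section WeightDecomposition.
Variable R : realType.
Implicit Types (g h w : R -> R) (a b u x y : R).

Lemma abs_continuous_variation g (lo hi : R) : abs_continuous_on g lo hi ->
  forall e, 0 < e -> exists2 d, 0 < d & forall a b, lo <= a -> a <= b -> b <= hi -> b - a < d ->
  (total_variation a b g <= e%:E)%E.
Proof.
move=> ac e e0; have [d d0 H] := ac e e0.
exists d => // a b la ab bh bad; apply: ge_ereal_sup => _ [_ [s abs <-] <-]; rewrite lee_fin.
have [ps /eqP lb] := abs.
pose A i := nth b (a :: s) i.
have As i : (i < size s)%N -> A i < A i.+1 by move=> si; move/(pathP b): ps; exact.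
apply/ltW; rewrite /variation big_mkord; apply: (H (size s) A (fun i => A i.+1)).
- move=> i si; split; first by rewrite (le_trans la)// (itv_partition_nth_ge _ abs)// ltnW.
  by split; [exact/ltW/As|rewrite (le_trans _ bh)// (itv_partition_nth_le _ abs)].
- by move=> i _.
have -> : \sum_(i < size s) (A i.+1 - A i) = A (size s) - A 0%N.
  by rewrite -(big_mkord xpredT (fun i => A i.+1 - A i)) telescope_sumr.
by rewrite /A (itv_partition_nth_size _ abs).
Qed.

(** The interval is exhausted in steps of length [d / 2], each of which has variation at most
    [1]. *)
Lemma abs_continuous_bv g (lo hi : R) : abs_continuous_on g lo hi ->
  forall a b, lo <= a -> a <= b -> b <= hi -> total_variation a b g \is a fin_num.
Proof.
move=> ac a b la ab bh; have [d d0 H] := abs_continuous_variation ac (@ltr01 R).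
have fin x y : lo <= x -> x <= y -> y <= hi -> y - x < d -> total_variation x y g \is a fin_num.
  move=> lx xy yh yx; rewrite ge0_fin_numE ?total_variation_ge0//.
  by rewrite (le_lt_trans (H x y lx xy yh yx))// ltry.
have d2 : 0 < d / 2 by rewrite divr_gt0.
suff K k : forall c, a <= c -> c <= hi -> c <= a + k%:R * (d / 2) -> total_variation a c g \is a fin_num.
  apply: (K (Num.bound ((b - a) / (d / 2)))) => //.
  rewrite -lerBlDl -ler_pdivrMr//; apply/ltW/archi_boundP.
  by rewrite divr_ge0 ?(ltW d2)// subr_ge0.
elim: k => [|k IH] c ac' ch.
  rewrite mul0r addr0 => ca; rewrite (_ : c = a) ?total_variationxx//; lra.
rewrite mulrSr mulrDl mul1r => ck; have [|lt] := leP c (a + k%:R * (d / 2)); first exact: IH.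
have kd : 0 <= k%:R * (d / 2) by rewrite mulr_ge0// ltW.
have acc : a <= a + k%:R * (d / 2) by rewrite lerDl.
rewrite (total_variationD _ acc (ltW lt)) fin_numD IH ?lexx//; last first.
  by rewrite (le_trans (ltW lt)).
by rewrite fin// ?(le_trans la)//; lra.
Qed.

Variables (L : nat) (s : nat -> R).

Lemma piece_cover x : -1 <= x <= 1 -> (forall i, (i < L)%N -> s i != x) ->
  exists2 j, (j <= L)%N & piece L s j x.
Proof.
move=> /andP[xN1 x1] sx.
have ex : exists j, (j == L) || (x < s j) by exists L; rewrite eqxx.
case: (ex_minnP ex) => j jP jmin.
have jL : (j <= L)%N by apply: jmin; rewrite eqxx.
exists j => //; split; rewrite /knot.
  case: j jP jmin jL => [|j] jP jmin jL /=.
    by move: xN1; rewrite le_eqVlt => /predU1P[<-|]; [right|left].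
  rewrite jL; left; rewrite lt_neqAle sx//= leNgt; apply/negP => xs.
  by have := jmin j; rewrite xs orbT ltnn => /(_ isT).
rewrite /=; move: jL; rewrite leq_eqVlt => /predU1P[jL|jL].
  rewrite jL ltnn; move: x1; rewrite le_eqVlt => /predU1P[->|]; [by right|by left].
by rewrite jL; left; move: jP; rewrite (ltn_eqF jL).
Qed.

Lemma step_fun_const h x y : step_fun_on L s h -> -1 <= x -> x <= y -> y <= 1 ->
  (forall i, (i < L)%N -> s i < x \/ y < s i) -> h x = h y.
Proof.
move=> sh xN1 xy y1 sxy; have x1 : -1 <= x <= 1 by rewrite xN1 (le_trans xy).
have [i iL|j jL [px1 px2]] := piece_cover x1.
  by have [/lt_eqF ->|/(le_lt_trans xy)/gt_eqF ->] := sxy i iL.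
have [c hc] := sh j jL; rewrite !hc//; split.
  case: px1 => [kx|[j0 xN]]; first by left; exact: lt_le_trans xy.
  move: xy; rewrite xN le_eqVlt => /predU1P[<-|y1']; first by right.
  by left; rewrite j0.
move: px2; rewrite /knot/=; case: ltnP => [jl|Lj] px2.
  case: px2 => [xs|[jL' _]]; last by rewrite jL' ltnn in jl.
  by left; have [/(lt_trans xs)|//] := sxy j jl; rewrite ltxx.
have -> : j = L by apply/eqP; rewrite eqn_leq jL Lj.
by move: y1; rewrite le_eqVlt => /predU1P[->|]; [right|left].
Qed.

Lemma step_fun_bounded h : step_fun_on L s h ->
  exists2 H, 0 <= H & forall x, -1 <= x <= 1 -> `|h x| <= H.
Proof.
move=> sh.
have [H H0 HP] : exists2 H, 0 <= H & forall j, (j <= L)%N -> forall x, piece L s j x -> `|h x| <= H.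
  suff [H H0 HP] : exists2 H, 0 <= H & forall j, (j < L.+1)%N -> forall x, piece L s j x -> `|h x| <= H.
    by exists H.
  have : (L.+1 <= L.+1)%N by [].
  elim: {-2}L.+1 => [_|k IH kL]; first by exists 0.
  have [H H0 HP] := IH (ltnW kL); have [c hc] := sh k kL.
  exists (H + `|c|); first by rewrite addr_ge0.
  move=> j; rewrite ltnS leq_eqVlt => /predU1P[->|jk] x px.
    by rewrite hc// lerDr.
  by rewrite (le_trans (HP j jk x px))// lerDl.
exists (H + \sum_(i < L) `|h (s i)|); first by rewrite addr_ge0// sumr_ge0.
move=> x x1; have [sx|] := pselect (forall i, (i < L)%N -> s i != x).
  by have [j jL /HP xj] := piece_cover x1 sx; rewrite (le_trans (xj jL))// lerDl sumr_ge0.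
move=> /existsNP[i /not_implyP[iL /negP]]; rewrite negbK => /eqP <-.
rewrite (le_trans (_ : _ <= \sum_(i < L) `|h (s i)|))// ?lerDr//.
by rewrite (bigD1 (Ordinal iL))//= lerDl sumr_ge0.
Qed.

(** Each [s i] is counted once when it is reached and once when it is left: the value of the step
    function at [s i] is arbitrary, so it may jump on both sides. *)
Let jumps x : R := \sum_(i < L) ((s i <= x)%R%:R + (s i < x)%R%:R).

Let jumps_le x y : x <= y -> jumps x <= jumps y.
Proof.
move=> xy; apply: ler_sum => i _; apply: lerD; rewrite ler_nat.
  by case: (leP (s i) x) => // /le_trans -> //.
by case: (ltP (s i) x) => // /lt_le_trans -> //.
Qed.

Let jumps_ge1 x y i : x <= y -> (i < L)%N -> x <= s i -> s i <= y -> x < y -> 1 <= jumps y - jumps x.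
Proof.
move=> _ iL xs sy xy; rewrite /jumps -sumrB (bigD1 (Ordinal iL))//=.
rewrite -[leLHS]addr0 lerD//.
  rewrite sy (ltNge (s i) x) xs/=.
  move: xs; rewrite le_eqVlt => /predU1P[xs|xs].
    by rewrite -xs xy lexx/=; lra.
  by rewrite (leNgt (s i) x) xs/=; case: (s i < y) => /=; lra.
apply: sumr_ge0 => j _; rewrite subr_ge0; apply: lerD; rewrite ler_nat.
  by case: (leP (s j) x) => // /le_trans/(_ (ltW xy)) -> .
by case: (ltP (s j) x) => // /lt_trans/(_ xy) -> .
Qed.

Let jumps_const x y : x <= y -> (forall i, (i < L)%N -> s i < x \/ y < s i) -> jumps y = jumps x.
Proof.
move=> xy H; apply: eq_bigr => i _; have [sx|ys] := H i (ltn_ord i).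
  by rewrite sx (ltW sx) (lt_le_trans sx xy) (le_trans (ltW sx) xy).
by rewrite ltNge (ltW ys) leNgt ys (leNgt _ x) (le_lt_trans xy ys) ltNge (ltW (le_lt_trans xy ys)).
Qed.

(** With [V] the variation of [g], [V - g] is nondecreasing, and [h] becomes nondecreasing once
    [2 H] is added at each of its possible jumps. The correction cancels in the difference and is
    constant away from the points [s i], where only the variation of [g] is left in [w1 + w2]. *)
Lemma weight_decomposition w m : admissible_weight w m L s ->
  exists w1 w2, [/\ nondecreasing_fun w1, nondecreasing_fun w2,
   forall x, -1 <= x <= 1 -> w x = w1 x - w2 x &
   forall e, 0 < e -> exists2 d, 0 < d & forall a b, -1 <= a -> a <= b -> b <= 1 -> b - a < d ->
     (forall i, (i < L)%N -> s i < a \/ b < s i) ->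
     (w1 b + w2 b) - (w1 a + w2 a) <= e].
Proof.
move=> [_ [_ [_ [_ [g [h [acg [sh whg]]]]]]]].
have [H H0 hH] := step_fun_bounded sh.
pose V x := fine (total_variation (-1) x g).
have VE x y : -1 <= x -> x <= y -> y <= 1 -> (V y - V x)%:E = total_variation x y g.
  move=> x1 xy y1; rewrite /V (total_variationD _ x1 xy) fineD; last 2 first.
  - exact: (abs_continuous_bv acg (lexx _) x1 (le_trans xy y1)).
  - exact: (abs_continuous_bv acg x1 xy y1).
  by rewrite addrAC subrr add0r fineK// (abs_continuous_bv acg x1 xy y1).
have Vg x y : -1 <= x -> x <= y -> y <= 1 -> `|g y - g x| <= V y - V x.
  by move=> x1 xy y1; rewrite -lee_fin VE// total_variation_ge.
(* Monotonicity is wanted on the whole line, so the functions are continued by constants outside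
   [[-1, 1]]. *)
pose clamp x : R := Num.max (-1) (Num.min x 1).
have c1 x : -1 <= clamp x by rewrite le_max lexx.
have c2 x : clamp x <= 1 by rewrite ge_max ge_min lexx orbT andbT; lra.
have cle x y : x <= y -> clamp x <= clamp y.
  move=> xy; rewrite /clamp !maxEle !minEle.
  case: (leP x 1) => ?; case: (leP y 1) => ? //.
  - by case: (leP (-1) x) => ?; case: (leP (-1) y) => ?; lra.
  - by rewrite (_ : (-1 <= 1 :> R) = true); [case: (leP (-1) x) => ?; lra|apply/idP; lra].
  - by exfalso; lra.
have cid x : -1 <= x <= 1 -> clamp x = x.
  by move=> /andP[x1 x2]; rewrite /clamp (min_idPl x2) (max_idPr x1).
pose f1 x := V x + h x + 2 * H * jumps x.
pose f2 x := V x - g x + 2 * H * jumps x.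
have f1le x y : -1 <= x -> x <= y -> y <= 1 -> f1 x <= f1 y.
  move=> x1 xy y1; have := Vg x y x1 xy y1 => /(le_trans (normr_ge0 _)) V0.
  have [ns|] := pselect (forall i, (i < L)%N -> s i < x \/ y < s i).
    by rewrite /f1 (step_fun_const sh x1 xy y1 ns) (jumps_const xy ns); lra.
  move=> /existsNP[i /not_implyP[iL /not_orP[/negP + /negP]]]; rewrite -!leNgt => xs sy.
  move: xy V0; rewrite le_eqVlt => /predU1P[->//|xy] V0.
  have := jumps_ge1 (ltW xy) iL xs sy xy.
  have := hH x ltac:(lra); have := hH y ltac:(lra).
  by rewrite /f1 !ler_norml => /andP[h1 h2] /andP[h3 h4] j1; nra.
have f2le x y : -1 <= x -> x <= y -> y <= 1 -> f2 x <= f2 y.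
  move=> x1 xy y1; have := Vg x y x1 xy y1; rewrite ler_norml => /andP[_ V0].
  have := jumps_le xy; rewrite /f2; nra.
exists (f1 \o clamp), (f2 \o clamp); split => [x y xy|x y xy|x x1|e e0] /=.
- exact/f1le/c2/cle.
- exact/f2le/c2/cle.
- by rewrite !cid// whg// /f1 /f2; ring.
(* On an interval free of jumps [w1 + w2] increases by that of [2 V - g], at most three times the
   variation of [g]. *)
have e3 : 0 < e / 3 by rewrite divr_gt0.
have [d d0 dP] := abs_continuous_variation acg e3.
exists d => // a b a1 ab b1 bad ns; rewrite !cid; try lra.
have := dP a b a1 ab b1 bad; rewrite -VE// lee_fin => Ve.
have := Vg a b a1 ab b1; rewrite ler_norml => /andP[V0 _].
rewrite /f1 /f2 (step_fun_const sh a1 ab b1 ns) (jumps_const ab ns); lra.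
Qed.
End WeightDecomposition.

(** * Distribution of the nodes *)

Section AtomSums.
Variable R : realType.
Implicit Types (Z : seq R) (lam tau : R -> R) (h t om A : R).

(** The extreme distribution has density [om] on the half line and an atom [A] at [0], for which the
    sum is [om / h + A / h^2]. The list is sorted with the farthest node first, so that Abel
    summation becomes an induction that peels off its head. *)
Lemma sum_atoms_upper Z lam tau h om A : 0 < h -> 0 <= om -> 0 <= A ->
  (forall z, 0 <= lam z) -> (forall z, z \in Z -> 0 <= tau z) ->
  (forall t, 0 <= t -> \sum_(z <- Z | tau z <= t) lam z <= om * t + A) ->
  \sum_(z <- Z) lam z / (h + tau z) ^+ 2 <= om / h + A / h ^+ 2.
Proof.
move=> h0 om0 A0 lam0; pose e := fun a b : R => tau b <= tau a.
have te : transitive e by move=> a b c; rewrite /e => ba cb; exact: le_trans cb ba.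
wlog sZ : Z / sorted e Z.
  move=> W tZ H; have pZ : perm_eq (sort e Z) Z by rewrite perm_sort.
  rewrite -(perm_big _ pZ)/=; apply: W => [|z|t t0].
  - by apply: sort_sorted => a b; exact: le_total.
  - by rewrite (perm_mem pZ); exact: tZ.
  - by rewrite (perm_big _ pZ)/=; exact: H.
pose phi t := (h + t) ^- 2.
(* The right side is the integral of [(om s + A) (- phi'(s))] over [[0, t]], the left side that of
   the mass function against the same weight. *)
have key : forall Z, sorted e Z -> (forall z, z \in Z -> 0 <= tau z) ->
  (forall t, 0 <= t -> \sum_(z <- Z | tau z <= t) lam z <= om * t + A) ->
  forall t, 0 <= t -> (forall z, z \in Z -> tau z <= t) ->
  \sum_(z <- Z) lam z * (phi (tau z) - phi t) <=
    om * (h^-1 - (h + t)^-1) + A * (phi 0 - phi t) - om * t * phi t.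
  elim=> [|y l IH] sl tl ml t t0 lt.
    rewrite big_nil /phi addr0.
    have -> : om * (h^-1 - (h + t)^-1) + A * (h ^- 2 - (h + t) ^- 2) - om * t * (h + t) ^- 2 =
      (om * t ^+ 2 / (h * (h + t) ^+ 2)) + A * (t * (2 * h + t)) / (h ^+ 2 * (h + t) ^+ 2).
      by field; rewrite !gt_eqF//; lra.
    have ht : 0 < h + t by lra.
    by rewrite addr_ge0// divr_ge0 ?mulr_ge0 ?exprn_ge0 ?addr_ge0 ?mulr_ge0 ?(ltW ht) ?(ltW h0).
  have yt : tau y <= t by apply: lt; rewrite inE eqxx.
  have y0 : 0 <= tau y by apply: tl; rewrite inE eqxx.
  have ly z : z \in l -> tau z <= tau y by move/(order_path_min te)/allP : sl; exact.
  have := IH (path_sorted sl) (fun z zl => tl z (mem_behead (s := y :: l) zl)) _ (tau y) y0 ly.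
  have ml' s : 0 <= s -> \sum_(z <- l | tau z <= s) lam z <= om * s + A.
    move=> s0; apply: le_trans (ml s s0); rewrite big_cons; case: ifP => _ //.
    by rewrite lerDr.
  move=> /(_ ml') {}IH.
  have my : \sum_(z <- y :: l) lam z <= om * tau y + A.
    apply: le_trans (ml _ y0); rewrite big_seq [leRHS]big_mkcond [leRHS]big_seq; apply: ler_sum => z.
    by rewrite inE => /predU1P[->|/ly ->]; rewrite ?lexx.
  have -> : \sum_(z <- y :: l) lam z * (phi (tau z) - phi t) =
    \sum_(z <- l) lam z * (phi (tau z) - phi (tau y)) + (\sum_(z <- y :: l) lam z) * (phi (tau y) - phi t).
    rewrite !big_cons mulrDl mulr_suml addrCA -big_split/=; congr (_ + _).
    by apply: eq_bigr => z _; ring.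
  have hy : 0 < h + tau y by lra.
  have ht : 0 < h + t by lra.
  have phiy : 0 <= phi (tau y) - phi t.
    rewrite subr_ge0 /phi lef_pV2 ?posrE ?exprn_gt0// lerXn2r ?nnegrE ?(ltW hy) ?(ltW ht)//; lra.
  have := ler_wpM2r phiy my.
  suff : 0 <= om * ((h + tau y)^-1 - (h + t)^-1 - (t - tau y) * phi t) by nra.
  rewrite mulr_ge0// /phi.
  have -> : (h + tau y)^-1 - (h + t)^-1 - (t - tau y) * (h + t) ^- 2 =
     (t - tau y) ^+ 2 / ((h + tau y) * (h + t) ^+ 2).
    by field; rewrite !gt_eqF.
  by rewrite divr_ge0 ?sqr_ge0// mulr_ge0 ?exprn_ge0// ltW.
move=> tZ mZ.
pose t := \sum_(z <- Z) tau z.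
have t0 : 0 <= t by rewrite /t big_seq sumr_ge0.
have lt z : z \in Z -> tau z <= t.
  move=> zZ; rewrite /t (big_rem z)//= lerDl big_seq sumr_ge0// => y /mem_rem; exact: tZ.
have := key Z sZ tZ mZ t t0 lt.
have mt : \sum_(z <- Z) lam z <= om * t + A.
  apply: le_trans (mZ _ t0); rewrite big_seq [leRHS]big_mkcond [leRHS]big_seq; apply: ler_sum => z.
  by move=> /lt ->.
have ht : 0 < h + t by lra.
have phi0 : 0 <= phi t by rewrite /phi invr_ge0 exprn_ge0// ltW.
have -> : \sum_(z <- Z) lam z * (phi (tau z) - phi t) =
  \sum_(z <- Z) lam z / (h + tau z) ^+ 2 - (\sum_(z <- Z) lam z) * phi t.
  by rewrite mulr_suml -sumrB; apply: eq_bigr => z _; rewrite /phi; ring.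
have := ler_wpM2r phi0 mt.
have -> : A / h ^+ 2 = A * phi 0 by rewrite /phi addr0.
have : 0 <= om * (h + t)^-1 by rewrite mulr_ge0// invr_ge0 ltW.
nra.
Qed.

(** As in [sum_atoms_upper], with the opposite extremal distribution. Masses are known only up to
    distance [r]; the tail and the boundary term at [r] cost at most [om / (h + r)] each. *)
Lemma sum_atoms_lower Z lam tau h om A r : 0 < h -> 0 <= om -> 0 <= A -> 0 <= r ->
  (forall z, 0 <= lam z) -> (forall z, z \in Z -> 0 <= tau z <= r) ->
  (forall t, 0 <= t -> t < r -> om * t - A <= \sum_(z <- Z | tau z <= t) lam z) ->
  om / h - 2 * om / (h + r) - A / h ^+ 2 <= \sum_(z <- Z) lam z / (h + tau z) ^+ 2.
Proof.
move=> h0 om0 A0 r0 lam0; pose e := fun a b : R => tau b <= tau a.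
have te : transitive e by move=> a b c; rewrite /e => ba cb; exact: le_trans cb ba.
wlog sZ : Z / sorted e Z.
  move=> W tZ H; have pZ : perm_eq (sort e Z) Z by rewrite perm_sort.
  rewrite -(perm_big _ pZ)/=; apply: W => [|z|t t0 tr].
  - by apply: sort_sorted => a b; exact: le_total.
  - by rewrite (perm_mem pZ); exact: tZ.
  - by rewrite (perm_big _ pZ)/=; exact: H.
pose phi t := (h + t) ^- 2.
(* Removing the farthest node [y] leaves the mass at [s] unchanged only for [s < tau y], hence the
   strict inequality in the hypothesis; [lim] recovers the bound at the end by letting [s] tend to
   [t]. *)
have lim (t c : R) : 0 < t -> (forall s, 0 <= s -> s < t -> om * s - A <= c) -> om * t - A <= c.
  move=> t0 H; rewrite leNgt; apply/negP => lt.
  have d0 : 0 < om * t - A - c by lra.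
  have [s [s0 st sd]] : exists s, [/\ 0 <= s, s < t & om * (t - s) < om * t - A - c].
    exists (t - Num.min t ((om * t - A - c) / (2 * (om + 1)))).
    have o2 : 0 < 2 * (om + 1) by lra.
    have q0 : 0 < (om * t - A - c) / (2 * (om + 1)) by rewrite divr_gt0.
    split; first by rewrite subr_ge0 ge_min lexx.
      by rewrite ltrBlDr ltrDl lt_min t0.
    rewrite opprB addrC subrK.
    have : Num.min t ((om * t - A - c) / (2 * (om + 1))) <= (om * t - A - c) / (2 * (om + 1)).
      by rewrite ge_min lexx orbT.
    move: (Num.min _ _) => v; rewrite ler_pdivlMr// => vd.
    have [v0|v0] := leP v 0; last by nra.
    have : om * v <= 0 by rewrite mulr_ge0_le0.
    lra.
  have := H s s0 st; lra.
have key : forall Z, sorted e Z -> forall t, 0 <= t -> 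
  (forall z, z \in Z -> 0 <= tau z <= t) ->
  (forall s, 0 <= s -> s < t -> om * s - A <= \sum_(z <- Z | tau z <= s) lam z) ->
   om * (h^-1 - (h + t)^-1) - A * (phi 0 - phi t) - om * t * phi t <=
  \sum_(z <- Z) lam z * (phi (tau z) - phi t).
  elim=> [|y l IH] sl t t0 tl ml.
    rewrite big_nil.
    move: t0; rewrite le_eqVlt => /predU1P[<-|t0].
      by rewrite /phi addr0 !subrr !mulr0 !mul0r; lra.
    have tA : om * t - A <= 0.
      by apply: lim => // s s0 st; have := ml s s0 st; rewrite big_nil.
    have ht : 0 < h + t by lra.
    have : A * (phi 0 - phi t) >= om * t * (phi 0 - phi t).
      rewrite ler_wpM2r ?subr_ge0; try lra.
      rewrite /phi addr0 lef_pV2 ?posrE ?exprn_gt0// lerXn2r ?nnegrE ?(ltW h0) ?(ltW ht)//; lra.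
    suff : 0 <= om * (t * phi 0 - (h^-1 - (h + t)^-1)) by nra.
    rewrite mulr_ge0// /phi addr0.
    have -> : t * h ^- 2 - (h^-1 - (h + t)^-1) = t ^+ 2 / (h ^+ 2 * (h + t)).
      by field; rewrite !gt_eqF.
    by rewrite divr_ge0 ?sqr_ge0// mulr_ge0 ?exprn_ge0// ltW.
  have /andP[y0 yt] : 0 <= tau y <= t by apply: tl; rewrite inE eqxx.
  have ly z : z \in l -> 0 <= tau z <= tau y.
    move=> zl; have /andP[-> _] := tl z (mem_behead (s := y :: l) zl).
    by move: z zl; apply/allP; exact: (order_path_min te).
  have := IH (path_sorted sl) (tau y) y0 ly.
  have ml' s : 0 <= s -> s < tau y -> om * s - A <= \sum_(z <- l | tau z <= s) lam z.
    move=> s0 sy; have := ml s s0 (lt_le_trans sy yt); rewrite big_cons.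
    by rewrite (leNgt (tau y)) sy.
  move=> /(_ ml') {}IH.
  have -> : \sum_(z <- y :: l) lam z * (phi (tau z) - phi t) =
    \sum_(z <- l) lam z * (phi (tau z) - phi (tau y)) + (\sum_(z <- y :: l) lam z) * (phi (tau y) - phi t).
    rewrite !big_cons mulrDl mulr_suml addrCA -big_split/=; congr (_ + _).
    by apply: eq_bigr => z _; ring.
  have hy : 0 < h + tau y by lra.
  have ht : 0 < h + t by lra.
  move: yt; rewrite le_eqVlt => /predU1P[<-|yt]; first by rewrite subrr mulr0 addr0.
  have my : om * t - A <= \sum_(z <- y :: l) lam z.
    apply: lim => [|s s0 st]; first lra.
    apply: le_trans (ml _ s0 st) _; rewrite [leRHS]big_mkcond/=.
    by rewrite [leLHS]big_mkcond/=; apply: ler_sum => z _; case: ifP.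
  have phiy : 0 <= phi (tau y) - phi t.
    rewrite subr_ge0 /phi lef_pV2 ?posrE ?exprn_gt0// lerXn2r ?nnegrE ?(ltW hy) ?(ltW ht)//; lra.
  have := ler_wpM2r phiy my.
  suff : 0 <= om * ((t - tau y) * phi (tau y) - ((h + tau y)^-1 - (h + t)^-1)) by nra.
  rewrite mulr_ge0// /phi.
  have -> : (t - tau y) * (h + tau y) ^- 2 - ((h + tau y)^-1 - (h + t)^-1) =
     (t - tau y) ^+ 2 / ((h + tau y) ^+ 2 * (h + t)).
    by field; rewrite !gt_eqF.
  by rewrite divr_ge0 ?sqr_ge0// mulr_ge0 ?exprn_ge0// ltW.
move=> tZ mZ.
have := key Z sZ r r0 tZ mZ.
have hr : 0 < h + r by lra.
have phi0 : 0 <= phi r by rewrite /phi invr_ge0 exprn_ge0// ltW.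
have : \sum_(z <- Z) lam z * (phi (tau z) - phi r) <= \sum_(z <- Z) lam z / (h + tau z) ^+ 2.
  by apply: ler_sum => z _; rewrite ler_wpM2l// lerBlDr lerDl.
have -> : A / h ^+ 2 = A * phi 0 by rewrite /phi addr0.
have : r * phi r <= (h + r)^-1.
  rewrite /phi expr2 invfM mulrA ler_piMl ?invr_ge0 ?(ltW hr)// ler_pdivrMr// mul1r; lra.
have : 0 <= A * phi r by rewrite mulr_ge0.
move=> h1 h2; have := ler_wpM2l om0 h2; lra.
Qed.
End AtomSums.

Section NodeEstimates.
Variable R : realType.
Implicit Types (p q P : {poly R}) (a b t u x : R) (Z : seq R) (lam : R -> R).

Lemma pint_comp_opp P : pint (P \Po (- 'X)) = pint P.
Proof.
rewrite /pint (@pintE _ _ (- (prim P \Po (- 'X)))).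
  by rewrite !hornerN !horner_comp !hornerN !hornerX !opprK addrC.
by rewrite derivN deriv_comp deriv_prim derivN derivX mulrN1 opprK.
Qed.

Lemma sn_opp t : sn (- t) = sn t.
Proof. by rewrite /sn sqrrN. Qed.

Lemma res_opp n t : res n (- t) = res n t.
Proof. by rewrite /res sn_opp. Qed.

Variables (w w1 w2 : R -> R) (m M : R).
Hypotheses (nd1 : nondecreasing_fun w1) (nd2 : nondecreasing_fun w2).
Hypothesis wE : forall x, -1 <= x <= 1 -> w x = w1 x - w2 x.
Hypothesis m0 : 0 < m.
Hypothesis wm : forall x, -1 <= x <= 1 -> m <= w x <= M.
Local Notation L q := (itv_int q w (-1) 1).

Lemma weight_lin : lin_form (fun q => L q).
Proof. exact: (itv_int_lin nd1 nd2 wE). Qed.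

Lemma weight_itv_bounds q a b : -1 <= a -> a <= b -> b <= 1 ->
  (forall u, a <= u <= b -> 0 <= q.[u]) ->
  m * ((prim q).[b] - (prim q).[a]) <= itv_int q w a b <= M * ((prim q).[b] - (prim q).[a]).
Proof.
move=> a1 ab b1 q0; rewrite (itv_int_ge nd1 nd2 wE)//; last first.
  by move=> u uab; split; [exact: q0|have /andP[] : m <= w u <= M by apply: wm; lra].
rewrite (itv_int_le nd1 nd2 wE)//.
by move=> u uab; split; [exact: q0|have /andP[] : m <= w u <= M by apply: wm; lra].
Qed.

Lemma weight_bounds q : (forall u, -1 <= u <= 1 -> 0 <= q.[u]) -> m * pint q <= L q <= M * pint q.
Proof. by apply: weight_itv_bounds; lra. Qed.

Lemma itv_mass_bounds a b (lo hi : R) : -1 <= a -> a <= b -> b <= 1 ->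
  (forall u, a <= u <= b -> lo <= w u <= hi) ->
  lo * (b - a) <= itv_int 1 w a b <= hi * (b - a).
Proof.
move=> a1 ab b1 H.
have E : b - a = (prim 1).[b] - (prim 1).[a] by rewrite (@pintE _ _ 'X) ?derivX// !hornerX.
rewrite E (itv_int_ge nd1 nd2 wE)//; last first.
  by move=> u uab; rewrite hornerC; split => //; have /andP[] := H u uab.
rewrite (itv_int_le nd1 nd2 wE)//.
by move=> u uab; rewrite hornerC; split => //; have /andP[] := H u uab.
Qed.

(** [P] minus the indicator of [[a, b]] is nonnegative and [w] lies between [m] and [M]. The
    integral is split at [a] and [b] because the indicator is not a polynomial. *)
Lemma weight_major_bounds P a b : -1 <= a -> a <= b -> b <= 1 ->
  (forall u, -1 <= u <= 1 -> 0 <= P.[u]) -> (forall u, a <= u <= b -> 1 <= P.[u]) ->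
  m * (pint P - (b - a)) <= L P - itv_int 1 w a b <= M * (pint P - (b - a)).
Proof.
move=> a1 ab b1 P0 P1.
have bN1 : -1 <= b by lra.
have a1' : a <= 1 by lra.
rewrite (itv_int_split nd1 nd2 wE P (lexx _) a1 a1' (lexx _)).
rewrite (itv_int_split nd1 nd2 wE P a1 ab b1 (lexx _)).
have /andP[l1 u1] := @weight_itv_bounds P (-1) a (lexx _) a1 a1' (fun u uI => P0 u ltac:(lra)).
have /andP[l3 u3] := @weight_itv_bounds P b 1 bN1 b1 (lexx _) (fun u uI => P0 u ltac:(lra)).
have P10 u : a <= u <= b -> 0 <= (P - 1).[u].
  by move=> /P1; rewrite hornerD hornerN hornerC subr_ge0.
have /andP[l2 u2] := @weight_itv_bounds (P - 1) a b a1 ab b1 P10.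
have E : itv_int P w a b = itv_int (P - 1) w a b + itv_int 1 w a b.
  by have := itv_int_lin nd1 nd2 wE a1 b1 1 (P - 1) 1; rewrite scale1r subrK mul1r.
have E2 : (prim (P - 1)).[b] - (prim (P - 1)).[a] = (prim P).[b] - (prim P).[a] - (b - a).
  rewrite (@pintE _ _ (prim P - 'X)) ?derivB ?deriv_prim ?derivX//.
  by rewrite !hornerD !hornerN !hornerX; ring.
by move: l2 u2; rewrite E E2 /pint; lra.
Qed.

Definition exact_on n Z lam := [/\ forall z, 0 <= lam z, forall z, z \in Z -> -1 <= z <= 1 &
  forall q, (size q <= 2 * n)%N -> L q = \sum_(z <- Z) lam z * q.[z]].

Lemma sum_le_of_major n Z lam P (A : {pred R}) : exact_on n Z lam -> (size P <= 2 * n)%N ->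
  (forall u, -1 <= u <= 1 -> 0 <= P.[u] /\ (u \in A -> 1 <= P.[u])) ->
  \sum_(z <- Z | z \in A) lam z <= L P.
Proof.
move=> [lam0 Z1 LE] sP mP; rewrite LE// big_mkcond/= big_seq [leRHS]big_seq.
apply: ler_sum => z /Z1 /mP[P0 P1]; case: ifP => [/P1 zA|_].
  by rewrite -[leLHS]mulr1 ler_wpM2l.
by rewrite mulr_ge0.
Qed.

Lemma weight_ub_gt0 : 0 < M.
Proof. by have /andP[h1 h2] := wm (x := 0) ltac:(lra); exact: lt_le_trans m0 (le_trans h1 h2). Qed.

(** The upper bound integrates a majorant of the step at [t]. The lower one reflects this to bound
    the mass of [[t, 1]] and subtracts it from the total, which is why it concerns the nodes
    strictly before [t]. *)
Lemma mass_bounds : exists2 C : R, 0 < C & forall n Z lam t, (2 <= n)%N -> exact_on n Z lam ->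
  -1 <= t <= 1 ->
  \sum_(z <- Z | z <= t) lam z <= itv_int 1 w (-1) t + C * res n t /\
  itv_int 1 w (-1) t - C * res n t <= \sum_(z <- Z | z < t) lam z.
Proof.
have [C C0 H] := crude_majorant R; exists (M * C); first by rewrite mulr_gt0// weight_ub_gt0.
have M0 := weight_ub_gt0.
move=> n Z lam t n2 ex t1; split.
  have [P [sP mP IP]] := H n t n2 t1.
  have -> : \sum_(z <- Z | z <= t) lam z = \sum_(z <- Z | z \in [pred z | z <= t]) lam z by [].
  apply: le_trans (sum_le_of_major ex sP _) _; first by move=> u /mP[p0 p1]; split.
  have /andP[_] := @weight_major_bounds P (-1) t (lexx _) ltac:(lra) ltac:(lra)
    (fun u uI => (mP u uI).1) (fun u uI => (mP u ltac:(lra)).2 ltac:(lra)).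
  have : M * (pint P - (1 + t)) <= M * (C * res n t) by rewrite ler_pM2l.
  lra.
have tN : -1 <= - t <= 1 by lra.
have [P [sP mP IP]] := H n (- t) n2 tN; rewrite res_opp in IP.
pose Q := P \Po (- 'X).
have Qv u : Q.[u] = P.[- u] by rewrite horner_comp hornerN hornerX.
have sQ : (size Q <= 2 * n)%N by rewrite size_comp_poly2// size_polyN size_polyX.
have mQ u : -1 <= u <= 1 -> 0 <= Q.[u] /\ (t <= u -> 1 <= Q.[u]).
  move=> u1; rewrite Qv; have [|p0 p1] := mP (- u); first by lra.
  by split => // tu; apply: p1; lra.
have : \sum_(z <- Z | z \in [pred z | t <= z]) lam z <= L Q.
  by apply: (sum_le_of_major ex sQ) => u /mQ[q0 q1]; split.
have /andP[_] := @weight_major_bounds Q t 1 ltac:(lra) ltac:(lra) (lexx _)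
    (fun u uI => (mQ u uI).1) (fun u uI => (mQ u ltac:(lra)).2 ltac:(lra)).
rewrite pint_comp_opp.
have : M * (pint P - (1 - t)) <= M * (C * res n t) by rewrite ler_pM2l.
have [lam0 Z1 LE] := ex.
have : L 1 = \sum_(z <- Z | z < t) lam z + \sum_(z <- Z | z \in [pred z | t <= z]) lam z.
  rewrite LE ?size_poly1; last by clear -n2; lia.
  rewrite (bigID (fun z => z < t))/=; congr (_ + _); apply: eq_big => // z; rewrite ?hornerC ?mulr1//.
  by rewrite -leNgt.
have /andP[tl tr] := t1.
have := itv_int_split nd1 nd2 wE 1 (lexx (-1)) tl tr (lexx 1).
lra.
Qed.

(** The polynomial [((k e)^2 - (X - y)^2) J] is positive only within [k e] of [y]. By the second
    moment bound its integral is positive for this [k], so by exactness it is positive at some node.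
    The quadratic factor is the reason for the spare degree in [kernel_exists]. *)
Lemma node_near : exists2 C : R, 0 < C & forall n Z lam t, (2 <= n)%N -> exact_on n Z lam ->
  -1 <= t <= 1 -> exists2 z, z \in Z & `|z - t| <= C * res n t.
Proof.
have M0 := weight_ub_gt0.
pose k : R := M / m * 55 ^+ 3 + 1.
have Mm : 0 <= M / m * 55 ^+ 3 by rewrite mulr_ge0 ?exprn_ge0// divr_ge0// ltW.
have k1 : 1 <= k by rewrite /k lerDr.
exists (18 * (k + 4)); first by rewrite mulr_gt0//; lra.
move=> n Z lam t n2 ex t1.
have [J [y [e [S [[sJ y1 e0 es yt] [S0 J0 JS SJ] [IJ1 IJ0 IJ2]]]]]] := kernel_exists n2 t1.
have [lam0 Z1 LE] := ex.
pose Q := ((k * e) ^+ 2)%:P - ('X - y%:P) ^+ 2.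
have sQ : (size (Q * J)%R <= 2 * n)%N.
  have h : (size Q <= 3)%N.
    rewrite (leq_trans (size_polyD _ _))// geq_max size_polyN (leq_trans (size_polyC_leq1 _))//=.
    by rewrite size_exp_XsubC.
  have := size_polyMleq Q J => /leq_trans; apply.
  by move: h sJ; move: (size Q) (size J) => a b; clear; lia.
have : 0 < L (Q * J).
  have J01 u : -1 <= u <= 1 -> 0 <= J.[u] by [].
  have J02 u : -1 <= u <= 1 -> 0 <= (('X - y%:P) ^+ 2 * J).[u].
    by move=> _; rewrite hornerM horner_exp mulr_ge0// sqr_ge0.
  have /andP[l1 _] := weight_bounds J01.
  have /andP[_ u2] := weight_bounds J02.
  have -> : Q * J = (k * e) ^+ 2 *: J + (-1) *: (('X - y%:P) ^+ 2 * J).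
    by rewrite /Q mulrBl mul_polyC scaleN1r.
  rewrite weight_lin (lin_formZ _ _ weight_lin).
  have ke0 : 0 < (k * e) ^+ 2 by rewrite exprn_gt0// mulr_gt0//; lra.
  have h1 := ler_wpM2l (ltW ke0) l1.
  have h2 := ler_wpM2l (ltW M0) IJ2.
  suff : M * (55 ^+ 3 * e ^+ 2 * pint J) < (k * e) ^+ 2 * (m * pint J) by lra.
  have : M * 55 ^+ 3 < k * m.
    rewrite /k; move: (55 ^+ 3) => c.
    have -> : (M / m * c + 1) * m = M * c + m by field; rewrite gt_eqF.
    by rewrite ltrDl.
  have e2J : 0 < e ^+ 2 * pint J by rewrite mulr_gt0// exprn_gt0.
  rewrite -(ltr_pM2r e2J) => h3.
  have h4 : k * m * (e ^+ 2 * pint J) <= k * (k * m * (e ^+ 2 * pint J)).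
    by rewrite ler_peMl// !mulr_ge0// ltW// ?exprn_gt0//; lra.
  have -> : (k * e) ^+ 2 * (m * pint J) = k * (k * m * (e ^+ 2 * pint J)) by ring.
  by apply: lt_le_trans h4; lra.
rewrite LE// => L0.
have [z zZ z0] : exists2 z, z \in Z & 0 < (Q * J).[z].
  apply: contrapT => H; move: L0; apply/negP; rewrite -leNgt big_seq sumr_le0// => z zZ.
  rewrite mulr_ge0_le0// leNgt; apply/negP => z0.
  by apply: H; exists z.
exists z => //.
have : 0 < Q.[z].
  rewrite ltNge; apply/negP => Qz; move: z0; apply/negP.
  by rewrite -leNgt hornerM mulr_le0_ge0.
rewrite /Q hornerD hornerN hornerC horner_exp hornerXsubC subr_gt0 => /ltW.
have ke0 : 0 <= k * e by rewrite mulr_ge0// ?(ltW e0)//; lra.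
rewrite -ler_sqrt ?exprn_ge0// !sqrtr_sqr (ger0_norm ke0) => zy.
have -> : z - t = (z - y) + (y - t) by ring.
rewrite (le_trans (ler_normD _ _))//.
have : (k + 4) * e <= (k + 4) * (18 * res n t) by rewrite ler_wpM2l//; lra.
lra.
Qed.
End NodeEstimates.

(** * Test polynomials with a pole at a nearby node *)

Section TestPolynomials.
Variables (R : realType) (L : {poly R} -> R).
Hypothesis lL : lin_form L.
Implicit Types (p q r : {poly R}) (u x z : R) (Z : seq R) (lam : R -> R).

Lemma one_sub_sqr_gt0 x : -1 < x -> x < 1 -> 0 < 1 - x ^+ 2.
Proof.
move=> x1 x2; have -> : 1 - x ^+ 2 = (1 - x) * (1 + x) by ring.
by rewrite mulr_gt0//; lra.
Qed.

Lemma double_root p z : p.[z] = 0 -> (p^`()).[z] = 0 -> exists r, p = ('X - z%:P) ^+ 2 * r.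
Proof.
move=> pz dz; have [r pE] := taylor2 p z.
by exists r; rewrite {1}pE pz dz scale0r !add0r.
Qed.

Lemma double_root_ge0 r z (a : R) : a < z -> (forall u, a <= u < z -> 0 <= (u - z) ^+ 2 * r.[u]) ->
  0 <= r.[z].
Proof.
move=> az H; rewrite leNgt; apply/negP => rz.
have rz0 : 0 < - r.[z] by rewrite oppr_gt0.
have [d d0 dP] := horner_near r z rz0.
pose u := Num.max a (z - d / 2).
have [au uz] : a <= u /\ u < z.
  by rewrite /u le_max lexx gt_max az/= ltrBlDr ltrDl divr_gt0.
have ud : z - d / 2 <= u by rewrite /u le_max lexx orbT.
have /dP : `|u - z| < d by rewrite ltr_norml; apply/andP; split; lra.
rewrite ltr_norml => /andP[_ h].
have := H u; rewrite au uz => /(_ isT); rewrite pmulr_rge0; first lra.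
by rewrite lt_neqAle sqr_ge0 andbT eq_sym expf_eq0/= subr_eq0 lt_eqF.
Qed.

Lemma exists_interior_max p z1 z2 : p != 0 -> z1 < z2 -> (forall u, z1 <= u <= z2 -> 0 <= p.[u]) ->
  p.[z1] = 0 -> p.[z2] = 0 -> exists y, [/\ z1 < y < z2, 0 < p.[y] & (p^`()).[y] = 0].
Proof.
move=> p0 z12 pge p1 p2.
have [y yI ymax] := @EVT_max R (fun u => p.[u]) z1 z2 (ltW z12) (@continuous_horner_within R p _).
have [u uI pu] : exists2 u, z1 <= u <= z2 & 0 < p.[u].
  have [s [us sE]] := poly_root_seq p0.
  apply: contrapT => H.
  (* Infinitely many distinct points of [[z1, z2]], more than [p] has roots, so [p] is positive at
     one of them. *)
  pose f (i : nat) := z1 + (z2 - z1) / i.+1%:R.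
  have fs i : f i \in s.
    have i0 : (0 : R) < i.+1%:R by rewrite ltr0n.
    have fI : z1 <= f i <= z2.
      have d0 : 0 <= (z2 - z1) / i.+1%:R by rewrite divr_ge0 ?(ltW i0)//; lra.
      have d1 : (z2 - z1) / i.+1%:R <= z2 - z1.
        by rewrite ler_pdivrMr// ler_peMr ?ler1n//; lra.
      by rewrite /f; move: (_ / _) d0 d1 => v d0 d1; apply/andP; split; lra.
    rewrite sE; apply/eqP; apply/eqP; rewrite eq_le pge// andbT leNgt; apply/negP => pf.
    by apply: H; exists (f i).
  have := uniq_leq_size (s1 := [seq f i | i <- iota 0 (size s).+1]) (s2 := s).
  rewrite size_map size_iota ltnn => K; suff : false by []; apply: K.
    rewrite map_inj_uniq ?iota_uniq// => i j /addrI/mulfI => /(_ _)/invr_inj.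
    by rewrite subr_eq0 gt_eqF// => /(_ isT)/eqP; rewrite eqr_nat eqSS => /eqP.
  by move=> v /mapP[i _ ->].
have py : 0 < p.[y] by rewrite (lt_le_trans pu)// ymax// in_itv.
move: yI; rewrite in_itv/= => /andP[y1 y2].
have yz1 : z1 < y by rewrite lt_neqAle y1 andbT; apply: contraTneq py => <-; rewrite p1 ltxx.
have yz2 : y < z2 by rewrite lt_neqAle y2 andbT; apply: contraTneq py => ->; rewrite p2 ltxx.
exists y; split => //; first by rewrite yz1.
have := is_derive_horner p y; move=> /@derive_val <-.
have /@derive_val -> // : is_derive y 1 (fun v => p.[v]) 0.
apply: (@derive1_at_max _ _ z1 z2); first exact: ltW.
- by move=> t _; have := is_derive_horner p t; move=> [].
- by rewrite in_itv/= yz1.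
- by move=> t; rewrite in_itv/= => /andP[t1 t2]; apply: ymax; rewrite in_itv/= !ltW.
Qed.

(** Based on [(1 - u^2) + 2 u (u - z) = (u - z)^2 + (1 - z^2)]. With [P = (X - z)^2 r] the terms are
    [k (1 - u^2) P'(u) / (u - z)], which vanishes at all nodes but [x] and [z], then [k P(u)], whose
    integral is known, and a multiple of [P(u) / (u - z)^2], which gives the node sum. *)
Lemma deriv_test r z (k : R) u :
  ((k *: ((1 - 'X ^+ 2) * (('X - z%:P) * r)))^`()).[u] =
   k * (1 - u ^+ 2) * (2 * r.[u] + (u - z) * (r^`()).[u]) - k * (u - z) ^+ 2 * r.[u]
   - k * (1 - z ^+ 2) * r.[u].
Proof.
rewrite derivZ !derivM derivXsubC derivB derivC derivXn/= !(horner_exp, hornerXsubC, hornerMn, hornerD, hornerN, hornerZ, hornerX, hornerC, hornerM).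
by rewrite expr1; ring.
Qed.

Lemma deriv_double_root r z u :
  ((('X - z%:P) ^+ 2 * r)^`()).[u] = (u - z) * (2 * r.[u] + (u - z) * (r^`()).[u]).
Proof.
rewrite derivM deriv_exp derivXsubC /= !(horner_exp, hornerXsubC, hornerMn, hornerD, hornerN, hornerZ, hornerX, hornerC, hornerM).
by rewrite expr1; ring.
Qed.

(** The count is tight: [1 - X^2] adds two degrees, and dividing by [X - z] and differentiating take
    away one each. *)
Lemma size_deriv_test n r z (k : R) : (0 < n)%N -> (size (('X - z%:P) ^+ 2 * r)%R <= 2 * n)%N ->
  (size ((k *: ((1 - 'X ^+ 2) * (('X - z%:P) * r)))^`())%R <= 2 * n)%N.
Proof.
move=> n0; set F := k *: _.
have [->|F0] := eqVneq F 0; first by rewrite deriv0 size_poly0.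
have r0 : r != 0 by apply: contraNneq F0 => r0; rewrite /F r0 !mulr0 scaler0.
rewrite size_monicM ?monic_exp ?monicXsubC// size_exp_XsubC => sr.
have := lt_size_deriv F0 => sF; rewrite -ltnS; apply: leq_trans sF _.
rewrite (leq_trans (size_scale_leq _ _))//.
have h2 : size (('X - z%:P) * r) = (size r).+1 by rewrite size_monicM ?monicXsubC// size_XsubC.
have h3 : (size (1 - 'X ^+ 2 : {poly R})%R <= 3)%N.
  rewrite (leq_trans (size_polyD _ _))// geq_max size_poly1/= size_polyN.
  by rewrite size_polyXn.
apply: leq_trans (size_polyMleq _ _) _; rewrite h2; move: h3 sr.
by move: (size (1 - 'X ^+ 2)%R) (size r) => a b; clear; lia.
Qed.

(** The scalar satisfies [k (1 - x^2) = z - x], so by [deriv_test] the two sides agree at every node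
    but [z]. There the right side has the extra [k (1 - z^2) r(z)], nonnegative because [p >= 0]
    near its double zero. *)
Lemma upper_test n p x z Z lam : (0 < n)%N -> -1 < x -> x < z -> z < 1 ->
  (size p <= 2 * n)%N -> major p x -> quadrature L (2 * n) p x Z lam -> z \in Z ->
  let k := (z - x) / (1 - x ^+ 2) in
  exists2 r, p = ('X - z%:P) ^+ 2 * r &
  \sum_(y <- Z | y == x) lam y * - (p^`()).[x] <=
    - L ((- k *: ((1 - 'X ^+ 2) * (('X - z%:P) * r)))^`()) + k * L p
    + k * (1 - z ^+ 2) * \sum_(y <- Z | y <= x) lam y / (z - y) ^+ 2.
Proof.
move=> n0 xN1 xz z1 sp mp [uZ ZE lam0 LE] zZ k.
have tz : touch p x z by rewrite -ZE.
have pz : p.[z] = 0 by move: tz; rewrite /touch (leNgt z x) xz => /andP[_ /eqP].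
have dz : (p^`()).[z] = 0.
  by apply: (touch_deriv_eq0 mp tz) => //; rewrite ?gt_eqF//; lra.
have [r pE] := double_root pz dz; exists r => //.
have x2 : 0 < 1 - x ^+ 2 by apply: one_sub_sqr_gt0; lra.
have z2 : 0 < 1 - z ^+ 2 by apply: one_sub_sqr_gt0; lra.
have k0 : 0 < k by rewrite divr_gt0// subr_gt0.
have rz : 0 <= r.[z].
  apply: (@double_root_ge0 r z (-1)); first lra.
  move=> u /andP[u1 uz]; have [|+ _] := mp u; first lra.
  by rewrite pE hornerM horner_exp hornerXsubC.
set F := - k *: _.
have sF : (size (F^`()) <= 2 * n)%N by apply: size_deriv_test => //; rewrite -pE.
have -> : - L F^`() + k * L p = L ((-1) *: F^`() + k *: p) by rewrite (lL (-1)) (lin_formZ k p lL); ring.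
rewrite LE; last first.
  rewrite (leq_trans (size_polyD _ _))// geq_max !(leq_trans (size_scale_leq _ _))//.
rewrite [X in X <= _]big_mkcond [X in _ + _ * X]big_mkcond mulr_sumr -big_split/=.
rewrite big_seq [leRHS]big_seq; apply: ler_sum => u uZ'.
have tu : touch p x u by rewrite -ZE.
have u1 : -1 <= u <= 1 by case/andP: tu.
rewrite hornerD !hornerZ deriv_test.
have pu : p.[u] = (u - z) ^+ 2 * r.[u] by rewrite pE hornerM horner_exp hornerXsubC.
have dpu : (p^`()).[u] = (u - z) * (2 * r.[u] + (u - z) * (r^`()).[u]) by rewrite pE deriv_double_root.
set D := 2 * r.[u] + _ in dpu *.
have -> : -1 * (- k * (1 - u ^+ 2) * D - - k * (u - z) ^+ 2 * r.[u] - - k * (1 - z ^+ 2) * r.[u]) + k * p.[u] =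
   k * (1 - u ^+ 2) * D - k * (1 - z ^+ 2) * r.[u] by rewrite pu; ring.
have [uz|uz] := eqVneq u z.
  rewrite uz (gt_eqF xz) (leNgt z x) xz/= mulr0 addr0 /D uz subrr mul0r addr0.
  rewrite mulr_ge0//.
  have -> : k * (1 - z ^+ 2) * (2 * r.[z]) - k * (1 - z ^+ 2) * r.[z] = k * (1 - z ^+ 2) * r.[z] by ring.
  by rewrite mulr_ge0// mulr_ge0// ltW.
have uz0 : u - z != 0 by rewrite subr_eq0.
have [ux|ux] := eqVneq u x.
  have px : p.[u] = 1 by move: tu; rewrite /touch ux lexx => /andP[_ /eqP].
  have rE : r.[u] = 1 / (z - u) ^+ 2.
    by rewrite -px pu; field; rewrite -opprB oppr_eq0.
  have DE : D = (p^`()).[u] / (u - z) by rewrite dpu mulrC mulKf.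
  rewrite ux lexx in DE rE uz0 *; rewrite DE rE le_eqVlt; apply/orP; left; apply/eqP.
  rewrite /k; field; rewrite uz0 (gt_eqF x2) /=.
  by rewrite andbT subr_eq0 eq_sym -subr_eq0.
have D0 : (1 - u ^+ 2) * D = 0.
  have [->|uN1] := eqVneq u (-1); first by rewrite sqrrN expr1n subrr mul0r.
  have [->|u11] := eqVneq u 1; first by rewrite expr1n subrr mul0r.
  have /andP[ua ub] := u1.
  have : (u - z) * D = 0.
    by rewrite -dpu (touch_deriv_eq0 mp tu)// lt_neqAle ?(eq_sym (-1)) ?uN1 ?u11.
  by move/eqP; rewrite mulf_eq0 (negbTE uz0)/= => /eqP ->; rewrite mulr0.
have -> : k * (1 - u ^+ 2) * D = 0 by rewrite -mulrA D0 mulr0.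
rewrite sub0r; case: ifPn => ux'.
  have p1 : p.[u] = 1 by move: tu; rewrite /touch ux' => /andP[_ /eqP].
  have -> : r.[u] = 1 / (z - u) ^+ 2.
    by rewrite -p1 pu; field; rewrite -opprB oppr_eq0.
  rewrite le_eqVlt; apply/orP; left; apply/eqP; ring.
have : p.[u] = 0 by move: tu; rewrite /touch (negbTE ux') => /andP[_ /eqP].
rewrite pu => /eqP; rewrite mulf_eq0 expf_eq0 (negbTE uz0) andbF/= => /eqP ->.
by rewrite !mulr0 oppr0 mulr0 addr0.
Qed.

(** The mirror image of [upper_test] with [p - 1], which is nonnegative up to [x] and equals [-1] at
    the nodes beyond. The extra term at [z] now has the opposite sign. *)
Lemma lower_test n p x z Z lam : (0 < n)%N -> -1 < z -> z < x -> x < 1 ->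
  (size p <= 2 * n)%N -> major p x -> quadrature L (2 * n) p x Z lam -> z \in Z ->
  let k := (x - z) / (1 - x ^+ 2) in
  exists2 r, p - 1 = ('X - z%:P) ^+ 2 * r &
    - L ((k *: ((1 - 'X ^+ 2) * (('X - z%:P) * r)))^`()) - k * (L p - L 1)
    + k * (1 - z ^+ 2) * \sum_(y <- Z | x < y) lam y / (y - z) ^+ 2
  <= \sum_(y <- Z | y == x) lam y * - (p^`()).[x].
Proof.
move=> n0 zN1 zx x1 sp mp [uZ ZE lam0 LE] zZ k.
have tz : touch p x z by rewrite -ZE.
have pz : (p - 1).[z] = 0.
  by move: tz; rewrite /touch (ltW zx) hornerD hornerN hornerC => /andP[_ /eqP ->]; rewrite subrr.
have d1 : (p - 1)^`() = p^`() by rewrite derivB derivC subr0.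
have dz : ((p - 1)^`()).[z] = 0.
  by rewrite d1 (touch_deriv_eq0 mp tz)// ?lt_eqF//; lra.
have [r pE] := double_root pz dz; exists r => //.
have x2 : 0 < 1 - x ^+ 2 by apply: one_sub_sqr_gt0; lra.
have z2 : 0 < 1 - z ^+ 2 by apply: one_sub_sqr_gt0; lra.
have k0 : 0 < k by rewrite divr_gt0// subr_gt0.
have rz : 0 <= r.[z].
  apply: (@double_root_ge0 r z (-1)); first lra.
  move=> u /andP[u1 uz]; have [|_ pu1] := mp u; first lra.
  have {pu1} : 1 <= p.[u] by apply: pu1; lra.
  rewrite -subr_ge0; congr (0 <= _); have := congr1 (fun q => q.[u]) pE.
  by rewrite hornerD hornerN hornerC hornerM horner_exp hornerXsubC.
set F := k *: _.
have s1 : (size (p - 1)%R <= 2 * n)%N.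
  by rewrite (leq_trans (size_polyD _ _))// geq_max sp size_polyN size_poly1 muln_gt0.
have sF : (size (F^`()) <= 2 * n)%N by apply: size_deriv_test => //; rewrite -pE.
have -> : - L F^`() - k * (L p - L 1) = L ((-1) *: F^`() + (- k) *: (p - 1)).
  have -> : p - 1 = (-1) *: 1 + p by rewrite scaleN1r addrC.
  by rewrite (lL (-1) F^`()) (lin_formZ _ _ lL) (lL (-1) 1); ring.
rewrite LE; last first.
  by rewrite (leq_trans (size_polyD _ _))// geq_max !(leq_trans (size_scale_leq _ _)).
rewrite [X in _ <= X]big_mkcond [X in _ + _ * X]big_mkcond mulr_sumr -big_split/=.
rewrite big_seq [leRHS]big_seq; apply: ler_sum => u uZ'.
have tu : touch p x u by rewrite -ZE.
have u1 : -1 <= u <= 1 by case/andP: tu.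
rewrite hornerD !hornerZ deriv_test.
have pu : (p - 1).[u] = (u - z) ^+ 2 * r.[u] by rewrite pE hornerM horner_exp hornerXsubC.
have pu1 : p.[u] - 1 = (u - z) ^+ 2 * r.[u] by rewrite -pu hornerD hornerN hornerC.
have dpu : (p^`()).[u] = (u - z) * (2 * r.[u] + (u - z) * (r^`()).[u]) by rewrite -d1 pE deriv_double_root.
set D := 2 * r.[u] + _ in dpu *.
have -> : -1 * (k * (1 - u ^+ 2) * D - k * (u - z) ^+ 2 * r.[u] - k * (1 - z ^+ 2) * r.[u]) + - k * (p - 1).[u] =
   - (k * (1 - u ^+ 2) * D) + k * (1 - z ^+ 2) * r.[u] by rewrite pu; ring.
have [uz|uz] := eqVneq u z.
  rewrite uz (lt_eqF zx) ltNge (ltW zx)/= mulr0 addr0 /D uz subrr mul0r addr0.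
  rewrite mulr_ge0_le0//.
  have -> : - (k * (1 - z ^+ 2) * (2 * r.[z])) + k * (1 - z ^+ 2) * r.[z] = - (k * (1 - z ^+ 2) * r.[z]) by ring.
  by rewrite oppr_le0 mulr_ge0// mulr_ge0// ltW.
have uz0 : u - z != 0 by rewrite subr_eq0.
have [ux|ux] := eqVneq u x.
  have r0 : r.[u] = 0.
    have : p.[u] - 1 = 0 by move: tu; rewrite /touch ux lexx => /andP[_ /eqP ->]; rewrite subrr.
    by rewrite pu1 => /eqP; rewrite mulf_eq0 expf_eq0 (negbTE uz0) andbF/= => /eqP.
  have DE : D = (p^`()).[u] / (u - z) by rewrite dpu mulrC mulKf.
  rewrite r0 ux ltxx in DE uz0 *; rewrite DE le_eqVlt; apply/orP; left; apply/eqP.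
  by rewrite /k; field; rewrite uz0 (gt_eqF x2).
have D0 : (1 - u ^+ 2) * D = 0.
  have [->|uN1] := eqVneq u (-1); first by rewrite sqrrN expr1n subrr mul0r.
  have [->|u11] := eqVneq u 1; first by rewrite expr1n subrr mul0r.
  have /andP[ua ub] := u1.
  have : (u - z) * D = 0.
    by rewrite -dpu (touch_deriv_eq0 mp tu)// lt_neqAle ?(eq_sym (-1)) ?uN1 ?u11.
  by move/eqP; rewrite mulf_eq0 (negbTE uz0)/= => /eqP ->; rewrite mulr0.
have -> : k * (1 - u ^+ 2) * D = 0 by rewrite -mulrA D0 mulr0.
rewrite oppr0 add0r; have [xu|ux'] := ltP x u.
  have p0 : p.[u] = 0 by move: tu; rewrite /touch (leNgt u x) xu => /andP[_ /eqP].
  have -> : r.[u] = - 1 / (u - z) ^+ 2 by move: pu1; rewrite p0 sub0r => ->; field.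
  rewrite le_eqVlt; apply/orP; left; apply/eqP; ring.
have p1 : p.[u] - 1 = 0 by move: tu; rewrite /touch ux' => /andP[_ /eqP ->]; rewrite subrr.
move: p1; rewrite pu1 => /eqP; rewrite mulf_eq0 expf_eq0 (negbTE uz0) andbF/= => /eqP ->.
by rewrite !mulr0 addr0.
Qed.
End TestPolynomials.

(** * Size of the majorant and of the test polynomials near [x] *)

Section LocalBounds.
Variable R : realType.
Implicit Types (p P r F : {poly R}) (u x z : R).

Lemma horner_lipschitz P (a b D : R) : a <= b -> (forall u, a <= u <= b -> `|(P^`()).[u]| <= D) ->
  `|P.[b] - P.[a]| <= D * (b - a).
Proof.
move=> ab H.
have mono Q : (forall u, a <= u <= b -> 0 <= (Q^`()).[u]) -> Q.[a] <= Q.[b].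
  by move=> Q0; apply: (@le_of_is_derive _ (fun y => Q.[y]) (fun y => (Q^`()).[y])) => // y _; exact: is_derive_horner.
have h1 : (D *: 'X - P).[a] <= (D *: 'X - P).[b].
  apply: mono => u /H; rewrite ler_norml => /andP[_ hu].
  by rewrite derivB derivZ derivX hornerD hornerN hornerZ hornerC mulr1 subr_ge0.
have h2 : (D *: 'X + P).[a] <= (D *: 'X + P).[b].
  apply: mono => u /H; rewrite ler_norml => /andP[hu _].
  by rewrite derivD derivZ derivX hornerD hornerZ hornerC mulr1; lra.
move: h1 h2; rewrite !(hornerD, hornerN, hornerZ, hornerX) => h1 h2.
rewrite ler_norml; apply/andP; split; lra.
Qed.

Lemma sn_gt0 x : -1 < x -> x < 1 -> 0 < sn x.
Proof. by move=> x1 x2; rewrite /sn sqrtr_gt0 one_sub_sqr_gt0. Qed.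

Lemma sn_le1 u : sn u <= 1.
Proof. by rewrite /sn -[leRHS]sqrtr1 ler_wsqrtr// gerBl sqr_ge0. Qed.

Lemma sqr_sn_le x u : -1 <= x <= 1 -> -1 <= u <= 1 -> sn u ^+ 2 <= sn x ^+ 2 + 2 * `|u - x|.
Proof.
move=> x1 u1; rewrite !sqr_sn//.
have : `|u ^+ 2 - x ^+ 2| <= 2 * `|u - x|.
  rewrite subr_sqr normrM mulrC ler_wpM2r// ler_norml; apply/andP; split; lra.
rewrite ler_norml => /andP[]; lra.
Qed.

Lemma near_itv x u : -1 < x -> x < 1 -> `|u - x| <= sn x ^+ 2 / 4 -> -1 < u < 1.
Proof.
move=> x1 x2; rewrite sqr_sn; last lra.
rewrite ler_norml => /andP[a b]; apply/andP; split; nra.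
Qed.

Lemma near_sn x u : -1 < x -> x < 1 -> `|u - x| <= sn x ^+ 2 / 4 ->
  sn x ^+ 2 / 2 <= sn u ^+ 2 <= 2 * sn x ^+ 2.
Proof.
move=> x1 x2 ux; have /andP[u1 u2] := near_itv x1 x2 ux.
move: ux; rewrite !sqr_sn; try lra.
rewrite ler_norml => /andP[a b].
have [xu|ux] := leP x u; apply/andP; split; nra.
Qed.

Lemma near_sn_le x u : -1 < x -> x < 1 -> `|u - x| <= sn x ^+ 2 / 4 ->
  sn x / 2 <= sn u <= 2 * sn x.
Proof.
move=> x1 x2 ux; have /andP[h1 h2] := near_sn x1 x2 ux.
have g0 := sn_gt0 x1 x2; have s0 := sn_ge0 u.
by apply/andP; split; nra.
Qed.

Lemma dist_le_left x t u (s : R) : x - t <= u <= x -> t <= s -> `|u - x| <= s.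
Proof. by rewrite ler_norml => /andP[? ?] ?; apply/andP; split; lra. Qed.

Lemma dist_le_right x t u (s : R) : x <= u <= x + t -> t <= s -> `|u - x| <= s.
Proof. by rewrite ler_norml => /andP[? ?] ?; apply/andP; split; lra. Qed.

Lemma dist_gt_left x u (s t : R) : t < s -> u <= x - s -> (`|u - x| <= t) = false.
Proof. by move=> *; apply/negP; rewrite ler_norml => /andP[? ?]; lra. Qed.

Lemma dist_gt_right x u (s t : R) : t < s -> x + s <= u -> (`|u - x| <= t) = false.
Proof. by move=> *; apply/negP; rewrite ler_norml => /andP[? ?]; lra. Qed.

Lemma inv_sqr_add_le (a h t : R) : 0 < a -> a < t -> 0 < h ->
  (h + t) ^- 2 <= 4 / (a + t) ^+ 2.
Proof.
move=> a0 at' h0; have s0 : 0 < a + t by lra.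
have -> : 4 / (a + t) ^+ 2 = ((a + t) / 2) ^- 2 by field; rewrite gt_eqF.
by rewrite lef_pV2 ?posrE ?exprn_gt0 ?lerXn2r ?nnegrE//; lra.
Qed.

Lemma sum_le_split (Z : seq R) (lam : R -> R) y x : y <= x ->
  \sum_(z <- Z | z <= x) lam z =
  \sum_(z <- Z | z < y) lam z + \sum_(z <- Z | y <= z <= x) lam z.
Proof.
move=> yx; rewrite (bigID (fun z => z < y))/=; congr (_ + _); apply: eq_bigl => z.
  by case: (ltP z y) => h; rewrite ?andbF// andbT (le_trans (ltW h)).
by rewrite -leNgt andbC.
Qed.

Section Scale.
Variables (n : nat) (x : R).
Hypotheses (n0 : (0 < n)%N) (xN1 : -1 < x) (x1 : x < 1) (ng : 1 <= n%:R * sn x).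
Local Notation g := (sn x).
Local Notation rho := (sn x / n%:R).

Let N0 : (0 : R) < n%:R. Proof. by rewrite ltr0n. Qed.
Let g0 : 0 < g. Proof. exact: sn_gt0. Qed.

Lemma inv_sqr_le_scale : n%:R ^- 2 <= rho.
Proof.
rewrite -[leLHS]mul1r ler_pdivrMr ?exprn_gt0//.
by have -> : rho * n%:R ^+ 2 = n%:R * g :> R by field; rewrite gt_eqF.
Qed.

Lemma res_center_le : res n x <= 2 * rho.
Proof. by have := inv_sqr_le_scale; rewrite /res; lra. Qed.

Lemma res_near_le u : `|u - x| <= g ^+ 2 / 4 -> res n u <= 3 * rho.
Proof.
move=> /(near_sn_le xN1 x1)/andP[_ h]; have := inv_sqr_le_scale.
have : sn u / n%:R <= 2 * sn x / n%:R by rewrite ler_pM2r ?invr_gt0.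
rewrite /res; lra.
Qed.

(** [2 |u - x|] is twice the product of [n |u - x|] and [1 / n], so [sn x^2 + 2 |u - x|], which
    bounds [sn u^2], is at most the square of [sn x + n |u - x| + 1 / n]. *)
Lemma res_far_le u : -1 <= u <= 1 -> res n u <= 3 * rho + `|u - x|.
Proof.
move=> u1; set d := `|u - x|; have d0 : 0 <= d by exact: normr_ge0.
have su : sn u ^+ 2 <= g ^+ 2 + 2 * d.
  by apply: sqr_sn_le => //; rewrite (ltW xN1) (ltW x1).
have h : sn u <= g + n%:R * d + n%:R^-1.
  have i0 : (0 : R) < n%:R^-1 by rewrite invr_gt0.
  have e : n%:R * n%:R^-1 = 1 :> R by rewrite mulfV// gt_eqF.
  have s0 := sn_ge0 u.
  rewrite leNgt; apply/negP => lt.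
  have : (g + n%:R * d + n%:R^-1) ^+ 2 < sn u ^+ 2.
    by rewrite ltrXn2r ?nnegrE//; rewrite !addr_ge0 ?mulr_ge0// ltW.
  have : 0 <= n%:R * d * g by rewrite !mulr_ge0// ltW.
  have : 0 <= (n%:R * d) ^+ 2 by rewrite sqr_ge0.
  have : 0 <= g * n%:R^-1 by rewrite mulr_ge0// ltW.
  have : n%:R * d * n%:R^-1 = d by rewrite mulrAC e mul1r.
  have : 0 < n%:R^-1 ^+ 2 :> R by rewrite exprn_gt0.
  move: (n%:R^-1) (n%:R * d) => i nd; nra.
have := inv_sqr_le_scale.
have : sn u / n%:R <= (g + n%:R * d + n%:R^-1) / n%:R by rewrite ler_pM2r ?invr_gt0.
have -> : (g + n%:R * d + n%:R^-1) / n%:R = rho + d + n%:R ^- 2 by field; rewrite gt_eqF.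
by rewrite /res; lra.
Qed.
End Scale.

Lemma major_local_bounds (C1 : R) : 0 <= C1 -> exists2 C : R, 1 <= C & forall n p x,
  (2 <= n)%N -> (size p <= 2 * n)%N -> -1 < x -> x < 1 -> 1 <= n%:R * sn x -> major p x ->
  pint p - (1 + x) <= C1 * res n x ->
  (forall u, -1 <= u <= 1 -> p.[u] * sn u <= C * (sn x + sn u)) /\
  (forall u, `|u - x| <= sn x ^+ 2 / 4 -> `|(p^`()).[u]| <= C * (n%:R / sn x)).
Proof.
move=> C10; have [C C0 H] := major_bound R.
pose Cq := C * (2 * C1 + 1).
have Cq0 : 0 < Cq by rewrite mulr_gt0//; lra.
pose Cd := 2 * C * (3 * (C1 + 1) + 12 * Cq).
have Cd0 : 0 < Cd by rewrite !mulr_gt0//; lra.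
exists (1 + Cq + Cd); first lra.
move=> n p x n2 sp xN1 x1 ng mp Ip.
have n0 : (0 < n)%N by exact: ltnW.
have N0 : (0 : R) < n%:R by rewrite ltr0n.
have g0 := sn_gt0 xN1 x1.
have x11 : -1 <= x <= 1 by lra.
have B u : -1 <= u <= 1 -> p.[u] * sn u <= Cq * (sn x + sn u).
  move=> u1; have [h _] := H n p x u n2 sp x11 mp u1.
  apply: le_trans h _; rewrite /Cq -mulrA ler_pM2l//.
  have e1 : n%:R * res n u = sn u + n%:R^-1 by rewrite /res; field; rewrite gt_eqF.
  have e2 : n%:R * (C1 * res n x) = C1 * (sn x + n%:R^-1) by rewrite /res; field; rewrite gt_eqF.
  have i1 : n%:R^-1 <= sn x by rewrite -div1r ler_pdivrMr// mulrC.
  have := ler_wpM2l (ltW N0) Ip; rewrite e2 => h2.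
  have := ler_wpM2l C10 i1; have s0 := sn_ge0 u.
  have := mulr_ge0 C10 s0; clear -h2 e1 i1 s0 g0; lra.
split=> [u u1|u ux].
  apply: le_trans (B u u1) _; rewrite ler_wpM2r//; last lra.
  by rewrite addr_ge0 ?sn_ge0// ltW.
have /andP[u1 u2] := near_itv xN1 x1 ux.
have u11 : -1 <= u <= 1 by lra.
have [_ h] := H n p x u n2 sp x11 mp u11.
have /andP[s1 _] := near_sn xN1 x1 ux.
have /andP[s2 _] := near_sn_le xN1 x1 ux.
have s0 : 0 < sn u by clear -g0 s2; lra.
have p0 : 0 <= p.[u] by have [] := mp u u11.
have pu : p.[u] <= 3 * Cq.
  have hB := B u u11.
  rewrite -(ler_pM2r s0); apply: (le_trans hB).
  have -> : 3 * Cq * sn u = Cq * (3 * sn u) by ring.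
  by rewrite ler_pM2l//; clear -s2; lra.
pose a := n%:R * sn x.
have rE (c : R) : n%:R ^+ 2 * (c * (sn x / n%:R)) = c * a by rewrite /a; field; rewrite gt_eqF.
have r1 : n%:R ^+ 2 * res n u <= 3 * a.
  by rewrite -rE ler_pM2l ?exprn_gt0// res_near_le.
have r2 : n%:R ^+ 2 * res n x <= 2 * a.
  by rewrite -rE ler_pM2l ?exprn_gt0// res_center_le.
have r3 : n%:R ^+ 2 * (pint p - (1 + x) + res n u) <= 2 * C1 * a + 3 * a.
  have := ler_wpM2l (sqr_ge0 n%:R) Ip; have := ler_wpM2l C10 r2; clear -r1; lra.
have r4 : p.[u] * (1 + n%:R ^+ 2 * res n u) <= 3 * Cq * (4 * a).
  by rewrite ler_pM//; [rewrite addr_ge0// mulr_ge0 ?sqr_ge0// ltW// res_gt0|rewrite -/a in ng; clear -r1 ng; lra].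
have h3 : `|(p^`()).[u]| * (sn x ^+ 2 / 2) <= C * ((3 * (C1 + 1) + 12 * Cq) * a).
  apply: le_trans (ler_wpM2l (normr_ge0 _) s1) _; apply: (le_trans h).
  rewrite ler_pM2l//.
  have : 0 <= C1 * a by rewrite mulr_ge0// (le_trans ler01).
  by clear -r3 r4; lra.
have h4 : `|(p^`()).[u]| <= Cd * (n%:R / sn x).
  rewrite -(ler_pM2r (_ : 0 < sn x ^+ 2 / 2)) ?divr_gt0 ?exprn_gt0//.
  apply: (le_trans h3); rewrite le_eqVlt; apply/orP; left; apply/eqP.
  by rewrite /Cd /a; field; rewrite gt_eqF.
apply: (le_trans h4); rewrite ler_wpM2r//; last by clear -Cq0; lra.
by rewrite divr_ge0// ltW.
Qed.

Section TestPolyArithmetic.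
Variables g rho C K T h : R.
Hypotheses (g0 : 0 < g) (rho0 : 0 < rho) (C1 : 1 <= C) (K1 : 1 <= K) (T0 : 0 < T).
Hypotheses (h0 : 0 < h) (hK : h <= 2 * K * rho) (Tg : T * rho <= g ^+ 2 / 4).
Variables A B d : R.
Hypothesis A0 : 0 <= A.

(** In this lemma and the next two, [A] stands for [|F(u)|], [B] for [|u - z|], [d] for [|u - x|]
    and [h] for [|z - x|]. *)
Lemma test_far_arith : T * rho < d -> h <= T * rho / 2 -> d - h <= B ->
  A * B <= h / g ^+ 2 * (C * (2 * g ^+ 2 + 3 * d)) -> A <= 20 * C * K / T.
Proof.
move=> dT hT hz AB.
have [C0 Tr0] : 0 <= C /\ 0 < T * rho by split; [exact: le_trans C1|exact: mulr_gt0].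
have g20 : 0 < g ^+ 2 by rewrite exprn_gt0.
have dp : 0 < d by exact: lt_trans dT.
have d2 : 0 < d / 2 by rewrite divr_gt0.
have dh : d / 2 <= B by lra.
have f2 : A <= h * (C * (4 / d + 6 / g ^+ 2)).
  rewrite -(ler_pM2r d2) (le_trans (ler_wpM2l A0 dh))// (le_trans AB)//.
  by rewrite le_eqVlt; apply/orP; left; apply/eqP; field; rewrite !gt_eqF.
have f3 : 4 / d <= 4 / (T * rho) by rewrite ler_pM2l// lef_pV2 ?posrE//; exact: ltW.
have Tg' : T * rho <= g ^+ 2 by have := Tg; lra.
have f4 : 6 / g ^+ 2 <= 6 / (T * rho) by rewrite ler_pM2l// lef_pV2 ?posrE.
have f5 : C * (4 / d + 6 / g ^+ 2) <= C * (10 / (T * rho)).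
  by rewrite ler_wpM2l//; lra.
have f6 : 0 <= C * (4 / d + 6 / g ^+ 2).
  by rewrite mulr_ge0// addr_ge0// divr_ge0// ltW.
apply: (le_trans f2); apply: (le_trans (ler_pM (ltW h0) f6 hK f5)).
by rewrite le_eqVlt; apply/orP; left; apply/eqP; field; rewrite !gt_eqF.
Qed.

Lemma test_mid_arith : d <= g ^+ 2 / 4 -> rho <= B ->
  A * B <= h / g ^+ 2 * (C * (2 * g ^+ 2 + 3 * d)) -> A <= 6 * K * C.
Proof.
move=> dg Br AB; have C0 : 0 <= C by exact: le_trans C1.
have g20 : 0 < g ^+ 2 by rewrite exprn_gt0.
rewrite -(ler_pM2r rho0) (le_trans (ler_wpM2l A0 Br))// (le_trans AB)//.
apply: (@le_trans _ _ (h / g ^+ 2 * (C * (3 * g ^+ 2)))).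
  rewrite ler_wpM2l ?divr_ge0 ?(ltW h0) ?(ltW g20)// ler_wpM2l//.
  by lra.
have -> : h / g ^+ 2 * (C * (3 * g ^+ 2)) = 3 * C * h by field; rewrite gt_eqF.
have -> : 6 * K * C * rho = 3 * C * (2 * K * rho) by ring.
by rewrite ler_wpM2l// mulr_ge0.
Qed.

Lemma test_near_arith : 0 < B -> A * B <= h / g ^+ 2 * (2 * g ^+ 2 * (C / rho * B)) -> A <= 6 * K * C.
Proof.
move=> B0 AB; have C0 : 0 <= C by exact: le_trans C1.
rewrite -(ler_pM2r B0) (le_trans AB)//.
have -> : h / g ^+ 2 * (2 * g ^+ 2 * (C / rho * B)) = (2 * C * B / rho) * h.
  by field; rewrite !gt_eqF.
have c0 : 0 <= 2 * C * B / rho by rewrite divr_ge0 ?(ltW rho0)// !mulr_ge0// ltW.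
apply: (le_trans (ler_wpM2l c0 hK)).
have -> : 2 * C * B / rho * (2 * K * rho) = 4 * (K * C * B) by field; rewrite gt_eqF.
have -> : 6 * K * C * B = 6 * (K * C * B) by ring.
by rewrite ler_wpM2r ?ler_nat// !mulr_ge0 ?(ltW B0)// (le_trans ler01).
Qed.
End TestPolyArithmetic.

(* [k (1 - u^2) P(u) / (u - z)], written with the double root of [P] at [z] divided out, is small away from [x] and bounded near it. *)
Lemma test_poly_bounds n (C K T k : R) P r x z : (0 < n)%N -> -1 < x -> x < 1 ->
  1 <= C -> 1 <= K -> 4 * K <= T -> 4 * T <= n%:R * sn x ->
  P = ('X - z%:P) ^+ 2 * r ->
  K * (sn x / n%:R) <= `|z - x| <= 2 * K * (sn x / n%:R) ->
  `|k| = `|z - x| / sn x ^+ 2 ->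
  (forall u, -1 <= u <= 1 -> `|P.[u]| * sn u <= C * (sn x + sn u)) ->
  (forall u, `|u - x| <= sn x ^+ 2 / 4 -> `|(P^`()).[u]| <= C * (n%:R / sn x)) ->
  forall u, -1 <= u <= 1 ->
  `|(k *: ((1 - 'X ^+ 2) * (('X - z%:P) * r))).[u]| <=
    if `|u - x| <= T * (sn x / n%:R) then 6 * K * C else 20 * C * K / T.
Proof.
move=> n0 xN1 x1 C1 K1 KT Tn PE /andP[h1 h2] kE B D u u1.
have N0 : (0 : R) < n%:R by rewrite ltr0n.
have g0 := sn_gt0 xN1 x1.
have x11 : -1 <= x <= 1 by rewrite !ltW.
set F := k *: _.
have rho0 : 0 < sn x / n%:R by rewrite divr_gt0.
have T0 : 0 < T by clear -K1 KT; lra.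
have Trho : T * (sn x / n%:R) <= sn x ^+ 2 / 4.
  by rewrite mulrA ler_pdivrMr//; have := ler_wpM2l (ltW g0) Tn; clear; lra.
have h0 : 0 < `|z - x| by rewrite (lt_le_trans _ h1)// mulr_gt0// (lt_le_trans ltr01).
have hT : `|z - x| <= T * (sn x / n%:R) / 2.
  by have := ler_wpM2r (ltW rho0) KT; clear -h2; lra.
have FE : F.[u] * (u - z) = k * ((1 - u ^+ 2) * P.[u]).
  by rewrite PE /F !(horner_exp, hornerXsubC, hornerD, hornerN, hornerZ, hornerX, hornerC, hornerM); ring.
have FN : `|F.[u]| * `|u - z| = `|z - x| / sn x ^+ 2 * (sn u ^+ 2 * `|P.[u]|).
  by rewrite -normrM FE !normrM kE -sqr_sn// (ger0_norm (sqr_ge0 (sn u))).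
have kap0 : 0 <= `|z - x| / sn x ^+ 2 by rewrite divr_ge0 ?sqr_ge0.
have C0 : 0 <= C by exact: le_trans C1.
have AB : `|F.[u]| * `|u - z| <= `|z - x| / sn x ^+ 2 * (C * (2 * sn x ^+ 2 + 3 * `|u - x|)).
  rewrite FN ler_wpM2l//.
  have hb := ler_wpM2r (sn_ge0 u) (B u u1).
  have hc : (sn x + sn u) * sn u <= 2 * sn x ^+ 2 + 3 * `|u - x|.
    by have := sqr_ge0 (sn x - sn u); have := sqr_sn_le x11 u1; clear; lra.
  by have := ler_wpM2l C0 hc; clear -hb; lra.
have hz : `|u - x| - `|z - x| <= `|u - z|.
  by rewrite lerBlDr (_ : u - x = (u - z) + (z - x)) ?ler_normD//; ring.
case: ifPn => [dT|]; last first.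
  by rewrite -ltNge => dT; apply: (test_far_arith g0 rho0 C1 T0 h0 h2 Trho _ dT hT hz AB).
have dg : `|u - x| <= sn x ^+ 2 / 4 by exact: le_trans Trho.
(* At distance at least [rho] from [z] the division by [u - z] is harmless. Closer, [P(z) = 0] and
   the derivative bound give [|P(u)| <= C (n / sn x) |u - z|], which cancels the denominator. *)
have [uz|zu] := leP (sn x / n%:R) `|u - z|.
  exact: (test_mid_arith g0 rho0 C1 h0 h2 _ dg uz AB).
have [uz0|uz0] := eqVneq u z.
  rewrite /F !(horner_exp, hornerXsubC, hornerD, hornerN, hornerZ, hornerX, hornerC, hornerM) uz0 subrr.
  by rewrite mul0r !mulr0 normr0 mulr_ge0// mulr_ge0// (le_trans ler01).
have uzp : 0 < `|u - z| by rewrite normr_gt0 subr_eq0.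
have zg : `|z - x| <= sn x ^+ 2 / 4.
  by apply: le_trans hT _; move: rho0 T0 Trho; clear => ? ? ?; nra.
have nb v : Num.min u z <= v <= Num.max u z -> `|v - x| <= sn x ^+ 2 / 4.
  move: dg zg; clear; rewrite !ler_norml minEle maxEle => /andP[z3 z4] /andP[u3 u4].
  by case: ifP => _ /andP[v1 v2]; apply/andP; split; lra.
have Pz : P.[z] = 0.
  by rewrite PE hornerM horner_exp hornerXsubC subrr expr0n/= mul0r.
have Plip : `|P.[u]| <= C * (n%:R / sn x) * `|u - z|.
  have [uz|uz] := leP u z.
    have := @horner_lipschitz P u z (C * (n%:R / sn x)) uz.
    rewrite Pz sub0r normrN (distrC u) (ger0_norm (_ : 0 <= z - u)) ?subr_ge0//; apply.
    by move=> v vI; apply: D; apply: nb; rewrite (min_idPl uz) (max_idPr uz).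
  have := @horner_lipschitz P z u (C * (n%:R / sn x)) (ltW uz).
  rewrite Pz subr0 (gtr0_norm (_ : 0 < u - z)) ?subr_gt0//; apply.
  by move=> v vI; apply: D; apply: nb; rewrite (min_idPr (ltW uz)) (max_idPl (ltW uz)).
have /andP[_ s4] := near_sn xN1 x1 dg.
apply: (test_near_arith (rho := sn x / n%:R) g0 rho0 C1 K1 h2 uzp).
by rewrite FN ler_wpM2l// ler_pM ?sqr_ge0// invf_div.
Qed.
End LocalBounds.

(** * Node masses and node sums on the two sides of [x] *)

Section PointEstimates.
Variable R : realType.
Implicit Types (p r F : {poly R}) (u x z t : R) (Z : seq R) (lam : R -> R).
Variables (w w1 w2 : R -> R) (m M : R).
Hypotheses (nd1 : nondecreasing_fun w1) (nd2 : nondecreasing_fun w2).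
Hypothesis wE : forall x, -1 <= x <= 1 -> w x = w1 x - w2 x.
Hypothesis m0 : 0 < m.
Hypothesis wm : forall x, -1 <= x <= 1 -> m <= w x <= M.
Local Notation L q := (itv_int q w (-1) 1).
Local Notation W t := (itv_int 1 w (-1) t).
Local Notation v t := (w1 t + w2 t).

(** Integration by parts on three pieces: the boundary terms telescope and vanish at [-1] and [1],
    leaving sup times variation on each piece. *)
Lemma deriv_functional_bound F (a b Bf Bn : R) : -1 <= a -> a <= b -> b <= 1 ->
  F.[-1] = 0 -> F.[1] = 0 ->
  (forall u, -1 <= u <= a -> `|F.[u]| <= Bf) -> (forall u, b <= u <= 1 -> `|F.[u]| <= Bf) ->
  (forall u, a <= u <= b -> `|F.[u]| <= Bn) ->
  `|L F^`()| <= Bf * (v 1 - v (-1)) + Bn * (v b - v a).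
Proof.
move=> a1 ab b1 FN F1 Ba Bb Bab.
have b1' : -1 <= b by lra.
have a1' : a <= 1 by lra.
have h1 := weight_ibp nd1 nd2 wE (lexx (-1)) a1 a1' Ba.
have h2 := weight_ibp nd1 nd2 wE a1 ab b1 Bab.
have h3 := weight_ibp nd1 nd2 wE b1' b1 (lexx 1) Bb.
rewrite (itv_int_split nd1 nd2 wE _ (lexx (-1)) a1 a1' (lexx 1)).
rewrite (itv_int_split nd1 nd2 wE _ a1 ab b1 (lexx 1)).
have B0 : 0 <= Bf by apply: le_trans (Ba (-1) _) => //; rewrite lexx.
have := mulr_ge0 B0 (_ : 0 <= v b - v a).
have -> : 0 <= v b - v a by have := nd1 ab; have := nd2 ab; lra.
move: h1 h2 h3; rewrite FN F1 !ler_norml => /andP[? ?] /andP[? ?] /andP[? ?] /(_ isT) ?.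
by apply/andP; split; lra.
Qed.

Variables (n : nat) (x : R) (Z : seq R) (lam : R -> R) (Cm T e : R).
Hypotheses (n2 : (2 <= n)%N) (xN1 : -1 < x) (x1 : x < 1).
Hypothesis ex : exact_on w n Z lam.
Hypothesis Cm0 : 0 <= Cm.
Hypothesis mass : forall t, -1 <= t <= 1 ->
  \sum_(z <- Z | z <= t) lam z <= W t + Cm * res n t /\
  W t - Cm * res n t <= \sum_(z <- Z | z < t) lam z.
Local Notation g := (sn x).
Local Notation rho := (sn x / n%:R).
Hypotheses (T1 : 1 <= T) (Tn : 8 * T <= n%:R * sn x).
Hypothesis osc : forall a b, x - 2 * T * rho <= a -> a <= b -> b <= x + 2 * T * rho ->
  v b - v a <= e.

Let n0 : (0 < n)%N. Proof. exact: ltnW. Qed.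
Let N0 : (0 : R) < n%:R. Proof. by rewrite ltr0n. Qed.
Let g0 : 0 < g. Proof. exact: sn_gt0. Qed.
Let rho0 : 0 < rho. Proof. by rewrite divr_gt0. Qed.
Let ng1 : 1 <= n%:R * g. Proof. by have := Tn; have := T1; lra. Qed.
Let Trho : 2 * T * rho <= g ^+ 2 / 4.
Proof. by rewrite mulrA ler_pdivrMr//; have := ler_wpM2l (ltW g0) Tn; lra. Qed.
Let e0 : 0 <= e.
Proof.
have Tr : 0 < T * rho by rewrite mulr_gt0//; have := T1; lra.
have h : v x - v x <= e by apply: osc => //; lra.
by rewrite subrr in h.
Qed.
Let lam0 z : 0 <= lam z. Proof. by have [] := ex. Qed.
Let TT : T * rho <= 2 * T * rho.
Proof. by rewrite -mulrA ler_peMl ?ler1n// mulr_ge0 ?(ltW rho0)// (le_trans ler01). Qed.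

Lemma weight_near u : `|u - x| <= 2 * T * rho -> w x - e <= w u <= w x + e.
Proof.
move=> ux; have /andP[u1 u2] := near_itv xN1 x1 (le_trans ux Trho).
have [xN1' x1' Tr0] : [/\ -1 < x, x < 1 & 0 < T * rho].
  by split => //; rewrite mulr_gt0//; have := T1; lra.
move: ux; rewrite ler_norml => /andP[ua ub].
rewrite !wE; try lra.
have [xu|/ltW xu] := leP x u.
  have := osc (a := x) (b := u) ltac:(lra) xu ltac:(lra); have := nd1 xu; have := nd2 xu; lra.
have := osc (a := u) (b := x) ltac:(lra) xu ltac:(lra); have := nd1 xu; have := nd2 xu; lra.
Qed.

Lemma mass_left t : 0 <= t -> t <= T * rho ->
  \sum_(z <- Z | x - t <= z <= x) lam z <= (w x + e) * t + 6 * Cm * rho.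
Proof.
move=> t0 tT; have [xN1' x1' Tr0] : [/\ -1 < x, x < 1 & 0 < T * rho].
  by split => //; rewrite mulr_gt0//; have := T1; lra.
have tx : `|x - t - x| <= g ^+ 2 / 4.
  by rewrite addrAC subrr add0r normrN ger0_norm//; have := Trho; lra.
have /andP[u1 u2] := near_itv xN1 x1 tx.
have [_ h1] := mass (t := x - t) ltac:(lra).
have [h2 _] := mass (t := x) ltac:(lra).
have r1 := res_near_le n0 xN1 x1 ng1 tx.
have r2 := res_center_le n0 ng1.
have := ler_wpM2l Cm0 r1; have := ler_wpM2l Cm0 r2 => q1 q2.
have : 0 <= Cm * rho by rewrite mulr_ge0// ltW.
have := itv_int_split nd1 nd2 wE 1 (lexx (-1)) (ltW u1) (_ : x - t <= x) (ltW x1).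
have xt : x - t <= x by rewrite gerBl.
move=> /(_ xt) sp.
have /andP[_ h3] : (w x - e) * (x - (x - t)) <= itv_int 1 w (x - t) x <= (w x + e) * (x - (x - t)).
  apply: (itv_mass_bounds nd1 nd2 wE (ltW u1) xt (ltW x1)) => u uI.
  by apply: weight_near; exact: dist_le_left uI (le_trans tT TT).
have := sum_le_split Z lam xt.
lra.
Qed.

(** Far from [x] only the order of magnitude matters. For [t >= rho] the [O(rho)] errors go into the
    slope, so that no additive constant remains. *)
Lemma mass_left_far t : rho <= t ->
  \sum_(z <- Z | x - t <= z <= x) lam z <= (M + 7 * Cm) * t.
Proof.
move=> rt; have [xN1' x1' rp] : [/\ -1 < x, x < 1 & 0 < rho] by [].
have M0 : 0 < M by exact: (weight_ub_gt0 m0 wm).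
have cm0 := Cm0.
pose y := Num.max (-1) (x - t).
have [y1 yt yx] : [/\ -1 <= y, x - t <= y & y <= x].
  by rewrite /y !le_max !lexx orbT ge_max; split => //; apply/andP; split; lra.
have -> : \sum_(z <- Z | x - t <= z <= x) lam z = \sum_(z <- Z | y <= z <= x) lam z.
  have [_ Z1 _] := ex.
  rewrite big_seq_cond [RHS]big_seq_cond; apply: eq_bigl => z; case: (boolP (z \in Z)) => //= /Z1/andP[z1 _].
  by rewrite /y ge_max z1.
have [_ h1] := mass (t := y) ltac:(lra).
have [h2 _] := mass (t := x) ltac:(lra).
have r1 := res_far_le n0 xN1 x1 ng1 (_ : -1 <= y <= 1).
have r2 := res_center_le n0 ng1.
have dy : `|y - x| <= t by apply: (dist_le_left (t := t)); rewrite ?yt.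
have {r1} r1 : res n y <= 3 * rho + t by apply: le_trans (r1 _) _; rewrite ?lerD2l// y1 (le_trans yx (ltW x1)).
have := ler_wpM2l Cm0 r1; have := ler_wpM2l Cm0 r2 => q1 q2.
have q3 : Cm * rho <= Cm * t by rewrite ler_wpM2l.
have q4 : 0 <= Cm * rho by rewrite mulr_ge0// ltW.
have := itv_int_split nd1 nd2 wE 1 (lexx (-1)) y1 yx (ltW x1) => sp.
have /andP[_ h3] : m * (x - y) <= itv_int 1 w y x <= M * (x - y).
  apply: (itv_mass_bounds nd1 nd2 wE y1 yx (ltW x1)) => u /andP[ua ub].
  by apply: wm; rewrite (le_trans y1 ua) (le_trans ub (ltW x1)).
have h4 : M * (x - y) <= M * t by rewrite ler_pM2l// lerBlDr addrC -lerBlDr.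
have := sum_le_split Z lam yx.
lra.
Qed.

Lemma mass_right t : 0 <= t -> t <= T * rho ->
  (w x - e) * t - 6 * Cm * rho <= \sum_(z <- Z | x < z <= x + t) lam z.
Proof.
move=> t0 tT; have [xN1' x1' Tr0] : [/\ -1 < x, x < 1 & 0 < T * rho].
  by split => //; rewrite mulr_gt0//; have := T1; lra.
have tx : `|x + t - x| <= g ^+ 2 / 4.
  by rewrite addrAC subrr add0r ger0_norm//; have := Trho; lra.
have /andP[u1 u2] := near_itv xN1 x1 tx.
have [_ h1] := mass (t := x + t) ltac:(lra).
have [h2 _] := mass (t := x) ltac:(lra).
have r1 := res_near_le n0 xN1 x1 ng1 tx.
have r2 := res_center_le n0 ng1.
have := ler_wpM2l Cm0 r1; have := ler_wpM2l Cm0 r2 => q1 q2.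
have : 0 <= Cm * rho by rewrite mulr_ge0// ltW.
have xt : x <= x + t by lra.
have := itv_int_split nd1 nd2 wE 1 (lexx (-1)) (ltW xN1) xt (ltW u2) => sp.
have /andP[h3 _] : (w x - e) * (x + t - x) <= itv_int 1 w x (x + t) <= (w x + e) * (x + t - x).
  apply: (itv_mass_bounds nd1 nd2 wE (ltW xN1) xt (ltW u2)) => u uI.
  by apply: weight_near; exact: dist_le_right uI (le_trans tT TT).
have : \sum_(z <- Z | z < x + t) lam z <= \sum_(z <- Z | z <= x) lam z + \sum_(z <- Z | x < z <= x + t) lam z.
  rewrite big_mkcond [X in _ <= X + _]big_mkcond [X in _ <= _ + X]big_mkcond -big_split/=.
  apply: ler_sum => z _; have l0 := lam0 z.
  case: (ltP z (x + t)) => h; case: (leP z x) => h' /=; rewrite ?(ltW h) ?addr0 ?add0r//.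
  by case: ifP.
lra.
Qed.

Variable K : R.
Hypotheses (K1 : 1 <= K) (KT : 4 * K <= T).

Lemma left_sum_bound z : K * rho <= z - x -> z - x <= 2 * K * rho ->
  (z - x) * \sum_(y <- Z | y <= x) lam y / (z - y) ^+ 2 <=
    w x + e + 6 * Cm / K + 8 * (M + 7 * Cm) * K / T.
Proof.
move=> h1 h2; set h := z - x in h1 h2 *.
have [K1' T1' KT' rp cm0] : [/\ 1 <= K, 1 <= T, 4 * K <= T, 0 < rho & 0 <= Cm] by [].
have [K0 T0] : 0 < K /\ 0 < T by split; lra.
have h0 : 0 < h by apply: lt_le_trans h1; rewrite mulr_gt0.
have r0 : 0 < T * rho by rewrite mulr_gt0.
have rr : rho <= T * rho by rewrite ler_peMl// ltW.
have om0 : 0 <= w x + e.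
  have [? ?] : -1 < x /\ x < 1 by [].
  have /andP[? _] : m <= w x <= M by apply: wm; lra.
  have := m0; have := e0; lra.
have M0 : 0 < M by exact: (weight_ub_gt0 m0 wm).
pose tau y := x - y.
have sE : \sum_(y <- Z | y <= x) lam y / (z - y) ^+ 2 =
   \sum_(y <- [seq y <- Z | x - T * rho <= y <= x]) lam y / (h + tau y) ^+ 2 +
   \sum_(y <- [seq y <- Z | y < x - T * rho]) lam y / (h + tau y) ^+ 2.
  rewrite !big_filter (bigID (fun y => x - T * rho <= y))/=; congr (_ + _).
    apply: eq_big => [y|y _]; first by rewrite andbC.
    by congr (_ / _ ^+ 2); rewrite /h /tau; ring.
  apply: eq_big => [y|y _]; last by congr (_ / _ ^+ 2); rewrite /h /tau; ring.
  by rewrite -ltNge; case: (ltP y (x - T * rho)) => // yx; rewrite ?andbF// andbT; lra.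
have near := @sum_atoms_upper _ [seq y <- Z | x - T * rho <= y <= x] lam tau h (w x + e) (6 * Cm * rho).
have A0 : 0 <= 6 * Cm * rho by rewrite !mulr_ge0// ltW.
have /near {}near : 0 < h by [].
have {near} := near om0 A0 lam0.
have nz z' : z' \in [seq y <- Z | x - T * rho <= y <= x] -> 0 <= tau z'.
  by rewrite mem_filter => /andP[/andP[_ ?] _]; rewrite /tau; lra.
move=> /(_ nz) near.
have {near} near : \sum_(y <- [seq y <- Z | x - T * rho <= y <= x]) lam y / (h + tau y) ^+ 2
    <= (w x + e) / h + 6 * Cm * rho / h ^+ 2.
  apply: near => t t0; rewrite big_filter_cond.
  have [tr|/ltW tr] := leP t (T * rho).
    apply: le_trans (mass_left t0 tr); rewrite le_eqVlt; apply/orP; left; apply/eqP.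
    apply: eq_bigl => y; rewrite /tau.
    have -> : (x - y <= t) = (x - t <= y) by rewrite lerBlDl lerBlDr.
    rewrite andbAC; case: (leP (x - t) y) => ty; last by rewrite andbF.
    by rewrite andbT (le_trans _ ty)// lerD2l lerN2.
  have mr := mass_left (ltW r0) (lexx _).
  apply: (@le_trans _ _ ((w x + e) * (T * rho) + 6 * Cm * rho)); last first.
    by rewrite lerD2r ler_wpM2l.
  apply: le_trans mr; rewrite [leLHS]big_mkcond [leRHS]big_mkcond/=; apply: ler_sum => y _.
  by case: (x - T * rho <= y <= x) => //=; case: ifP.
(* Beyond [T rho] the shift [h] is replaced by [T rho], at the cost of a factor [4]. The far nodes
   have no mass up to distance [T rho], so [mass_left_far] applies with [A = 0]. *)
have far := @sum_atoms_upper _ [seq y <- Z | y < x - T * rho] lam tau (T * rho) (M + 7 * Cm) 0 r0.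
have C90 : 0 <= M + 7 * Cm by lra.
have {far} far := far C90 (lexx 0) lam0.
have fz z' : z' \in [seq y <- Z | y < x - T * rho] -> 0 <= tau z'.
  by rewrite mem_filter => /andP[? _]; rewrite /tau; lra.
move: far => /(_ fz) far.
have {far} far : \sum_(y <- [seq y <- Z | y < x - T * rho]) lam y / (T * rho + tau y) ^+ 2
    <= (M + 7 * Cm) / (T * rho) + 0 / (T * rho) ^+ 2.
  apply: far => t t0; rewrite big_filter_cond addr0.
  have [tr|/ltW tr] := leP t (T * rho).
    rewrite big_pred0 ?mulr_ge0// => y; apply/negbTE/negP => /andP[yx].
    by rewrite /tau => yt; lra.
  apply: le_trans (mass_left_far (le_trans rr tr)).
  rewrite [leLHS]big_mkcond [leRHS]big_mkcond/=; apply: ler_sum => y _.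
  case: (ltP y (x - T * rho)) => /= yx; last by case: ifP.
  case: ifP => [yt|_]; last by case: ifP.
  by rewrite ifT//; apply/andP; rewrite /tau in yt; split; lra.
have far4 : \sum_(y <- [seq y <- Z | y < x - T * rho]) lam y / (h + tau y) ^+ 2 <=
   4 * ((M + 7 * Cm) / (T * rho)).
  move: far; rewrite mul0r addr0 => far.
  apply: (@le_trans _ _ (4 * \sum_(y <- [seq y <- Z | y < x - T * rho]) lam y / (T * rho + tau y) ^+ 2)); last first.
    by rewrite ler_pM2l.
  rewrite mulr_sumr big_seq [leRHS]big_seq; apply: ler_sum => y.
  rewrite mem_filter => /andP[yx _]; rewrite mulrCA ler_wpM2l//.
  by apply: inv_sqr_add_le => //; rewrite /tau ltrBrDl -ltrBrDr.
rewrite sE.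
apply: (@le_trans _ _ (h * ((w x + e) / h + 6 * Cm * rho / h ^+ 2 + 4 * ((M + 7 * Cm) / (T * rho))))).
  by rewrite ler_pM2l// lerD.
have -> : h * ((w x + e) / h + 6 * Cm * rho / h ^+ 2 + 4 * ((M + 7 * Cm) / (T * rho))) =
  w x + e + 6 * Cm * rho / h + 4 * (M + 7 * Cm) / (T * rho) * h.
  by field; rewrite !gt_eqF.
have e1 : 6 * Cm * rho / h <= 6 * Cm / K.
  rewrite ler_pdivrMr// -[leLHS]mulrA.
  have -> : 6 * Cm / K * h = 6 * (Cm * (h / K)) by field; rewrite gt_eqF.
  by rewrite ler_pM2l// ler_wpM2l// ler_pdivlMr// mulrC.
have e2 : 4 * (M + 7 * Cm) / (T * rho) * h <= 8 * (M + 7 * Cm) * K / T.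
  have -> : 8 * (M + 7 * Cm) * K / T = 4 * (M + 7 * Cm) / (T * rho) * (2 * K * rho).
    by field; rewrite !gt_eqF.
  by rewrite ler_wpM2l// divr_ge0 ?(ltW r0)// mulr_ge0.
by lra.
Qed.

(** All terms are nonnegative, so the nodes beyond [x + T rho] are dropped; after multiplication by
    [h] the lost tail is [O(K / T)]. The condition [e <= m] keeps the density [w x - e]
    nonnegative. *)
Lemma right_sum_bound z : e <= m -> K * rho <= x - z -> x - z <= 2 * K * rho ->
  w x - e - 4 * M * K / T - 6 * Cm / K <=
    (x - z) * \sum_(y <- Z | x < y) lam y / (y - z) ^+ 2.
Proof.
move=> em h1 h2; set h := x - z in h1 h2 *.
have [K1' T1' KT' rp cm0] : [/\ 1 <= K, 1 <= T, 4 * K <= T, 0 < rho & 0 <= Cm] by [].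
have [K0 T0] : 0 < K /\ 0 < T by split; lra.
have h0 : 0 < h by apply: lt_le_trans h1; rewrite mulr_gt0.
have r0 : 0 < T * rho by rewrite mulr_gt0.
have /andP[om0 omM] : 0 <= w x - e <= M.
  have [? ?] : -1 < x /\ x < 1 by [].
  have /andP[? ?] : m <= w x <= M by apply: wm; lra.
  have := e0 => ?; apply/andP; split; lra.
pose tau y := y - x.
have A0 : 0 <= 6 * Cm * rho by rewrite !mulr_ge0// ltW.
have := @sum_atoms_lower _ [seq y <- Z | x < y <= x + T * rho] lam tau h (w x - e) (6 * Cm * rho) (T * rho)
  h0 om0 A0 (ltW r0) lam0.
have nz y : y \in [seq y <- Z | x < y <= x + T * rho] -> 0 <= tau y <= T * rho.
  by rewrite mem_filter => /andP[/andP[? ?] _]; rewrite /tau; apply/andP; split; lra.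
move=> /(_ nz) H.
have {}H : (w x - e) / h - 2 * (w x - e) / (h + T * rho) - 6 * Cm * rho / h ^+ 2 <=
    \sum_(y <- [seq y <- Z | x < y <= x + T * rho]) lam y / (h + tau y) ^+ 2.
  apply: H => t t0 tr; apply: le_trans (mass_right t0 (ltW tr)) _.
  rewrite big_filter_cond [leLHS]big_mkcond [leRHS]big_mkcond/=; apply: ler_sum => y _.
  case: ifP => [/andP[? ?]|_]; last by case: ifP.
  by rewrite ifT//; apply/andP; split; [apply/andP; split|rewrite /tau]; lra.
have sE : \sum_(y <- [seq y <- Z | x < y <= x + T * rho]) lam y / (h + tau y) ^+ 2 <=
    \sum_(y <- Z | x < y) lam y / (y - z) ^+ 2.
  rewrite big_filter [leLHS]big_mkcond [leRHS]big_mkcond/=; apply: ler_sum => y _.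
  have -> : h + tau y = y - z by rewrite /h /tau; ring.
  have q0 : 0 <= lam y / (y - z) ^+ 2 by rewrite divr_ge0// sqr_ge0.
  by case: (x < y) => //=; case: ifP.
apply: (@le_trans _ _ (h * ((w x - e) / h - 2 * (w x - e) / (h + T * rho) - 6 * Cm * rho / h ^+ 2))); last first.
  by rewrite ler_pM2l//; exact: le_trans sE.
have hT : 0 < h + T * rho by lra.
have E (a b c d : R) : 0 < b -> 0 < d ->
    b * (a / b - 2 * a / d - c / b ^+ 2) = a - 2 * a * (b / d) - c / b.
  by move=> b0 d0; field; rewrite !gt_eqF.
rewrite E//.
have e1 : 6 * Cm * rho / h <= 6 * Cm / K.
  rewrite ler_pdivrMr// -[leLHS]mulrA.
  have -> : 6 * Cm / K * h = 6 * (Cm * (h / K)) by field; rewrite gt_eqF.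
  by rewrite ler_pM2l// ler_wpM2l// ler_pdivlMr// mulrC.
have e2 : h / (h + T * rho) <= 2 * K / T.
  rewrite ler_pdivrMr//.
  have : 2 * K * rho <= 2 * K / T * (h + T * rho).
    have -> : 2 * K / T * (h + T * rho) = 2 * K / T * h + 2 * K * rho by field; rewrite !gt_eqF.
    by rewrite lerDr mulr_ge0// ?(ltW h0)// divr_ge0 ?mulr_ge0// ltW.
  lra.
have e3 : (w x - e) * (h / (h + T * rho)) <= M * (2 * K / T).
  by rewrite ler_pM// divr_ge0// ltW.
have -> : 4 * M * K / T = 2 * (M * (2 * K / T)) by ring.
lra.
Qed.
End PointEstimates.

(** * Upper and lower estimate of the node term at [x] *)

Section Estimates.
Variable R : realType.
Implicit Types (p r F : {poly R}) (u x z t : R) (Z : seq R) (lam : R -> R).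
Variables (w w1 w2 : R -> R) (m M : R).
Hypotheses (nd1 : nondecreasing_fun w1) (nd2 : nondecreasing_fun w2).
Hypothesis wE : forall x, -1 <= x <= 1 -> w x = w1 x - w2 x.
Hypothesis m0 : 0 < m.
Hypothesis wm : forall x, -1 <= x <= 1 -> m <= w x <= M.
Local Notation L q := (itv_int q w (-1) 1).
Local Notation W t := (itv_int 1 w (-1) t).
Local Notation v t := (w1 t + w2 t).
Variables (n : nat) (x : R) (p : {poly R}) (Z : seq R) (lam : R -> R) (C Cm K T e : R).
Hypotheses (n2 : (2 <= n)%N) (xN1 : -1 < x) (x1 : x < 1).
Hypotheses (sp : (size p <= 2 * n)%N) (mp : major p x) (Lp1 : L p <= L 1).
Hypothesis Q : quadrature (fun q => L q) (2 * n) p x Z lam.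
Hypothesis Cm0 : 0 <= Cm.
Hypothesis mass : forall t, -1 <= t <= 1 ->
  \sum_(z <- Z | z <= t) lam z <= W t + Cm * res n t /\
  W t - Cm * res n t <= \sum_(z <- Z | z < t) lam z.
Local Notation g := (sn x).
Local Notation rho := (sn x / n%:R).
Hypotheses (C1 : 1 <= C) (K1 : 1 <= K) (KT : 4 * K <= T) (Tn : 8 * T <= n%:R * sn x).
Hypothesis pb : forall u, -1 <= u <= 1 -> p.[u] * sn u <= C * (sn x + sn u).
Hypothesis pb1 : forall u, -1 <= u <= 1 -> `|(p - 1).[u]| * sn u <= C * (sn x + sn u).
Hypothesis db : forall u, `|u - x| <= sn x ^+ 2 / 4 -> `|(p^`()).[u]| <= C * (n%:R / sn x).
Hypothesis osc : forall a b, x - 2 * T * rho <= a -> a <= b -> b <= x + 2 * T * rho ->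
  v b - v a <= e.

Let n0 : (0 < n)%N. Proof. exact: ltnW. Qed.
Let N0 : (0 : R) < n%:R. Proof. by rewrite ltr0n. Qed.
Let g0 : 0 < g. Proof. exact: sn_gt0. Qed.
Let rho0 : 0 < rho. Proof. by rewrite divr_gt0. Qed.
Let T1 : 1 <= T. Proof. by have := K1; have := KT; lra. Qed.
Let T0 : 0 < T. Proof. exact: lt_le_trans T1. Qed.
Let K0 : 0 <= K. Proof. exact: le_trans K1. Qed.
Let Tr0 : 0 < T * rho. Proof. exact: mulr_gt0. Qed.
Let Tr2 : T * rho < 2 * T * rho. Proof. by rewrite -mulrA ltr_pMl ?ltr1n. Qed.
Let Tn4 : 4 * T <= n%:R * g.
Proof. by apply: le_trans Tn; rewrite ler_pM2r ?ler_nat. Qed.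
Let Trho : 2 * T * rho <= g ^+ 2 / 4.
Proof. by rewrite mulrA ler_pdivrMr//; have := ler_wpM2l (ltW g0) Tn; lra. Qed.
Let ex : exact_on w n Z lam.
Proof.
have [uZ ZE lam0 LE] := Q; split => // z; rewrite ZE => /andP[] //.
Qed.

Lemma test_functional_bound F :
  F.[-1] = 0 -> F.[1] = 0 ->
  (forall u, -1 <= u <= 1 ->
    `|F.[u]| <= if `|u - x| <= T * rho then 6 * K * C else 20 * C * K / T) ->
  `|L F^`()| <= 20 * C * K / T * (v 1 - v (-1)) + 6 * K * C * e.
Proof.
move=> FN F1 B.
have [K1' C1' KT' T1' TR] : [/\ 1 <= K, 1 <= C, 4 * K <= T, 1 <= T & 2 * T * rho <= g ^+ 2 / 4] by [].
have T20 := ltW (lt_trans Tr0 Tr2).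
have na : `|x - 2 * T * rho - x| <= g ^+ 2 / 4 by rewrite addrAC subrr add0r normrN ger0_norm.
have nb : `|x + 2 * T * rho - x| <= g ^+ 2 / 4 by rewrite addrAC subrr add0r ger0_norm.
have /andP[a1 a2] := near_itv xN1 x1 na.
have /andP[b1 b2] := near_itv xN1 x1 nb.
have KC : 0 <= C * K by rewrite mulr_ge0// (le_trans ler01).
have cmp : 20 * C * K / T <= 6 * K * C.
  rewrite ler_pdivrMr//; have T4 : 4 <= T by apply: le_trans KT; rewrite ler_peMr.
  by have := ler_wpM2l KC T4; lra.
have KC6 : 0 <= 6 * K * C by rewrite -mulrA mulr_ge0// mulrC.
(* The cuts are at distance [2 T rho], strictly outside the radius [T rho], so the far bound holds
   up to the cut points. *)
have := @deriv_functional_bound _ w w1 w2 nd1 nd2 wE F (x - 2 * T * rho) (x + 2 * T * rho) (20 * C * K / T) (6 * K * C)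
   (ltW a1) (_ : x - 2 * T * rho <= x + 2 * T * rho) (ltW b2) FN F1.
have ab : x - 2 * T * rho <= x + 2 * T * rho by rewrite lerD2l ge0_cp.
move=> /(_ ab) H; apply: le_trans (H _ _ _) _ => [u uI|u uI|u uI|].
- have /andP[u1 u2] := uI; have := B u; rewrite (dist_gt_left Tr2 u2); apply.
  by rewrite u1 (le_trans u2 (ltW a2)).
- have /andP[u1 u2] := uI; have := B u; rewrite (dist_gt_right Tr2 u1); apply.
  by rewrite u2 (le_trans (ltW b1) u1).
- apply: le_trans (B u _) _; last by case: ifP.
  by have /andP[u1 u2] := uI; rewrite (le_trans (ltW a1) u1) (le_trans u2 (ltW b2)).
- by rewrite lerD2l ler_wpM2l//; apply: osc.
Qed.

Lemma scale_bound (h : R) : h <= 2 * K * rho -> h / g ^+ 2 <= 2 * K / (n%:R * g).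
Proof.
move=> hh; rewrite ler_pdivrMr ?exprn_gt0//.
by have -> : 2 * K / (n%:R * g) * g ^+ 2 = 2 * K * rho by field; rewrite !gt_eqF.
Qed.

Lemma upper_estimate z : z \in Z -> K * rho <= z - x -> z - x <= 2 * K * rho ->
  \sum_(y <- Z | y == x) lam y * - (p^`()).[x] <=
  w x + e + (6 * Cm / K + 8 * (M + 7 * Cm) * K / T) + 20 * C * K / T * (v 1 - v (-1)) + 6 * K * C * e
  + 4 * M * K / (n%:R * g) + 4 * K / (n%:R * g) * (M + e + (6 * Cm / K + 8 * (M + 7 * Cm) * K / T)).
Proof.
move=> zZ h1 h2; set X := 6 * Cm / K + _.
have [K1' C1' KT' T1' TR] : [/\ 1 <= K, 1 <= C, 4 * K <= T, 1 <= T & 2 * T * rho <= g ^+ 2 / 4] by [].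
have Kr : 0 < K * rho by rewrite mulr_gt0// (lt_le_trans ltr01).
have KTr := ler_wpM2r (ltW rho0) KT.
have h0 : 0 < z - x by lra.
have nz : `|z - x| <= g ^+ 2 / 4 by rewrite gtr0_norm//; lra.
have /andP[z1 z2] := near_itv xN1 x1 nz.
have x11 : -1 <= x <= 1 by rewrite (ltW xN1) (ltW x1).
have z11 : -1 <= z <= 1 by rewrite (ltW z1) (ltW z2).
have xz : x < z by lra.
have [r pE H] := upper_test (weight_lin nd1 nd2 wE) n0 xN1 xz z2 sp mp Q zZ.
set k := (z - x) / (1 - x ^+ 2) in H.
have kE : k = (z - x) / g ^+ 2 by rewrite /k sqr_sn.
have g20 : 0 < g ^+ 2 by rewrite exprn_gt0.
have k0 : 0 < k by rewrite kE divr_gt0.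
set F := - k *: _ in H.
have FV u : F.[u] = - k * ((1 - u ^+ 2) * ((u - z) * r.[u])).
  by rewrite /F !(horner_exp, hornerXsubC, hornerD, hornerN, hornerZ, hornerX, hornerC, hornerM).
have FN : F.[-1] = 0 by rewrite FV sqrrN expr1n subrr mul0r mulr0.
have F1 : F.[1] = 0 by rewrite FV expr1n subrr mul0r mulr0.
have FB := @test_poly_bounds _ n C K T (- k) p r x z n0 xN1 x1 C1 K1 KT Tn4 pE.
have LF : `|L F^`()| <= 20 * C * K / T * (v 1 - v (-1)) + 6 * K * C * e.
  apply: (test_functional_bound FN F1); apply: FB => //.
  - by rewrite gtr0_norm// h1 h2.
  - by rewrite normrN kE normrM [X in _ * X]gtr0_norm ?invr_gt0.
  - by move=> u u1; rewrite ger0_norm ?pb//; have [] := mp u1.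
have M0 : 0 < M by exact: (weight_ub_gt0 m0 wm).
have L1 : L 1 <= 2 * M.
  have N11 : -1 <= 1 :> R := le_trans (lerN10 R) ler01.
  by have /andP[_] := itv_mass_bounds nd1 nd2 wE (lexx (-1)) N11 (lexx 1) wm; rewrite opprK mulrC.
have ksc := scale_bound h2; rewrite -kE in ksc.
have ng0 : 0 < n%:R * g by rewrite mulr_gt0.
have Lp : k * L p <= 4 * M * K / (n%:R * g).
  apply: (@le_trans _ _ (k * (2 * M))); first by rewrite ler_pM2l//; exact: le_trans L1.
  have : k * (2 * M) <= 2 * K / (n%:R * g) * (2 * M) by rewrite ler_pM2r// mulr_gt0.
  have -> : 2 * K / (n%:R * g) * (2 * M) = 4 * M * K / (n%:R * g) by field; rewrite !gt_eqF.
  by [].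
have S := left_sum_bound nd1 nd2 wE m0 wm n2 xN1 x1 ex Cm0 mass T1 Tn osc K1 KT h1 h2.
set s := \sum_(y <- Z | y <= x) _ in H S.
have s0 : 0 <= s.
  by apply: sumr_ge0 => y _; rewrite divr_ge0 ?sqr_ge0//; have [] := Q.
(* The factor [1 - z^2] belongs to [z], the denominator of [k] to [x]; their ratio exceeds [1] by at
   most [2 k], which is [O(K / (n g))] by [scale_bound]. *)
have q1 : (1 - z ^+ 2) / g ^+ 2 <= 1 + 4 * K / (n%:R * g).
  have := sqr_sn_le x11 z11; rewrite (gtr0_norm h0) -(sqr_sn z11) => hs.
  have : sn z ^+ 2 / g ^+ 2 <= (g ^+ 2 + 2 * (z - x)) / g ^+ 2 by rewrite ler_pM2r ?invr_gt0.
  have -> : (g ^+ 2 + 2 * (z - x)) / g ^+ 2 = 1 + 2 * k by rewrite kE; field; rewrite gt_eqF.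
  have -> : 4 * K / (n%:R * g) = 2 * (2 * K / (n%:R * g)) by ring.
  by move=> q; apply: (le_trans q); rewrite lerD2l ler_pM2l.
have sX : (z - x) * s <= M + e + X.
  by apply: (le_trans S); rewrite -addrA -/X !lerD2r; have /andP[_] := wm x11.
have eta0 : 0 <= 4 * K / (n%:R * g) by rewrite divr_ge0 ?(ltW ng0)// mulr_ge0.
have q2 : k * (1 - z ^+ 2) * s <= w x + e + X + 4 * K / (n%:R * g) * (M + e + X).
  have -> : k * (1 - z ^+ 2) * s = (1 - z ^+ 2) / g ^+ 2 * ((z - x) * s) by rewrite kE; ring.
  apply: (@le_trans _ _ ((1 + 4 * K / (n%:R * g)) * ((z - x) * s))).
    by rewrite ler_wpM2r// mulr_ge0// ltW.
  rewrite mulrDl mul1r lerD//; last by rewrite ler_wpM2l.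
  by apply: (le_trans S); rewrite /X addrA.
apply: (le_trans H); move: LF; rewrite ler_norml lerNl => /andP[LF _].
apply: (le_trans (lerD (lerD LF Lp) q2)); rewrite le_eqVlt; apply/orP; left; apply/eqP.
by clear; move: (4 * M * K / _) (4 * K / _ * _) (20 * C * K / T * _) (6 * K * C * e) => a b c d; ring.
Qed.

Lemma lower_estimate z : e <= m -> z \in Z -> K * rho <= x - z -> x - z <= 2 * K * rho ->
  w x - e - 4 * M * K / T - 6 * Cm / K - 4 * K / (n%:R * g) * M
  - (20 * C * K / T * (v 1 - v (-1)) + 6 * K * C * e) <=
  \sum_(y <- Z | y == x) lam y * - (p^`()).[x].
Proof.
move=> em zZ h1 h2.
have [K1' C1' KT' T1' TR] : [/\ 1 <= K, 1 <= C, 4 * K <= T, 1 <= T & 2 * T * rho <= g ^+ 2 / 4] by [].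
have Kr : 0 < K * rho by rewrite mulr_gt0// (lt_le_trans ltr01).
have KTr := ler_wpM2r (ltW rho0) KT.
have h0 : 0 < x - z by lra.
have nz : `|z - x| <= g ^+ 2 / 4 by rewrite distrC gtr0_norm//; lra.
have /andP[z1 z2] := near_itv xN1 x1 nz.
have x11 : -1 <= x <= 1 by rewrite (ltW xN1) (ltW x1).
have z11 : -1 <= z <= 1 by rewrite (ltW z1) (ltW z2).
have zx : z < x by lra.
have [r pE H] := lower_test (weight_lin nd1 nd2 wE) n0 z1 zx x1 sp mp Q zZ.
set k := (x - z) / (1 - x ^+ 2) in H.
have kE : k = (x - z) / g ^+ 2 by rewrite /k sqr_sn.
have g20 : 0 < g ^+ 2 by rewrite exprn_gt0.
have k0 : 0 < k by rewrite kE divr_gt0.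
set F := k *: _ in H.
have FV u : F.[u] = k * ((1 - u ^+ 2) * ((u - z) * r.[u])).
  by rewrite /F !(horner_exp, hornerXsubC, hornerD, hornerN, hornerZ, hornerX, hornerC, hornerM).
have FN : F.[-1] = 0 by rewrite FV sqrrN expr1n subrr mul0r mulr0.
have F1 : F.[1] = 0 by rewrite FV expr1n subrr mul0r mulr0.
have FB := @test_poly_bounds _ n C K T k (p - 1) r x z n0 xN1 x1 C1 K1 KT Tn4 pE.
have LF : `|L F^`()| <= 20 * C * K / T * (v 1 - v (-1)) + 6 * K * C * e.
  apply: (test_functional_bound FN F1); apply: FB => //.
  - by rewrite distrC gtr0_norm// h1 h2.
  - by rewrite kE normrM distrC [X in _ * X]gtr0_norm ?invr_gt0.
  - by move=> u ux; rewrite derivB derivC subr0 db.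
have M0 : 0 < M by exact: (weight_ub_gt0 m0 wm).
have ksc := scale_bound h2; rewrite -kE in ksc.
have ng0 : 0 < n%:R * g by rewrite mulr_gt0.
have Lp : 0 <= - k * (L p - L 1) by rewrite mulNr -mulrN mulr_ge0 ?(ltW k0)// opprB subr_ge0.
have S := right_sum_bound nd1 nd2 wE wm n2 xN1 x1 ex Cm0 mass T1 Tn osc K1 KT em h1 h2.
set s := \sum_(y <- Z | x < y) _ in H S.
set Y := w x - e - 4 * M * K / T - 6 * Cm / K in S *.
have s0 : 0 <= s.
  by apply: sumr_ge0 => y _; rewrite divr_ge0 ?sqr_ge0//; have [] := Q.
have eE : 4 * K / (n%:R * g) = 2 * (2 * K / (n%:R * g)) by ring.
have q1 : 1 - 4 * K / (n%:R * g) <= (1 - z ^+ 2) / g ^+ 2.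
  have := sqr_sn_le z11 x11; rewrite (gtr0_norm h0) -(sqr_sn z11) => hs.
  have : (g ^+ 2 - 2 * (x - z)) / g ^+ 2 <= sn z ^+ 2 / g ^+ 2.
    by rewrite ler_pM2r ?invr_gt0// lerBlDr.
  have -> : (g ^+ 2 - 2 * (x - z)) / g ^+ 2 = 1 - 2 * k by rewrite kE; field; rewrite gt_eqF.
  by move=> q; apply: le_trans q; rewrite lerD2l lerN2 eE ler_pM2l.
have eta0 : 0 <= 4 * K / (n%:R * g) by rewrite divr_ge0 ?(ltW ng0)// mulr_ge0.
have eta1 : 4 * K / (n%:R * g) <= 1.
  rewrite ler_pdivrMr// mul1r; apply: (le_trans KT); apply: le_trans Tn4.
  by rewrite ler_peMl ?ler1n// ltW.
have e0 : 0 <= e.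
  have T20 := ltW (lt_trans Tr0 Tr2).
  have h : v x - v x <= e by apply: osc; rewrite ?gerBl ?lerDl.
  by rewrite subrr in h.
have YM : Y <= M.
  have /andP[_ ?] := wm x11.
  rewrite /Y -!addrA -[leRHS]addr0 lerD// -!opprD oppr_le0 !addr_ge0//.
    by rewrite divr_ge0 ?(ltW T0)// !mulr_ge0// ltW.
  by rewrite divr_ge0// mulr_ge0.
have q2 : Y - 4 * K / (n%:R * g) * M <= k * (1 - z ^+ 2) * s.
  have -> : k * (1 - z ^+ 2) * s = (1 - z ^+ 2) / g ^+ 2 * ((x - z) * s) by rewrite kE; ring.
  apply: (@le_trans _ _ ((1 - 4 * K / (n%:R * g)) * ((x - z) * s))); last first.
    by rewrite ler_wpM2r// mulr_ge0// ltW.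
  apply: (@le_trans _ _ ((1 - 4 * K / (n%:R * g)) * Y)); last by rewrite ler_wpM2l// subr_ge0.
  by rewrite mulrBl mul1r lerD2l lerN2; exact: ler_wpM2l.
apply: le_trans H.
move: LF; rewrite ler_norml => /andP[_ LF].
rewrite [leRHS]addrC; apply: lerD => //; rewrite -[leLHS]addr0.
by apply: lerD; [rewrite lerN2|rewrite -mulNr].
Qed.
End Estimates.

(** * Choice of the scales and conclusion *)

Lemma extremal_polynomial (R : realType) (w w1 w2 : R -> R) (m M : R) :
  nondecreasing_fun w1 -> nondecreasing_fun w2 ->
  (forall x, -1 <= x <= 1 -> w x = w1 x - w2 x) ->
  0 < m -> (forall x, -1 <= x <= 1 -> m <= w x <= M) ->
  exists2 C : R, 0 <= C & forall n x, (2 <= n)%N -> -1 < x -> x < 1 -> C < n%:R * sn x ->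
  exists (p : {poly R}) (Z : seq R) (lam : R -> R),
    [/\ [/\ (size p <= 2 * n)%N, major p x, p != 0 & itv_int p w (-1) 1 <= itv_int 1 w (-1) 1],
      quadrature (fun q => itv_int q w (-1) 1) (2 * n) p x Z lam &
      pint p - (1 + x) <= C * res n x].
Proof.
move=> nd1 nd2 wE m0 wm; have [c c0 H] := crude_majorant R.
have M0 := weight_ub_gt0 m0 wm.
pose L q := itv_int q w (-1) 1.
have lL : lin_form L by exact: (weight_lin nd1 nd2 wE).
have Lm (q : {poly R}) : (forall u, -1 <= u <= 1 -> 0 <= q.[u]) -> m * pint q <= L q.
  by move=> /(weight_bounds nd1 nd2 wE wm)/andP[].
have Mc0 : 0 < M * c by rewrite mulr_gt0.
exists (1 + 4 * (M * c) / m); first by rewrite addr_ge0// divr_ge0 ?mulr_ge0// ltW.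
move=> n x n2 xN1 x1 ng.
have x11 : -1 <= x <= 1 by rewrite !ltW.
have n0 : (0 < n)%N by exact: ltnW.
have N0 : (0 : R) < n%:R by rewrite ltr0n.
have nn0 : (0 < 2 * n)%N by rewrite muln_gt0.
have g0 := sn_gt0 xN1 x1.
have q0 : 0 <= 4 * (M * c) / m by rewrite divr_ge0 ?mulr_ge0 ?ltW.
have [p [sp mp pmin]] := minimizer lL m0 Lm x nn0.
have [P [sP mP IP]] := H n x n2 x11.
have /andP[lP uP] := @weight_major_bounds _ w w1 w2 m M nd1 nd2 wE wm P (-1) x (lexx _) (ltW xN1) (ltW x1)
  (fun u uI => (mP u uI).1) (fun u uI => (mP u ltac:(lra)).2 ltac:(lra)).
have /andP[lp up] := @weight_major_bounds _ w w1 w2 m M nd1 nd2 wE wm p (-1) x (lexx _) (ltW xN1) (ltW x1)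
  (fun u uI => (mp u uI).1) (fun u uI => (mp u ltac:(lra)).2 ltac:(lra)).
have pP := pmin P sP mP; rewrite /L in pP.
have uP' : M * (pint P - (1 + x)) <= M * (c * res n x) by rewrite ler_pM2l.
have M1 : major 1 x by move=> u _; rewrite hornerC.
have r2 : res n x <= 2 * (sn x / n%:R) by apply: res_center_le => //; lra.
have rr : M * c * res n x <= M * c * (2 * (sn x / n%:R)) by rewrite ler_pM2l.
(* The constant [1] wastes at least [m (1 - x) >= m g^2 / 2], the crude majorant at most
   [2 M c g / n] with [g = sn x]. Once [n g] exceeds [4 M c / m], the minimizer is not [1] and its
   contact set is finite. *)
have strict : L p < L 1.
  rewrite /L (itv_int_split nd1 nd2 wE 1 (lexx (-1)) (ltW xN1) (ltW x1) (lexx 1)).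
  have /andP[h _] := itv_mass_bounds nd1 nd2 wE (ltW xN1) (ltW x1) (lexx 1)
    (fun u uI => wm u ltac:(lra)).
  have s2 : sn x ^+ 2 <= 2 * (1 - x) by rewrite sqr_sn//; nra.
  have : M * c * (2 * (sn x / n%:R)) < m * (sn x ^+ 2 / 2).
    have -> : m * (sn x ^+ 2 / 2) = (m * (n%:R * sn x)) * (sn x / n%:R / 2) by field; rewrite gt_eqF.
    have -> : M * c * (2 * (sn x / n%:R)) = 4 * (M * c) * (sn x / n%:R / 2) by field; rewrite gt_eqF.
    by rewrite ltr_pM2r ?divr_gt0// [ltRHS]mulrC -ltr_pdivrMr//; lra.
  have : m * (sn x ^+ 2 / 2) <= m * (1 - x) by rewrite ler_pM2l//; lra.
  lra.
have p0 : p != 0.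
  apply/eqP => p0; have [|_ h] := mp (-1); first by lra.
  by have := h (ltW xN1); rewrite p0 horner0 ler10.
have p1 : p != 1 by apply: contraTneq strict => ->; rewrite ltxx.
have [Z [lam Q]] := minimizer_quadrature lL nn0 xN1 (ltW x1) sp mp pmin p0 p1.
exists p, Z, lam; split => //; first by split => //; exact: ltW.
rewrite -(ler_pM2l m0); apply: (@le_trans _ _ (M * c * res n x)); first lra.
have -> : m * ((1 + 4 * (M * c) / m) * res n x) = (m + 4 * (M * c)) * res n x by field; rewrite gt_eqF.
by rewrite ler_wpM2r ?(ltW (res_gt0 _ _))//; lra.
Qed.

(** Near [x] the resolution is at most [3 rho], so the error [Cn * res] is at most [K rho / 2]
    because [6 Cn <= K]. *)
Lemma nodes_near (R : realType) (Cn K : R) n x (Z : seq R) : (0 < n)%N -> -1 < x -> x < 1 ->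
  0 <= Cn -> 1 <= K -> 6 * Cn <= K -> 22 * K <= n%:R * sn x ->
  (forall t, -1 <= t <= 1 -> exists2 z, z \in Z & `|z - t| <= Cn * res n t) ->
  forall c : R, `|c| <= 5 -> exists2 z, z \in Z & `|z - x - c * K * (sn x / n%:R)| <= K * (sn x / n%:R) / 2.
Proof.
move=> n0 xN1 x1 Cn0 K1 KC Kn node c c5.
have N0 : (0 : R) < n%:R by rewrite ltr0n.
have g0 := sn_gt0 xN1 x1.
have rho0 : 0 < sn x / n%:R by rewrite divr_gt0.
have K0 : 0 < K by lra.
have near : `|x + c * K * (sn x / n%:R) - x| <= sn x ^+ 2 / 4.
  rewrite addrAC subrr add0r normrM normrM (gtr0_norm rho0) (gtr0_norm K0).
  apply: (@le_trans _ _ (5 * K * (sn x / n%:R))).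
    by rewrite ler_wpM2r ?(ltW rho0)// ler_wpM2r// ltW.
  rewrite mulrA ler_pdivrMr//; have := ler_wpM2l (ltW g0) Kn.
  have : 0 <= K * sn x by rewrite mulr_ge0// ltW.
  lra.
have /andP[t1 t2] := near_itv xN1 x1 near.
have [|z zZ zt] := node (x + c * K * (sn x / n%:R)); first by rewrite !ltW.
exists z => //.
have ng1 : 1 <= n%:R * sn x by lra.
have := res_near_le n0 xN1 x1 ng1 near => /(ler_wpM2l Cn0) h.
rewrite -addrA -opprD; apply: (le_trans zt); apply: (le_trans h).
have : 6 * Cn * (sn x / n%:R) <= K * (sn x / n%:R) by rewrite ler_wpM2r// ltW.
lra.
Qed.

Lemma major_sub1_bound (R : realType) (p : {poly R}) x (C u : R) : major p x -> -1 <= u <= 1 ->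
  p.[u] * sn u <= C * (sn x + sn u) -> `|(p - 1).[u]| * sn u <= (C + 1) * (sn x + sn u).
Proof.
move=> mp u1 pb; have [p0 _] := mp u u1; have s0 := sn_ge0 u; have g0 := sn_ge0 x.
have h : `|(p - 1).[u]| <= p.[u] + 1.
  by rewrite hornerD hornerN hornerC ler_norml; clear pb; apply/andP; split; lra.
apply: (le_trans (ler_wpM2r s0 h)); clear h u1; lra.
Qed.

Lemma exists_scales (R : realType) (M V C Cm Cn m e0 : R) : 0 < M -> 0 <= V -> 1 <= C -> 0 <= Cm ->
  0 <= Cn -> 0 < m -> 0 < e0 ->
  exists K T e : R, [/\ [/\ 1 <= K, 6 * Cn <= K, 6 * Cm / K <= e0 & 4 * K <= T],
    [/\ 8 * (M + 7 * Cm) * K / T <= e0, 20 * C * K / T * V <= e0 & 4 * M * K / T <= e0] &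
    [/\ 0 < e, e <= m & (6 * K * C + 1) * e <= e0]].
Proof.
move=> M0 V0 C1 Cm0 Cn0 m0 e00.
have [K [K1 KCn Ce1]] : exists K : R, [/\ 1 <= K, 6 * Cn <= K & 6 * Cm / K <= e0].
  have q0 : 0 <= 6 * Cm / e0 by rewrite divr_ge0 ?mulr_ge0// ltW.
  exists (1 + 6 * Cn + 6 * Cm / e0); split; [lra|lra|].
  rewrite ler_pdivrMr; last lra.
  by rewrite mulrDr mulrCA mulfV ?gt_eqF// mulr1 lerDr mulr_ge0// ?(ltW e00)//; lra.
have K0 : 0 < K by lra.
have c10 : 0 <= 20 * C * K * V by rewrite !mulr_ge0//; lra.
have c20 : 0 <= 8 * (M + 7 * Cm) * K by rewrite !mulr_ge0//; lra.
have c30 : 0 <= 4 * M * K by rewrite !mulr_ge0//; lra.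
pose T := 4 * K + (20 * C * K * V + 8 * (M + 7 * Cm) * K + 4 * M * K) / e0.
have T4 : 4 * K <= T by rewrite /T lerDl divr_ge0 ?addr_ge0// ltW.
have T0 : 0 < T by lra.
have smallT c : 0 <= c -> c <= 20 * C * K * V + 8 * (M + 7 * Cm) * K + 4 * M * K -> c / T <= e0.
  move=> c0 cc; rewrite ler_pdivrMr// [leRHS]mulrC -ler_pdivrMr//.
  apply: (le_trans (ler_wpM2r (_ : 0 <= e0^-1) cc)); first by rewrite invr_ge0 ltW.
  by rewrite /T lerDr mulr_ge0// ltW.
have KC0 : 0 < 6 * K * C + 1 by rewrite ltr_wpDl// !mulr_ge0//; lra.
clearbody T.
exists K, T, (Num.min m (e0 / (6 * K * C + 1))); split; split => //.
- by apply: smallT; lra.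
- by rewrite mulrAC; apply: smallT; lra.
- by apply: smallT; lra.
- by rewrite lt_min m0 divr_gt0.
- by rewrite ge_min lexx.
- by rewrite mulrC -ler_pdivlMr// ge_min lexx orbT.
Qed.

(** The two nodes beyond [x] supply the critical point for [derive_eq_node]: [p] vanishes at both
    and is nonnegative between them, so it has a positive maximum there, which is not a contact
    point. *)
Lemma derive_pi_node (R : realType) (w w1 w2 : R -> R) (m M : R) n (x za zb : R) (p : {poly R}) Z (lam : R -> R) :
  nondecreasing_fun w1 -> nondecreasing_fun w2 ->
  (forall x, -1 <= x <= 1 -> w x = w1 x - w2 x) ->
  0 < m -> (forall x, -1 <= x <= 1 -> m <= w x <= M) ->
  (0 < n)%N -> -1 < x -> x < 1 -> derivable (pi_fun w n) x 1 ->
  (size p <= 2 * n)%N -> major p x -> p != 0 ->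
  quadrature (fun q => itv_int q w (-1) 1) (2 * n) p x Z lam ->
  za \in Z -> zb \in Z -> x < za -> za < zb ->
  derive1 (pi_fun w n) x = \sum_(y <- Z | y == x) lam y * - (p^`()).[x].
Proof.
move=> nd1 nd2 wE m0 wm n0 xN1 x1 dpi sp mp p0 Q zaZ zbZ xza zab.
have w0 u : -1 <= u <= 1 -> 0 <= w u by move=> /wm /andP[h _]; exact: le_trans (ltW m0) h.
have [uZ ZE lam0 LE] := Q.
have pi_eq := pi_fun_eq nd1 nd2 wE w0 sp mp Q.
have pi_le t (P : {poly R}) : (size P <= 2 * n)%N -> major P t -> pi_fun w n t <= itv_int P w (-1) 1.
  exact: (pi_fun_le nd1 nd2 wE w0).
have rightz z : z \in Z -> x < z -> p.[z] = 0.
  by rewrite ZE /touch => /andP[_ +] xz; rewrite (leNgt z x) xz => /eqP.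
have zb1 : zb <= 1 by move: zbZ; rewrite ZE => /andP[/andP[]].
have xzb := lt_trans xza zab.
have [y [/andP[y1 y2] py dy]] : exists y, [/\ za < y < zb, 0 < p.[y] & (p^`()).[y] = 0].
  apply: exists_interior_max; rewrite ?rightz// => u /andP[u1 u2].
  have [|//] := mp u; rewrite (le_trans u2 zb1) andbT.
  exact: le_trans (ltW xN1) (le_trans (ltW xza) u1).
have xy := lt_trans xza y1.
have yZ : y \notin Z by apply/negP => yZ; move: py; rewrite rightz ?ltxx.
have yx : y != x by rewrite gt_eqF.
exact: (derive_eq_node (weight_lin nd1 nd2 wE) n0 xN1 x1 sp mp pi_eq pi_le dpi Q dy yZ yx).
Qed.

(** The window has length [4 T rho <= 4 T / n], which is below [d] because [4 T / d < G <= n]; it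
    avoids the points [s i] because [4 T <= G <= G^2]. *)
Lemma oscillation_near (R : realType) (v : R -> R) (L : nat) (s : nat -> R) (T G d e : R) n x :
  (forall a b, -1 <= a -> a <= b -> b <= 1 -> b - a < d ->
     (forall i, (i < L)%N -> s i < a \/ b < s i) -> v b - v a <= e) ->
  (0 < n)%N -> -1 < x -> x < 1 -> 0 < T -> 0 < d -> 8 * T <= n%:R * sn x ->
  1 <= G -> 4 * T <= G -> 4 * T / d < G -> G <= n%:R ->
  (forall i, (i < L)%N -> G ^+ 2 / n%:R <= `|s i - x|) ->
  forall a b, x - 2 * T * (sn x / n%:R) <= a -> a <= b -> b <= x + 2 * T * (sn x / n%:R) ->
  v b - v a <= e.
Proof.
move=> oscd n0 xN1 x1 T0 d0 Tn G1 TG TdG GN hs a b xa ab bx.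
have N0 : (0 : R) < n%:R by rewrite ltr0n.
have g0 := sn_gt0 xN1 x1.
have rho0 : 0 < sn x / n%:R by rewrite divr_gt0.
have Tr0 : 0 < T * (sn x / n%:R) by rewrite mulr_gt0.
have rhoN : T * (sn x / n%:R) <= T / n%:R.
  by rewrite ler_pM2l// ler_piMl ?sn_le1// invr_ge0 ltW.
have Trho : 2 * T * (sn x / n%:R) <= sn x ^+ 2 / 4.
  by rewrite mulrA ler_pdivrMr//; have := ler_wpM2l (ltW g0) Tn; clear -T0; lra.
have TN : T / n%:R * 4 < d.
  by rewrite mulrAC ltr_pdivrMr// [ltRHS]mulrC -ltr_pdivrMr// [T * 4]mulrC (lt_le_trans TdG).
have GG : T / n%:R * 4 <= G ^+ 2 / n%:R.
  rewrite mulrAC ler_pM2r ?invr_gt0// mulrC (le_trans TG)// expr2 ler_peMl//.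
  exact: le_trans ler01 G1.
move: oscd hs xa bx Tr0 rhoN Trho TN GG => oscd hs.
have -> : 2 * T * (sn x / n%:R) = 2 * (T * (sn x / n%:R)) by rewrite -mulrA.
move: (T * (sn x / n%:R)) (T / n%:R) (G ^+ 2 / n%:R) hs => r q G' hs xa bx r0 rq rg qd qG.
clear TdG TG G1 GN Tn T0 N0 rho0.
have na : `|x - 2 * r - x| <= sn x ^+ 2 / 4.
  by rewrite addrAC subrr add0r normrN gtr0_norm//; lra.
have nb : `|x + 2 * r - x| <= sn x ^+ 2 / 4.
  by rewrite addrAC subrr add0r gtr0_norm//; lra.
have /andP[l1 _] := near_itv xN1 x1 na; have /andP[_ r1] := near_itv xN1 x1 nb.
apply: oscd => //; try lra.
move=> i iL; have := hs i iL.
rewrite ler_normr => /orP[h'|h']; [right|left]; lra.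
Qed.

(** The upper estimate has six errors of size [e0], with [e] counted together with [a6] and all
    terms in [eta] counted as one; the lower estimate has fewer. *)
Lemma error_budget (R : realType) (P wx e e0 a1 a2 a3 a4 a5 a6 eta M : R) :
  0 <= e -> 0 <= a6 -> 0 <= eta ->
  a1 <= e0 -> a2 <= e0 -> a3 <= e0 -> a4 <= e0 -> a5 <= e0 -> a6 + e <= e0 ->
  0 <= M -> 0 <= e0 -> eta * (M + 3 * e0) <= e0 ->
  P <= wx + e + (a1 + a2) + a3 + a6 + a4 + eta * (M + e + (a1 + a2)) ->
  wx - e - a5 - a1 - eta * M - (a3 + a6) <= P ->
  `|P - wx| <= 6 * e0.
Proof.
move=> e1 h6 eta0 h1 h2 h3 h4 h5 h7 M0 e00 he up lo.
have k1 : eta * (M + e + (a1 + a2)) <= eta * (M + 3 * e0) by rewrite ler_wpM2l//; lra.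
have k2 : eta * M <= eta * (M + 3 * e0) by rewrite ler_wpM2l//; lra.
move: (eta * (M + e + _)) (eta * (M + 3 * e0)) (eta * M) he up lo k1 k2 => b1 b2 b3 he up lo k1 k2.
by rewrite ler_norml; apply/andP; split; lra.
Qed.

Theorem theorem1p3 (R : realType) (w : R -> R) (m : R) (L : nat) (s : nat -> R) :
  admissible_weight w m L s ->
  forall eps : R, 0 < eps ->
  exists2 C : R, 0 < C &
    forall n : nat, (1 <= n)%N ->
    forall x : R, -1 < x < 1 ->
      derivable (pi_fun w n) x 1 ->
      C / (n%:R ^+ 2) <= 1 - x ^+ 2 ->
      (forall i, (i < L)%N -> C / n%:R <= `|s i - x|) ->
      `|derive1 (pi_fun w n) x - w x| <= eps.
Proof.
move=> adm eps eps0; have [m0 [_ [_ [wmin _]]]] := adm.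
have [w1 [w2 [nd1 nd2 wE osc]]] := weight_decomposition adm.
have [M wm] : exists M, forall x, -1 <= x <= 1 -> m <= w x <= M.
  exists (w1 1 - w2 (-1)) => x x11; rewrite wmin//= wE//; have /andP[a b] := x11.
  by rewrite lerB//; [exact: nd1|exact: nd2].
have M0 := weight_ub_gt0 m0 wm.
have V0 : 0 <= w1 1 + w2 1 - (w1 (-1) + w2 (-1)).
  have N11 : -1 <= 1 :> R by lra.
  by rewrite subr_ge0 lerD//; [exact: nd1|exact: nd2].
have [Cm Cm0 mass] := mass_bounds nd1 nd2 wE m0 wm.
have [Cn Cn0 node] := node_near nd1 nd2 wE m0 wm.
have [Ce Ce0 extremal] := extremal_polynomial nd1 nd2 wE m0 wm.
have [Cb Cb1 local] := major_local_bounds Ce0.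
have [e0 e00 epsE] : exists2 e0 : R, 0 < e0 & eps = 6 * e0.
  by exists (eps / 6); rewrite ?divr_gt0// mulrC divfK.
have C1 : 1 <= Cb + 1 by rewrite lerDr (le_trans ler01).
have [K [T [e [[K1 KCn a1 T4] [a2 a3 a5] [e_gt0 em eK]]]]] :=
  exists_scales M0 V0 C1 (ltW Cm0) (ltW Cn0) m0 e00.
have [d d0 oscd] := osc e e_gt0.
have K0 : 0 < K := lt_le_trans ltr01 K1.
have T0 : 0 < T by rewrite (lt_le_trans _ T4)// mulr_gt0.
have [G [[G1 GK GT GC] [Gd G3 G4 G2]]] : exists G : R,
    [/\ [/\ 1 <= G, 22 * K <= G, 8 * T <= G & Ce < G] &
     [/\ 4 * T / d < G, 4 * M * K <= e0 * G, 4 * K * (M + 3 * e0) <= e0 * G & 2 <= G]].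
  clear -K0 T0 d0 M0 e00 Ce0.
  have k1 : 0 <= 4 * T / d by rewrite divr_ge0 ?mulr_ge0 ?ltW.
  have k2 : 0 <= 4 * M * K by rewrite !mulr_ge0 ?ltW.
  have k3 : 0 <= 4 * K * (M + 3 * e0) by rewrite ltW// mulr_gt0// ?mulr_gt0// addr_gt0// mulr_gt0.
  have q2 : 0 <= 4 * M * K / e0 by rewrite (divr_ge0 k2)// ltW.
  have q3 : 0 <= 4 * K * (M + 3 * e0) / e0 by rewrite (divr_ge0 k3)// ltW.
  pose G := 22 * K + 8 * T + Ce + 4 * T / d + 4 * M * K / e0 + 4 * K * (M + 3 * e0) / e0 + 2.
  exists G; split; split; rewrite ?[e0 * G]mulrC -?ler_pdivrMr// /G; lra.
(* With the constant [G^2] the condition on [1 - x^2] reads [G <= n sn x]. *)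
exists (G ^+ 2); first by rewrite exprn_gt0// (lt_le_trans ltr01).
move=> n n0 x /andP[xN1 x1] dpi hx hs.
have N0 : (0 : R) < n%:R by rewrite ltr0n.
have G0 : 0 < G := lt_le_trans ltr01 G1.
have gx := sn_gt0 xN1 x1.
have ng0 : 0 < n%:R * sn x by rewrite mulr_gt0.
have x11 : -1 <= x <= 1 by rewrite !ltW.
have Gn : G <= n%:R * sn x.
  rewrite -(ler_pXn2r (ltn0Sn 1)) ?nnegrE ?(ltW G0) ?(ltW ng0)//.
  by rewrite exprMn sqr_sn// mulrC -ler_pdivrMr// exprn_gt0.
have GN : G <= n%:R by apply: (le_trans Gn); rewrite ler_piMr ?sn_le1// ltW.
(* The kernels need [n >= 2]; for [n = 1] no [x] qualifies, since [2 <= G <= n]. *)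
have n2 : (2 <= n)%N by rewrite -(ler_nat R) (le_trans G2).
have [p [Z [lam [[sp mp p0 Lp1] Q Ip]]]] := extremal n x n2 xN1 x1 (lt_le_trans GC Gn).
have [uZ ZE lam0 LE] := Q.
have ex : exact_on w n Z lam by split => // z; rewrite ZE => /andP[].
have rho0 : 0 < sn x / n%:R by rewrite divr_gt0.
have nodes := nodes_near n0 xN1 x1 (ltW Cn0) K1 KCn (le_trans GK Gn) (node n Z lam ^~ n2 ^~ ex).
have Kr0 : 0 < K * (sn x / n%:R) by rewrite mulr_gt0.
(* In units of [K rho] nodes are located up to [1 / 2]: the targets [3 / 2] and [- 3 / 2] give
   distances between [1] and [2], and the target [5] a node beyond [za]. *)
have [za [zb [zc [[zaZ zbZ zcZ] [za1 za2 zab] [zc1 zc2]]]]] : exists za zb zc,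
    [/\ [/\ za \in Z, zb \in Z & zc \in Z],
     [/\ K * (sn x / n%:R) <= za - x, za - x <= 2 * K * (sn x / n%:R) & za < zb] &
     K * (sn x / n%:R) <= x - zc /\ x - zc <= 2 * K * (sn x / n%:R)].
  clear -nodes Kr0.
  have [|za zaZ] := nodes (3 / 2); first by rewrite ger0_norm; lra.
  have [|zb zbZ] := nodes 5; first by rewrite ger0_norm; lra.
  have [|zc zcZ] := nodes (- (3 / 2)); first by rewrite normrN ger0_norm; lra.
  have E c : c * K * (sn x / n%:R) = c * (K * (sn x / n%:R)) by rewrite -mulrA.
  clear nodes; rewrite !ler_norml !E; clear E; move: Kr0; move: (K * _) => r r0.
  move=> /andP[d1 d2] /andP[b1 b2] /andP[a1 a2].
  by exists za, zb, zc; split; split => //; lra.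
have xza : x < za by rewrite -subr_gt0 (lt_le_trans Kr0).
have dE := derive_pi_node nd1 nd2 wE m0 wm n0 xN1 x1 dpi sp mp p0 Q zaZ zbZ xza zab.
have [pb db] := local n p x n2 sp xN1 x1 (le_trans G1 Gn) mp Ip.
have Cle : Cb <= Cb + 1 by rewrite lerDl.
have pb' u : -1 <= u <= 1 -> p.[u] * sn u <= (Cb + 1) * (sn x + sn u).
  by move=> u1; rewrite (le_trans (pb u u1))// ler_wpM2r// addr_ge0 ?sn_ge0.
have pb1 u : -1 <= u <= 1 -> `|(p - 1).[u]| * sn u <= (Cb + 1) * (sn x + sn u).
  by move=> u1; apply: (major_sub1_bound mp u1); exact: pb.
have db' u : `|u - x| <= sn x ^+ 2 / 4 -> `|(p^`()).[u]| <= (Cb + 1) * (n%:R / sn x).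
  by move=> ux; rewrite (le_trans (db u ux))// ler_wpM2r// divr_ge0// ltW.
have T4G : 4 * T <= G by rewrite (le_trans _ GT)// ler_pM2r// ler_nat.
have osc' := oscillation_near oscd n0 xN1 x1 T0 d0 (le_trans GT Gn) G1 T4G Gd GN hs.
have up := upper_estimate nd1 nd2 wE m0 wm n2 xN1 x1 sp mp Lp1 Q (ltW Cm0)
  (mass n Z lam ^~ n2 ^~ ex) C1 K1 T4 (le_trans GT Gn) pb' db' osc' zaZ za1 za2.
have lo := lower_estimate nd1 nd2 wE m0 wm n2 xN1 x1 sp mp Lp1 Q (ltW Cm0)
  (mass n Z lam ^~ n2 ^~ ex) C1 K1 T4 (le_trans GT Gn) pb1 db' osc' em zcZ zc1 zc2.
rewrite -dE in up lo.
have small c : c <= e0 * G -> c / (n%:R * sn x) <= e0.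
  by move=> cG; rewrite ler_pdivrMr// (le_trans cG)// ler_pM2l.
rewrite epsE.
apply: error_budget up lo => //.
- exact: ltW.
- by rewrite !mulr_ge0// ltW// (lt_le_trans ltr01).
- by rewrite divr_ge0 ?mulr_ge0// ltW.
- exact: small.
- by move: eK; rewrite mulrDl mul1r.
- exact: ltW.
- exact: ltW.
- by rewrite mulrAC; exact: small.
Qed.
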